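(* Assume that $V_1$ has the normal distribution $\mathcal{N}(0,\sigma^2)$ with $\sigma^2>0$, that there exists $t>0$ such that $\mathbb{E}[\exp(t\varepsilon_0^2)]<\infty$ and $\mathbb{E}[\exp(tX_0^2)]<\infty$, and that $\theta\ne-\rho$. Then the sequence $$\left(\frac{\sqrt n}{b_n}\begin{pmatrix}\widehat\theta_n-\theta^*\\ \widehat\rho_n-\rho^*\end{pmatrix}\right)_{n\ge1}$$ satisfies a large deviation principle on $\mathbb{R}^2$ with speed $b_n^2$ and good rate function $K(x)=\frac12x'\Gamma^{-1}x$, where $$\Gamma=\begin{pmatrix}\sigma_\theta^2&\theta\rho\,\sigma_\theta^2\\ \theta\rho\,\sigma_\theta^2&\sigma_\rho^2\end{pmatrix}.$$ In particular, the sequence $\left(\frac{\sqrt n}{b_n}(\widehat\rho_n-\rho^* )\right)_{n\ge1}$ satisfies a large deviation principle on $\mathbb{R}$ with speed $b_n^2$ and good rate function $I_\rho(x)=\dfrac{x^2}{2\sigma_\rho^2}$.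
   Context: Model: for all $n\ge1$, $X_n=\theta X_{n-1}+\varepsilon_n$ and $\varepsilon_n=\rho\,\varepsilon_{n-1}+V_n$, where $\theta,\rho$ are real parameters with $|\theta|<1$, $|\rho|<1$, $(V_n)_{n\ge1}$ is a sequence of i.i.d. real random variables with zero mean and positive variance $\sigma^2$, and the square-integrable real initial values $X_0,\varepsilon_0$ are arbitrary. Estimators: $\widehat\theta_n=\dfrac{\sum_{k=1}^n X_kX_{k-1}}{\sum_{k=1}^n X_{k-1}^2}$; for fixed $n$, the residuals are $\widehat\varepsilon_k=X_k-\widehat\theta_nX_{k-1}$ for $1\le k\le n$ and $\widehat\varepsilon_0=X_0$; $\widehat\rho_n=\dfrac{\sum_{k=1}^n\widehat\varepsilon_k\widehat\varepsilon_{k-1}}{\sum_{k=1}^n\widehat\varepsilon_{k-1}^{\,2}}$. Constants: $\theta^*=\frac{\theta+\rho}{1+\theta\rho}$, $\rho^*=\theta\rho\,\theta^*$, $\sigma_\theta^2=\frac{(1-\theta^2)(1-\theta\rho)(1-\rho^2)}{(1+\theta\rho)^3}$, $\sigma_\rho^2=\frac{1-\theta\rho}{(1+\theta\rho)^3}\big((\theta+\rho)^2(1+\theta\rho)^2+(\theta\rho)^2(1-\theta^2)(1-\rho^2)\big)$. The prime denotes transpose. $(b_n)$ is an increasing sequence of positive numbers with $b_n\to\infty$ and $b_n/\sqrt n\to0$. A sequence $(Z_n)$ satisfies a large deviation principle with speed $b_n^2$ and good rate function $I$ if $I$ is lower semicontinuous with values in $[0,\infty]$ and compact level sets, and for every Borel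 set $B$, $-\inf_{B^\circ}I\le\liminf_n b_n^{-2}\log\mathbb{P}(Z_n\in B)\le\limsup_n b_n^{-2}\log\mathbb{P}(Z_n\in B)\le-\inf_{\overline B}I$. *)

(* Defs.v *)
From HB Require Import structures.
From mathcomp Require Export all_boot all_order all_algebra finmap.
From mathcomp Require Export all_classical all_reals all_analysis.

Set Implicit Arguments.
Unset Strict Implicit.
Unset Printing Implicit Defensive.

Export Order.TTheory GRing.Theory Num.Theory.
Export numFieldNormedType.Exports.

Local Open Scope classical_set_scope.
Local Open Scope ring_scope.

Section probability.
Context {d : measure_display} {T : measurableType d} {R : realType}.
Variable P : probability T R.

Definition mutually_independent (I : choiceType) (X : I -> T -> R) : Prop :=
  forall (J : {fset I}) (A : I -> set R), (forall i, measurable (A i)) ->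
    P (\bigcap_(i in [set` J]) (X i @^-1` A i)) =
    (\prod_(i <- J) P (X i @^-1` A i))%E.

Definition identically_distributed (I : Type) (X : I -> T -> R) : Prop :=
  forall (i j : I) (A : set R), measurable A ->
    P (X i @^-1` A) = P (X j @^-1` A).

Definition good_rate_function (E : topologicalType) (I : E -> \bar R) : Prop :=
  [/\ lower_semicontinuous I,
      forall x, (0 <= I x)%E &
      forall c : R, compact [set x | (I x <= c%:E)%E]].

(* [lne 0 = -oo], and the infimum over the empty set is [+oo]. The limits do
   not depend on the term of index 0 of the sequences. *)
Definition large_deviation_principle (E : topologicalType)
    (Z : nat -> T -> E) (speed : nat -> R) (I : E -> \bar R) : Prop :=
  good_rate_function I /\
  forall B : set E, <<s @open E >> B ->
    let u := fun n : nat => ((speed n)^-1%:E * lne (P (Z n @^-1` B)))%E in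
    [/\ (- ereal_inf [set I x | x in interior B] <= limn_einf u)%E,
        (limn_einf u <= limn_esup u)%E &
        (limn_esup u <= - ereal_inf [set I x | x in closure B])%E].

End probability.

Section estimators.
Context {T : Type} {R : realType}.
Variable X : nat -> T -> R.

(* The quotients below are 0 when their denominator vanishes. *)
Definition theta_hat (n : nat) (w : T) : R :=
  (\sum_(1 <= k < n.+1) X k w * X k.-1 w) /
  (\sum_(1 <= k < n.+1) X k.-1 w ^+ 2).

Definition residual (n k : nat) (w : T) : R :=
  if k is k'.+1 then X k w - theta_hat n w * X k' w else X 0%N w.

Definition rho_hat (n : nat) (w : T) : R :=
  (\sum_(1 <= k < n.+1) residual n k w * residual n k.-1 w) /
  (\sum_(1 <= k < n.+1) residual n k.-1 w ^+ 2).

End estimators.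

Section constants.
Context {R : realType}.
Variables theta rho : R.

Definition theta_star : R := (theta + rho) / (1 + theta * rho).

Definition rho_star : R := theta * rho * theta_star.

Definition sigma2_theta : R :=
  (1 - theta ^+ 2) * (1 - theta * rho) * (1 - rho ^+ 2)
  / (1 + theta * rho) ^+ 3.

Definition sigma2_rho : R :=
  (1 - theta * rho) / (1 + theta * rho) ^+ 3 *
  ((theta + rho) ^+ 2 * (1 + theta * rho) ^+ 2 +
   (theta * rho) ^+ 2 * (1 - theta ^+ 2) * (1 - rho ^+ 2)).

Definition Gamma : 'M[R]_2 := \matrix_(i < 2, j < 2)
  nth 0 (nth [::] [:: [:: sigma2_theta; theta * rho * sigma2_theta];
                      [:: theta * rho * sigma2_theta; sigma2_rho]] i) j.

Definition rate_K (x : 'cV[R]_2) : \bar R :=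
  (2^-1 * (x^T *m invmx Gamma *m x) ord0 ord0)%:E.

Definition rate_rho (x : R) : \bar R := (x ^+ 2 / (2 * sigma2_rho))%:E.

End constants.

Definition col2 {R : realType} (a b : R) : 'cV[R]_2 :=
  \col_(i < 2) nth 0 [:: a; b] i.

(* Main.v *)
From HB Require Import structures.
Require Import Defs.
From mathcomp Require Import ring lra measurable_realfun.

(* For a Gaussian AR(2) process (X_n) the Yule-Walker normal equations express
   the sums of X_k^2, X_k X_(k-1) and X_k X_(k-2) through the sums of X_(k-1) V_k,
   X_(k-2) V_k and V_k^2, up to boundary terms. Exponential moments show that, at
   speed b_n^2, the empirical variance is superexponentially close to the
   stationary variance and the boundary terms are negligible, so that l1 times the
   first plus l2 times the second normalized estimator is superexponentially close
   to a martingale transform M_n / (b_n sqrt n), with M_n the sum of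
   (al X_(k-1) + be X_(k-2)) V_k, whose bracket is superexponentially close to
   n l' Gamma l with l = (l1, l2). As V is Gaussian, the exponential martingale
   associated with M_n has mean exactly one. Markov's
   inequality then bounds the estimators in all half-planes, hence outside ellipses
   by compactness, while changing the measure by this exponential martingale gives
   the lower bound at the point of slope (l1, l2). The initial values are removed
   by applying the martingale argument to the process started at zero. *)

Set Implicit Arguments.
Unset Strict Implicit.
Unset Printing Implicit Defensive.

Local Open Scope classical_set_scope.
Local Open Scope ring_scope.

(** The initial values are not assumed independent of the noise, so the sums built on [X] itself
    need not be martingales; the process started at zero is a function of the noise alone, and
    geometric decay of the difference compares the two. All approximations are stated as convergence
    along the filter [superexp P v L], for every real [L], so that the algebra of limits applies to
    random quantities and finitely many exceptional events cost nothing. With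
    [eta n = b n / sqrt n], one has [n * eta n = b n * sqrt n] and [n * eta n ^ 2 = b n ^ 2]: a tilt
    of parameter [eta n] is small enough for exponential moments of squares to exist, yet its effect
    is exactly of the order of the speed. The estimators are ratios, so no limit of their
    log-Laplace transforms is sought: the logarithm of the tilt is only required to be
    superexponentially close to a linear function of them, and a bound on the second moment of the
    tilt discards, in the lower bound, the set where this approximation fails. *)

(** * Gaussian integrals *)

Section gaussian.
Context {R : realType}.
Variable sigma : R.
Hypothesis sigma0 : 0 < sigma.
Let mu := @lebesgue_measure R.

(** The Radon-Nikodym derivative agrees almost everywhere with the density, because both have the
    same integral over every measurable set. *)
Lemma ge0_integral_normal_prob (f : R -> \bar R) :
  measurable_fun setT f -> (forall x, (0 <= f x)%E) ->
  (\int[normal_prob 0 sigma]_x f x =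
   \int[mu]_x (f x * (normal_pdf 0 sigma x)%:E))%E.
Proof.
move=> mf f0.
have dom := normal_prob_dominates 0 sigma.
rewrite -(Radon_Nikodym_SigmaFinite.change_of_variables dom)//.
have mRN := measurable_int _ (Radon_Nikodym_SigmaFinite.f_integrable dom).
apply: ge0_ae_eq_integral => //.
- exact: emeasurable_funM.
- apply: emeasurable_funM => //; apply/measurable_EFinP.
  exact: measurable_normal_pdf.
- by move=> x _; rewrite mule_ge0// Radon_Nikodym_SigmaFinite.f_ge0.
- by move=> x _; rewrite mule_ge0// lee_fin normal_pdf_ge0.
have : ae_eq mu setT (Radon_Nikodym_SigmaFinite.f (normal_prob 0 sigma) mu)
    (EFin \o normal_pdf 0 sigma).
  apply: integral_ae_eq => //.
  - exact: Radon_Nikodym_SigmaFinite.f_integrable.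
  - by apply/measurable_EFinP; exact: measurable_normal_pdf.
  - by move=> E _ mE; rewrite -Radon_Nikodym_SigmaFinite.f_integral.
by apply: filterS => x + _ => /(_ I) ->.
Qed.

(** Completing the square: the integrand times the density is the normal density of mean
    [c * sigma ^+ 2]. *)
Lemma normal_exp_martingale (c : R) :
  (\int[normal_prob 0 sigma]_v
     (expR (c * v - c ^+ 2 * sigma ^+ 2 / 2))%:E = 1)%E.
Proof.
rewrite ge0_integral_normal_prob.
- rewrite -(integral_normal_pdf (c * sigma ^+ 2) sigma); apply: eq_integral => x _.
  rewrite -EFinM; congr EFin; rewrite !normal_pdfE ?gt_eqF//.
  rewrite mulrCA; congr (_ * _); rewrite /normal_fun -expRD; congr expR.
  by field; rewrite gt_eqF.
- apply/measurable_EFinP; apply: measurableT_comp => //.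
  by apply: measurable_funB => //; exact: measurable_funM.
- by move=> x; rewrite lee_fin expR_ge0.
Qed.

(** With [q ^+ 2 = 1 - 2 * t * sigma ^+ 2], the integrand times the density is [q^-1] times the
    normal density of standard deviation [sigma / q]. *)
Lemma normal_exp_sqr (t : R) : 2 * t * sigma ^+ 2 < 1 ->
  (\int[normal_prob 0 sigma]_v (expR (t * v ^+ 2))%:E =
   (Num.sqrt (1 - 2 * t * sigma ^+ 2))^-1%:E)%E.
Proof.
move=> ht; rewrite ge0_integral_normal_prob; last 2 first.
- by apply/measurable_EFinP; apply: measurableT_comp => //; exact: measurable_funM.
- by move=> x; rewrite lee_fin expR_ge0.
set q := Num.sqrt _.
have q0 : 0 < q by rewrite sqrtr_gt0 subr_gt0.
have qE : q ^+ 2 = 1 - 2 * t * sigma ^+ 2 by rewrite sqr_sqrtr// subr_ge0 ltW.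
have sq0 : 0 < sigma / q by exact: divr_gt0.
transitivity (\int[mu]_x ((q^-1)%:E * (normal_pdf 0 (sigma / q) x)%:E))%E.
  apply: eq_integral => x _; rewrite -!EFinM; congr EFin.
  rewrite !normal_pdfE ?gt_eqF//.
  have -> : normal_peak (sigma / q) = q * normal_peak sigma.
    rewrite /normal_peak exprMn -mulrnAr [_ * q^-1 ^+ 2]mulrC -mulrA.
    rewrite sqrtrM ?sqr_ge0// sqrtr_sqr gtr0_norm ?invr_gt0// invfM invrK.
    by rewrite mulrnAr.
  rewrite mulrCA [RHS]mulrA mulKf ?gt_eqF//; congr (_ * _).
  rewrite /normal_fun -expRD; congr expR; rewrite !subr0.
  have -> : t = (1 - q ^+ 2) / (2 * sigma ^+ 2) by rewrite qE; field; rewrite gt_eqF.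
  by field; rewrite !gt_eqF.
rewrite ge0_integralZl//.
- by rewrite integral_normal_pdf mule1.
- by apply/measurable_EFinP; exact: measurable_normal_pdf.
- by move=> x _; rewrite lee_fin normal_pdf_ge0.
- by rewrite lee_fin invr_ge0 ltW.
Qed.

End gaussian.

(** After squaring and [1 + x <= expR x], what remains is [(1 - 2u)(1 + 2u + 8u^2) = 1 + 4u^2(1 -
    4u) >= 1]. The first-order term is kept exact because centring the squared noise has to cancel
    it. *)
Lemma invr_sqrt_le_expR {R : realType} (u : R) : `|u| <= 8^-1 ->
  (Num.sqrt (1 - 2 * u))^-1 <= expR (u + 4 * u ^+ 2).
Proof.
move=> /[!ler_norml] /andP[u1 u2].
rewrite -[leRHS]invrK lef_pV2 ?posrE ?invr_gt0 ?expR_gt0 ?sqrtr_gt0//; last by lra.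
rewrite -expRN -[leLHS]ger0_norm ?expR_ge0// -sqrtr_sqr ler_sqrt; last by lra.
rewrite -expRM_natr.
have := expR_ge1Dx (2 * u + 8 * u ^+ 2).
have -> : - (u + 4 * u ^+ 2) * 2%:R = - (2 * u + 8 * u ^+ 2) by ring.
rewrite expRN => h.
rewrite invf_ple ?posrE ?expR_gt0//; last by lra.
apply: le_trans h; rewrite -div1r ler_pdivrMr; last by lra.
have : 0 <= u ^+ 2 by exact: sqr_ge0.
by nra.
Qed.

(** * Independence of a recursively generated state from the noise to come *)

Section recursive_state.
Context {d d' : measure_display} {T : measurableType d} {E : measurableType d'}
  {R : realType}.
Variable P : probability T R.
Variable Y : nat -> {RV P >-> R}.
Hypothesis indepY : mutually_independent P (fun n w => Y n w).
Variables (F : E * R -> E) (s0 : E).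
Hypothesis mF : measurable_fun setT F.

Fixpoint state (n : nat) (w : T) : E :=
  if n is k.+1 then F (state k w, Y k w) else s0.

Lemma measurable_state n : measurable_fun setT (state n).
Proof.
elim: n => [|n ih] /=; first exact: measurable_cst.
by apply: measurableT_comp => //; apply: measurable_fun_pair.
Qed.

Let cyl (J : {fset nat}) (B : nat -> set R) :=
  \bigcap_(i in [set` J]) (Y i @^-1` B i).

Let measurable_cyl J B : (forall i, measurable (B i)) -> measurable (cyl J B).
Proof.
move=> mB; apply: fin_bigcap_measurable => // i _.
by rewrite -[_ @^-1` _]setTI; exact: measurable_funPT.
Qed.

Let cylU1 k (J : {fset nat}) (A : set R) B : k \notin J ->
  Y k @^-1` A `&` cyl J B = cyl (k |` J)%fset (fun i => if i == k then A else B i).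
Proof.
move=> kJ; apply/seteqP; split => w /=.
  move=> [wA wB] i /=; rewrite !inE => /orP[/eqP ->|iJ]; first by rewrite eqxx.
  by case: eqP => [ik|_]; [rewrite -ik iJ in kJ|exact: wB].
move=> h; split; first by have := h k; rewrite /= !inE eqxx; exact.
move=> i iJ; have := h i; rewrite /= !inE iJ orbT => /(_ isT).
by case: eqP => // ik; rewrite -ik iJ in kJ.
Qed.

Let cyl_prod k (J : {fset nat}) (A : set R) B : k \notin J ->
    measurable A -> (forall i, measurable (B i)) ->
  P (Y k @^-1` A `&` cyl J B) = (P (Y k @^-1` A) * P (cyl J B))%E.
Proof.
move=> kJ mA mB; rewrite cylU1// /cyl indepY//; last by move=> i; case: ifP.
rewrite big_fsetU1//= eqxx indepY//; congr (_ * _)%E.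
apply: eq_big_seq => i iJ.
by case: eqP => // ik; rewrite -ik iJ in kJ.
Qed.

Let joint n : T -> E * R := fun w => (state n w, Y n w).

Let mjoint n : measurable_fun setT (joint n).
Proof. by apply: measurable_fun_pair => //; exact: measurable_state. Qed.

HB.instance Definition _ n :=
  isMeasurableFun.Build _ _ _ _ (state n) (measurable_state n).
HB.instance Definition _ n :=
  isMeasurableFun.Build _ _ _ _ (joint n) (mjoint n).

(** Induction on [n], for all cylinders over indices at least [n] at once. On rectangles, the law of
    [(state n, Y n)] restricted to a later cylinder is a product measure, equal to the unrestricted
    law up to the factor [P (cyl J B)]; uniqueness of product measures extends this to the preimage
    of [A] under [F]. *)
Let stateY n (J : {fset nat}) (A : set E) B : (forall j, j \in J -> (n <= j)%N) ->
    measurable A -> (forall i, measurable (B i)) ->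
  P (state n @^-1` A `&` cyl J B) = (P (state n @^-1` A) * P (cyl J B))%E.
Proof.
elim: n J A B => [|n ih] J A B nJ mA mB.
  have [As|As] := pselect (A s0).
    have -> : state 0 @^-1` A = setT by apply/seteqP; split.
    by rewrite setTI probability_setT mul1e.
  have -> : state 0 @^-1` A = set0 by apply/seteqP; split.
  by rewrite set0I measure0 mul0e.
have nJ' : n \notin J by apply/negP => /nJ; rewrite ltnn.
have nJ2 j : j \in J -> (n <= j)%N by move=> /nJ /ltnW.
pose m1 := distribution P (state n : {mfun T >-> E}).
pose m2 := distribution P (Y n).
have mC := measurable_cyl J mB.
pose c : {nonneg R} := NngNum (fine_ge0 (measure_ge0 P (cyl J B))).
have cE : P (cyl J B) = (c%:num)%:E by rewrite fineK// fin_num_measure.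
(* The law of the pair on the event [cyl J B]; its total mass is [c], which is carried by the second
   factor [mscale c m2]. *)
pose q := pushforward (mrestr P mC) (joint n : {mfun T >-> (E * R)%type}).
have step1 X1 X2 : measurable X1 -> measurable X2 ->
    P (state n @^-1` X1 `&` Y n @^-1` X2) = (m1 X1 * m2 X2)%E.
  move=> mX1 mX2.
  have := ih [fset n]%fset X1 (fun=> X2) _ mX1 _.
  have -> : cyl [fset n]%fset (fun=> X2) = Y n @^-1` X2.
    rewrite /cyl; apply/seteqP; split => w /=.
      by move=> /(_ n); rewrite /= inE eqxx; exact.
    by move=> h i /=; rewrite inE => /eqP ->.
  by apply => //; move=> j; rewrite inE => /eqP ->.
have step2 X1 X2 : measurable X1 -> measurable X2 ->
    q (X1 `*` X2) = (m1 X1 * (mscale c m2) X2)%E.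
  move=> mX1 mX2; rewrite /q/= /pushforward /mrestr/=.
  have -> : joint n @^-1` (X1 `*` X2) `&` cyl J B = state n @^-1` X1 `&`
      (Y n @^-1` X2 `&` cyl J B) by rewrite setIA.
  rewrite cylU1//.
  rewrite ih//; last 2 first.
  - by move=> j; rewrite !inE => /orP[/eqP ->//|/nJ2].
  - by move=> i; case: ifP.
  by rewrite -cylU1// cyl_prod// cE /mscale/= [X in (_ * X)%E]muleC.
pose Z := (F @^-1` A).
have mZ : measurable Z by rewrite -[Z]setTI; exact: mF.
have h1 := @product_measure_unique _ _ _ _ _ m1 (mscale c m2) q step2 Z mZ.
have h2 := @product_measure_unique _ _ _ _ _ m1 m2
  (distribution P (joint n : {mfun T >-> (E * R)%type})) step1 Z mZ.
change (q Z = (distribution P (joint n : {mfun T >-> (E * R)%type}) Z * P (cyl J B))%E).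
apply: etrans (esym (h1 (mjoint n))) _; rewrite -h2.
rewrite /product_measure1/= cE muleC -ge0_integralZl//.
by apply: measurable_fun_xsection.
Qed.

Lemma joint_state_law n (Z : set (E * R)) : measurable Z ->
  P [set w | Z (state n w, Y n w)] =
  (distribution P (state n : {mfun T >-> E}) \x distribution P (Y n))%E Z.
Proof.
move=> mZ; rewrite (@product_measure_unique _ _ _ _ _ _ _
  (distribution P (joint n : {mfun T >-> (E * R)%type})))//.
move=> A B mA mB.
have := @stateY n [fset n]%fset A (fun=> B) _ mA _.
have -> : cyl [fset n]%fset (fun=> B) = Y n @^-1` B.
  rewrite /cyl; apply/seteqP; split => w /=.
    by move=> /(_ n); rewrite /= inE eqxx; exact.
  by move=> h i /=; rewrite inE => /eqP ->.
by apply => //; move=> j; rewrite inE => /eqP ->.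
Qed.

(** Tonelli for the product law of [joint_state_law]; this stands in for conditioning on the
    past. *)
Lemma integral_state_step n (f : E * R -> \bar R) :
  measurable_fun setT f -> (forall z, (0 <= f z)%E) ->
  (\int[P]_w f (state n w, Y n w) =
   \int[P]_w \int[distribution P (Y n)]_v f (state n w, v))%E.
Proof.
move=> mf f0.
transitivity (\int[distribution P (joint n : {mfun T >-> (E * R)%type})]_z f z)%E.
  by rewrite ge0_integral_distribution.
rewrite (eq_measure_integral
  (distribution P (state n : {mfun T >-> E}) \x distribution P (Y n))%E); last first.
  by move=> A mA _; exact: joint_state_law.
rewrite fubini_tonelli1//.
rewrite ge0_integral_distribution//; first exact: measurable_fun_fubini_tonelli_F.
by move=> s; apply: integral_ge0.
Qed.

End recursive_state.

(** * Expectations of exponentials of additive functionals *)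

Section exponential_product.
Context {d d' : measure_display} {T : measurableType d} {E : measurableType d'}
  {R : realType}.
Variable P : probability T R.
Variable Y : nat -> {RV P >-> R}.
Hypothesis indepY : mutually_independent P (fun n w => Y n w).
Variables (F : E * R -> E) (s0 : E).
Hypothesis mF : measurable_fun setT F.

(** The running sum is adjoined to the state, giving the recursion [G], so that the last noise
    variable can be integrated out with both state and partial sum frozen. As the one-step integral
    is [c] whatever the state, each step contributes a factor [c]. *)
Lemma integral_exp_sum_state (g : E * R -> R) (c : R) n :
    0 <= c ->
    measurable_fun setT g ->
    (forall k s, \int[distribution P (Y k)]_v (expR (g (s, v)))%:E = c%:E)%E ->
  (\int[P]_w (expR (\sum_(k < n) g (state Y F s0 k w, Y k w)))%:E = (c ^+ n)%:E)%E.
Proof.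
move=> c0 mg hg.
pose G (z : (E * R) * R) : E * R := (F (z.1.1, z.2), z.1.2 + g (z.1.1, z.2)).
have m11 : measurable_fun setT (fun z : (E * R) * R => (z.1.1, z.2)).
  by apply: measurable_fun_pair => //; apply: measurableT_comp.
have mG : measurable_fun setT G.
  apply: measurable_fun_pair; first exact: measurableT_comp.
  apply: measurable_funD; first exact: measurableT_comp.
  exact: measurableT_comp.
pose st := state Y G (s0, 0).
have stG m w : st m w =
    (state Y F s0 m w, \sum_(k < m) g (state Y F s0 k w, Y k w)).
  elim: m => [|m]; rewrite /st /=; first by rewrite big_ord0.
  by move=> ->; rewrite /G/= big_ord_recr.
have mst m : measurable_fun setT (st m) by exact: measurable_state.
have msum m : measurable_fun setT
    (fun w => \sum_(k < m) g (state Y F s0 k w, Y k w)).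
  have -> : (fun w => \sum_(k < m) g (state Y F s0 k w, Y k w)) = snd \o st m.
    by apply/funext => w /=; rewrite stG.
  exact: measurableT_comp.
elim: n => [|n ih].
  under eq_integral do rewrite big_ord0 expR0.
  by rewrite integral_cst//= probability_setT mule1 expr0.
pose f (z : (E * R) * R) : \bar R := ((expR z.1.2)%:E * (expR (g (z.1.1, z.2)))%:E)%E.
have mf1 : measurable_fun setT (fun z : (E * R) * R => (expR (g (z.1.1, z.2)))%:E).
  by apply/measurable_EFinP; apply: measurableT_comp => //; exact: measurableT_comp.
have mf : measurable_fun setT f.
  apply: emeasurable_funM => //; apply/measurable_EFinP; apply: measurableT_comp => //.
  exact: measurableT_comp.
have f0 z : (0 <= f z)%E by rewrite mule_ge0// lee_fin expR_ge0.
have -> : (\int[P]_w (expR (\sum_(k < n.+1) g (state Y F s0 k w, Y k w)))%:E =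
    \int[P]_w f (st n w, Y n w))%E.
  by apply: eq_integral => w _; rewrite big_ord_recr/= /f stG/= expRD EFinM.
rewrite integral_state_step// exprS EFinM -ih -ge0_integralZl//; last first.
  by apply/measurable_EFinP; exact: measurableT_comp.
apply: eq_integral => w _; rewrite -/(st n w) /f stG/= ge0_integralZl//.
- by rewrite muleC; congr (_ * _)%E; exact: hg.
- have ms : measurable_fun setT (fun v : R => (state Y F s0 n w, v)).
    exact: measurable_fun_pair.
  apply/measurable_EFinP; apply: measurableT_comp => //.
  exact: (measurableT_comp mg ms).
Qed.

End exponential_product.

Lemma measurable_lt_set d (T : measurableType d) (R : realType) (f g : T -> R) :
  measurable_fun setT f -> measurable_fun setT g -> measurable [set w | f w < g w].
Proof.
move=> mf mg; have := measurable_fun_ltr mf mg measurableT (Y := [set true]).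
by rewrite setTI; apply.
Qed.

(** * Bounds on expectations and Markov's inequality *)

Section mean_bound.
Context {d : measure_display} {T : measurableType d} {R : realType}.
Variable P : probability T R.
Implicit Types (f g : T -> R) (c : R).

Definition mean_le f c := [/\ measurable_fun setT f, forall w, 0 <= f w &
  (\int[P]_w (f w)%:E <= c%:E)%E].

Lemma mean_leW f c c' : c <= c' -> mean_le f c -> mean_le f c'.
Proof. by move=> cc' [? ? h]; split => //; rewrite (le_trans h)// lee_fin. Qed.

Lemma mean_le_dom f g c : measurable_fun setT g -> (forall w, 0 <= g w <= f w) ->
  mean_le f c -> mean_le g c.
Proof.
move=> mg gf [mf f0 h]; split => //; first by move=> w; have /andP[] := gf w.
apply: le_trans h; apply: ge0_le_integral => //.
- by move=> w _; rewrite lee_fin; have /andP[] := gf w.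
- exact/measurable_EFinP.
- exact/measurable_EFinP.
- by move=> w _; rewrite lee_fin; have /andP[] := gf w.
Qed.

Lemma mean_leD f g c c' : mean_le f c -> mean_le g c' ->
  mean_le (fun w => f w + g w) (c + c').
Proof.
move=> [mf f0 h] [mg g0 h']; split.
- exact: measurable_funD.
- by move=> w; rewrite addr_ge0.
under eq_integral do rewrite EFinD.
rewrite ge0_integralD//.
- by rewrite EFinD leeD.
- by move=> w _; rewrite lee_fin.
- exact/measurable_EFinP.
- by move=> w _; rewrite lee_fin.
- exact/measurable_EFinP.
Qed.

Lemma mean_leZ k f c : 0 <= k -> mean_le f c -> mean_le (fun w => k * f w) (k * c).
Proof.
move=> k0 [mf f0 h]; split.
- exact: measurable_funM.
- by move=> w; rewrite mulr_ge0.
under eq_integral do rewrite EFinM.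
rewrite ge0_integralZl//.
- by rewrite EFinM lee_wpmul2l.
- exact/measurable_EFinP.
- by move=> w _; rewrite lee_fin.
Qed.

Lemma mean_le_cst c : 0 <= c -> mean_le (fun=> c) c.
Proof.
by move=> c0; split => //; rewrite integral_cst//= probability_setT mule1.
Qed.

Lemma mean_le_indic (A : set T) : measurable A -> mean_le \1_A (fine (P A)).
Proof.
move=> mA; split => //.
by rewrite integral_indic// setIT fineK// fin_num_measure.
Qed.

Lemma markov_mean_le f c (a : R) : 0 < a -> mean_le f c ->
  (P [set w | (a <= f w)%R] <= (c / a)%:E)%E.
Proof.
move=> a0 [mf f0 h].
have mA : measurable [set w | a <= f w].
  by rewrite -[X in measurable X]setTI; exact: measurable_fun_le.
have := le_integral_abse P measurableT (g := fun w => (f w)%:E) _ a0.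
move=> /(_ _)/wrap[]; first exact/measurable_EFinP.
rewrite setTI => le1; rewrite mulrC EFinM lee_pdivlMl//.
have -> : [set w | (a <= f w)%R] = [set w | (a%:E <= `|(f w)%:E|)%E].
  by apply/seteqP; split => w /=; rewrite lee_fin ger0_norm.
apply: le_trans le1 _; apply: le_trans h; rewrite le_eqVlt; apply/orP; left.
by apply/eqP; apply: eq_integral => w _; rewrite /= ger0_norm.
Qed.

End mean_bound.

(** * The filter of properties that hold up to superexponentially small probability *)

Section superexponential_filter.
Context {d : measure_display} {T : measurableType d} {R : realType}.
Variables (P : probability T R) (v : nat -> R).
Hypothesis voo : v n @[n --> \oo] --> +oo.

(** A filter on pairs of an index and an outcome. The rate [L'] is strictly larger than [L] so that
    the factor 2 of a union bound can be absorbed, and the exceptional set [A] is explicit so that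
    [Q] itself need not be measurable. *)
Definition superexp (L : R) : set_system (nat * T) := [set Q |
  exists2 L', L < L' & \forall n \near \oo, exists A, [/\ measurable A,
    (P A <= (expR (- L' * v n))%:E)%E & forall w, ~ A w -> Q (n, w)]].

Lemma near_speed_ge (K : R) : \forall n \near \oo, K <= v n.
Proof. by move/cvgryPge: voo => /(_ K). Qed.

Lemma superexp_near L (Q : set nat) : (\forall n \near \oo, Q n) ->
  superexp L [set z | Q z.1].
Proof.
move=> nQ; exists (L + 1); first by rewrite ltrDl.
apply: filterS nQ => n Qn; exists set0; split => //.
by rewrite measure0 lee_fin expR_ge0.
Qed.

Global Instance superexp_filter L : Filter (superexp L).
Proof.
split.
- exact: (superexp_near L filterT).
- move=> Q1 Q2 [L1 LL1 h1] [L2 LL2 h2].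
  (* Half of the margin is spent on the union bound: once [v n] exceeds the inverse of
     [Num.min L1 L2 - L'], the extra factor is at most [2^-1]. *)
  pose L' := (L + Num.min L1 L2) / 2.
  have mL : L < Num.min L1 L2 by rewrite lt_min LL1.
  exists L'; first by rewrite /L'; lra.
  have d0 : 0 < Num.min L1 L2 - L' by rewrite /L'; lra.
  have nv := near_speed_ge (1 / (Num.min L1 L2 - L')).
  have nv0 := near_speed_ge 0.
  apply: filterS3 (filterI h1 h2) nv nv0.
  move=> n [[A1 [mA1 PA1 AQ1]] [A2 [mA2 PA2 AQ2]]] vn vn0.
  exists (A1 `|` A2); split; first exact: measurableU.
    apply: le_trans (measureU2 _ _ _) _ => //.
    apply: le_trans (leeD PA1 PA2) _; rewrite -EFinD lee_fin.
    have e1 : expR (- L1 * v n) <= expR (- Num.min L1 L2 * v n).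
      by rewrite ler_expR ler_wpM2r// lerN2 ge_min lexx.
    have e2 : expR (- L2 * v n) <= expR (- Num.min L1 L2 * v n).
      by rewrite ler_expR ler_wpM2r// lerN2 ge_min lexx orbT.
    apply: le_trans (lerD e1 e2) _.
    have -> : - Num.min L1 L2 * v n = - L' * v n - (Num.min L1 L2 - L') * v n by ring.
    rewrite expRD -mulrDr ler_piMr ?expR_ge0//.
    rewrite ler_pdivrMr// in vn.
    have h : 1 <= (Num.min L1 L2 - L') * v n by rewrite mulrC.
    have := expR_ge1Dx ((Num.min L1 L2 - L') * v n); rewrite expRN => h2'.
    have : (expR ((Num.min L1 L2 - L') * v n))^-1 <= 2^-1.
      by rewrite lef_pV2 ?posrE ?expR_gt0//; lra.
    by lra.
  move=> w nA; split; [apply: AQ1|apply: AQ2] => ?; apply: nA; by [left|right].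
- move=> Q1 Q2 Q12 [L' LL' h]; exists L' => //.
  by apply: filterS h => n [A [mA PA AQ]]; exists A; split => // w /AQ /Q12.
Qed.

(* Markov's inequality for [expR \o U]. *)
Lemma superexp_lt L (U : nat -> T -> R) (a c : R) : L + c < a ->
  (\forall n \near \oo, mean_le P (fun w => expR (v n * U n w)) (expR (c * v n))) ->
  superexp L [set z | U z.1 z.2 < a].
Proof.
move=> Lca h; exists (a - c); first by lra.
apply: filterS2 h (near_speed_ge 1) => n hn v1.
exists [set w | expR (a * v n) <= expR (v n * U n w)]; split.
- case: hn => mU _ _; rewrite -[X in measurable X]setTI.
  exact: measurable_fun_le.
- apply: le_trans (markov_mean_le (expR_gt0 _) hn) _.
  by rewrite lee_fin -expRN -expRD ler_expR; lra.
- move=> w /= /negP; rewrite -ltNge ltr_expR mulrC ltr_pM2r//.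
  exact: lt_le_trans v1.
Qed.

End superexponential_filter.

(** * A positive definite quadratic form on the plane and its Legendre transform *)

Section quadratic_forms.
Context {R : realType}.
Variables a b c : R.
Hypothesis a0 : 0 < a.
Hypothesis disc0 : 0 < a * c - b ^+ 2.

Definition qform (l1 l2 : R) : R := (a * l1 ^+ 2 + 2 * b * l1 * l2 + c * l2 ^+ 2) / 2.

(** The Legendre transform of [qform]: half of [x' G^-1 x], for [G] the symmetric matrix with
    entries [a], [b], [b], [c]. *)
Definition dual_qform (x1 x2 : R) : R :=
  (c * x1 ^+ 2 - 2 * b * x1 * x2 + a * x2 ^+ 2) / (2 * (a * c - b ^+ 2)).

(** The coordinates of [G^-1 x], the slope at which the Legendre transform is attained. *)
Definition dual1 (x1 x2 : R) : R := (c * x1 - b * x2) / (a * c - b ^+ 2).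
Definition dual2 (x1 x2 : R) : R := (a * x2 - b * x1) / (a * c - b ^+ 2).

Lemma qform_c0 : 0 < c.
Proof. by rewrite -(pmulr_rgt0 _ a0); have := sqr_ge0 b; have := disc0; lra. Qed.

Lemma dual_qformE x1 x2 : dual_qform x1 x2 = qform (dual1 x1 x2) (dual2 x1 x2).
Proof. by rewrite /dual_qform /qform /dual1 /dual2; field; rewrite gt_eqF. Qed.

Lemma dual_inv1 x1 x2 : a * dual1 x1 x2 + b * dual2 x1 x2 = x1.
Proof. by rewrite /dual1 /dual2; field; rewrite gt_eqF. Qed.

Lemma dual_inv2 x1 x2 : b * dual1 x1 x2 + c * dual2 x1 x2 = x2.
Proof. by rewrite /dual1 /dual2; field; rewrite gt_eqF. Qed.

Lemma qform_ge0 l1 l2 : 0 <= qform l1 l2.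
Proof.
have h : a * (a * l1 ^+ 2 + 2 * b * l1 * l2 + c * l2 ^+ 2) =
  (a * l1 + b * l2) ^+ 2 + (a * c - b ^+ 2) * l2 ^+ 2 by ring.
rewrite /qform divr_ge0// -(pmulr_rge0 _ a0) h.
by rewrite addr_ge0 ?sqr_ge0// mulr_ge0 ?sqr_ge0// ltW.
Qed.

Lemma dual_qform_ge0 x1 x2 : 0 <= dual_qform x1 x2.
Proof. by rewrite dual_qformE qform_ge0. Qed.

Lemma sqr1_le_dual_qform x1 x2 : x1 ^+ 2 <= 2 * a * dual_qform x1 x2.
Proof.
have -> : 2 * a * dual_qform x1 x2 =
    x1 ^+ 2 + (a * x2 - b * x1) ^+ 2 / (a * c - b ^+ 2).
  by rewrite /dual_qform; field; rewrite gt_eqF.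
by rewrite lerDl divr_ge0 ?sqr_ge0// ltW.
Qed.

(** The difference is a square over the determinant, and it vanishes at [x1 = b * x2 / c]: hence
    [x2 ^+ 2 / (2 * c)] is the minimum of the dual form over the first coordinate, which gives the
    marginal rate function. *)
Lemma sqr2_le_dual_qform x1 x2 : x2 ^+ 2 <= 2 * c * dual_qform x1 x2.
Proof.
have -> : 2 * c * dual_qform x1 x2 =
    x2 ^+ 2 + (c * x1 - b * x2) ^+ 2 / (a * c - b ^+ 2).
  by rewrite /dual_qform; field; rewrite gt_eqF.
by rewrite lerDl divr_ge0 ?sqr_ge0// ltW.
Qed.

Lemma continuous_dual_qform : continuous (fun x : R * R => dual_qform x.1 x.2).
Proof.
move=> x; rewrite /dual_qform; apply: cvgM; last exact: cvg_cst.
have h1 : y.1 @[y --> x] --> x.1 by exact: cvg_fst.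
have h2 : y.2 @[y --> x] --> x.2 by exact: cvg_snd.
apply: cvgD; [apply: cvgB|]; repeat apply: cvgM => //; try exact: cvg_cst.
Qed.

Lemma compact_dual_qform_le k : compact [set x : R * R | dual_qform x.1 x.2 <= k].
Proof.
pose r1 := Num.sqrt (2 * a * k); pose r2 := Num.sqrt (2 * c * k).
apply: (subclosed_compact (B := `[- r1, r1] `*` `[- r2, r2])).
- apply: (preimage_closed (f := fun x : R * R => dual_qform x.1 x.2) (D := [set y | y <= k])).
    by move=> x _; exact: continuous_dual_qform.
  exact: closed_le.
- by apply: compact_setX; exact: segment_compact.
- move=> [x1 x2] /= h; rewrite !in_itv/= -!ler_norml -!sqrtr_sqr.
  have c0 := qform_c0; have h1 := sqr1_le_dual_qform x1 x2.
  have h2 := sqr2_le_dual_qform x1 x2.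
  by split; apply: ler_wsqrtr; [apply: le_trans h1 _|apply: le_trans h2 _];
    rewrite ler_pM2l// mulr_gt0.
Qed.

(* The ellipse [dual_qform = k] is compact, hence covered by finitely many of the
   half-planes; by homogeneity these also cover its exterior. *)
Lemma near_dual_qform_lt {I : Type} {F : set_system I} {FF : Filter F}
    (z1 z2 : I -> R) k k' : 0 < k' -> k' < k ->
    (forall l1 l2, \forall i \near F, l1 * z1 i + l2 * z2 i - qform l1 l2 < k') ->
  \forall i \near F, dual_qform (z1 i) (z2 i) < k.
Proof.
move=> k'0 kk' hz.
pose E := [set x : R * R | dual_qform x.1 x.2 = k].
have cE : compact E.
  apply: (subclosed_compact _ (@compact_dual_qform_le k)).
    apply: (preimage_closed (f := fun x : R * R => dual_qform x.1 x.2) (D := [set k])).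
      by move=> x _; exact: continuous_dual_qform.
    exact: closed_eq.
  by move=> x /= ->.
(* The point indexed by [i] does not lie on the ray issued from [y] away from the origin. Once this
   holds for all [y] on the ellipse, the point is strictly inside. *)
pose Q (i : I) (y : R * R) := forall t, 1 <= t -> (z1 i, z2 i) <> (t * y.1, t * y.2).
have /compact_near_coveringP/(_ _ F Q FF) := cE.
have step (x : R * R) : E x -> \near x & F, Q F x.
  (* At this slope the linear form takes the value [2 * k] at [x] while [qform] is [k], so
     [k' + qform l1 l2] is exceeded near [x]. For [t >= 1], a point [t * y] with [y] in this
     neighbourhood would violate the half-plane bound. *)
  move=> Ex; pose l1 := dual1 x.1 x.2; pose l2 := dual2 x.1 x.2.
  exists ([set y : R * R | k' + qform l1 l2 < l1 * y.1 + l2 * y.2],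
    [set i | l1 * z1 i + l2 * z2 i - qform l1 l2 < k']) => /=; first split.
  - have cl : l1 * y.1 + l2 * y.2 @[y --> x] --> l1 * x.1 + l2 * x.2.
      apply: cvgD; apply: cvgM; try exact: cvg_cst.
        exact: cvg_fst.
      exact: cvg_snd.
    have lx : k' + qform l1 l2 < l1 * x.1 + l2 * x.2.
      have -> : l1 * x.1 + l2 * x.2 = 2 * dual_qform x.1 x.2.
        by rewrite /l1 /l2 /dual_qform /dual1 /dual2; field; rewrite gt_eqF.
      by rewrite -dual_qformE; move: Ex; rewrite /E /= => ->; lra.
    by apply: (cvgr_gt _ cl _ lx).
  - exact: hz.
  - move=> [y i] /= [hy hi] t t1 [z1E z2E]; move: hi; rewrite z1E z2E.
    have q0 := qform_ge0 l1 l2.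
    have -> : l1 * (t * y.1) + l2 * (t * y.2) = t * (l1 * y.1 + l2 * y.2) by ring.
    by nra.
move=> /(_ step); apply: filterS => i hi.
rewrite ltNge; apply/negP => kK.
set K := dual_qform _ _ in kK.
have k0 : 0 < k by lra.
have K0 : 0 < K by lra.
(* The homothety of ratio [s <= 1] brings the point back onto the ellipse. *)
pose s := Num.sqrt (k / K).
have s0 : 0 < s by rewrite sqrtr_gt0 divr_gt0.
have s1 : s <= 1 by rewrite -sqrtr1 ler_wsqrtr// ler_pdivrMr// mul1r.
have sE : s ^+ 2 = k / K by rewrite sqr_sqrtr// divr_ge0 ?ltW.
apply: (hi (s * z1 i, s * z2 i) _ s^-1).
- rewrite /E/=; have -> : dual_qform (s * z1 i) (s * z2 i) = s ^+ 2 * K.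
    by rewrite /K /dual_qform; ring.
  by rewrite sE; field; rewrite gt_eqF.
- by rewrite -invr1 lef_pV2 ?posrE.
- by rewrite /= !mulKf ?gt_eqF.
Qed.

End quadratic_forms.

Lemma eventually_and (A B : set nat) : (\forall n \near \oo, A n) ->
  (\forall n \near \oo, B n) -> \forall n \near \oo, A n /\ B n.
Proof. exact: filterI. Qed.

(** * Elementary inequalities for the tilting argument *)

Section real_bounds.
Context {R : realType}.
Implicit Types x y : R.

Lemma ltr_norm_dist x y de : x - y < de -> y - x < de -> `|x - y| < de.
Proof. by move=> h1 h2; rewrite ltr_norml; apply/andP; split; lra. Qed.

(** The right-hand side is the pointwise majorant used in [tilted_lower_bound]. All its terms are
    nonnegative, so in each region of the sample space it suffices to bound [y] by the term made for
    that region. *)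
Lemma tilt_sum_ge y t1 t2 q y1 y2 y3 y4 t4 : 0 <= t1 -> 0 <= t2 -> 0 <= t4 ->
    0 < q -> [/\ 0 < y1, 0 < y2, 0 < y3 & 0 < y4] ->
    [\/ y <= t1 + t2, y <= t4, exists2 z, y <= q * z & z = y1 \/ z = y2 |
      exists2 z, y <= q * z & z = y3 \/ z = y4] ->
  y <= t1 + t2 + q * ((y1 + y2) + (y3 + y4)) + t4.
Proof.
move=> t10 t20 t40 q0 [y10 y20 y30 y40].
have := mulr_gt0 q0 y10; have := mulr_gt0 q0 y20.
have := mulr_gt0 q0 y30; have := mulr_gt0 q0 y40.
by rewrite !mulrDr => ? ? ? ? [?|?|[z ? [] ?]|[z ? [] ?]]; subst; lra.
Qed.

Lemma tilt_exponent_le (D l1 l2 u1 u2 x1 x2 q n1 n2 e eta : R) :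
  D - (l1 * u1 + l2 * u2 - q) < e -> l1 * (u1 - x1) <= n1 ->
  l2 * (u2 - x2) <= n2 -> l1 * x1 + l2 * x2 = 2 * q ->
  n1 + n2 <= eta / 4 -> e <= eta / 4 -> D <= q + eta / 2.
Proof. by move=> *; lra. Qed.

(** The linear gain [s * de] outweighs the two errors: [2 * e] costs at most a quarter of it and the
    quadratic term at most half, which leaves a quarter. *)
Lemma tilt_gain_le (D D' vn e s de q : R) : 0 < vn -> e <= s * de / 8 -> 0 <= s ->
  s * q <= de / 2 -> D <= D' + (2 * e + s ^+ 2 * q - s * de) ->
  vn * D <= - (s * de / 4) * vn + vn * D'.
Proof.
move=> vn0 he s0 hq hD.
have {}hq : s ^+ 2 * q <= s * (de / 2) by rewrite expr2 -mulrA ler_wpM2l.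
have -> : - (s * de / 4) * vn + vn * D' = vn * (D' - s * de / 4) by ring.
by rewrite ler_pM2l//; lra.
Qed.

Lemma expRN_le_inv x k : 0 < k -> k <= 1 + x -> expR (- x) <= k^-1.
Proof.
move=> k0 kx; rewrite expRN lef_pV2 ?posrE ?expR_gt0//.
exact: le_trans (expR_ge1Dx _).
Qed.

End real_bounds.

(** * Upper and lower bounds from an approximate exponential martingale *)

Section gaussian_tilting.
Context {d : measure_display} {T : measurableType d} {R : realType}.
Variables (P : probability T R) (v : nat -> R).
Hypothesis voo : v n @[n --> \oo] --> +oo.
Local Instance superexp_FF L : Filter (superexp P v L) := superexp_filter P voo L.
Variables a b c : R.
Hypothesis a0 : 0 < a.
Hypothesis disc0 : 0 < a * c - b ^+ 2.
Variables (Z1 Z2 : nat -> T -> R) (D : R -> R -> nat -> T -> R).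
Hypothesis mZ1 : forall n, measurable_fun setT (Z1 n).
Hypothesis mZ2 : forall n, measurable_fun setT (Z2 n).
Hypothesis D_le : forall l1 l2, \forall n \near \oo,
  mean_le P (fun w => expR (v n * D l1 l2 n w)) 1.
Hypothesis D_ge : forall l1 l2, \forall n \near \oo,
  (1 <= \int[P]_w (expR (v n * D l1 l2 n w))%:E)%E.
Hypothesis D_sqr : forall l1 l2, exists C, \forall n \near \oo,
  mean_le P (fun w => expR (v n * D l1 l2 n w) ^+ 2) (expR (C * v n)).
Hypothesis D_cvg : forall L l1 l2,
  D l1 l2 z.1 z.2 - (l1 * Z1 z.1 z.2 + l2 * Z2 z.1 z.2 - qform a b c l1 l2)
    @[z --> superexp P v L] --> 0.

(** Markov's inequality applied to [D], with half of the margin [t - L] reserved for the replacement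
    of [D] by its linear approximation. *)
Lemma superexp_halfplane L t l1 l2 : L < t -> superexp P v L
  [set z | l1 * Z1 z.1 z.2 + l2 * Z2 z.1 z.2 - qform a b c l1 l2 < t].
Proof.
move=> Lt.
have e0 : 0 < (t - L) / 2 by lra.
have hD : superexp P v L [set z | D l1 l2 z.1 z.2 < t - (t - L) / 2].
  apply: (superexp_lt voo (c := 0)); first by lra.
  by apply: filterS (D_le l1 l2) => n; rewrite mul0r expR0.
have /cvgrPdist_lt/(_ _ e0) := D_cvg L l1 l2.
apply: filterS2 hD => z /=.
rewrite sub0r normrN ltr_norml => h1 /andP[h2 h3]; lra.
Qed.

Lemma superexp_dual_qform_lt L k : 0 < k -> L < k ->
  superexp P v L [set z | dual_qform a b c (Z1 z.1 z.2) (Z2 z.1 z.2) < k].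
Proof.
move=> k0 Lk.
(* A level between [L] and [k] that is also positive, as the covering of the ellipse requires. *)
pose k' := (Num.max L 0 + k) / 2.
have m0 : 0 <= Num.max L 0 by rewrite le_max lexx orbT.
have mL : L <= Num.max L 0 by rewrite le_max lexx.
have mk : Num.max L 0 < k by rewrite gt_max Lk.
apply: (near_dual_qform_lt a0 disc0 (F := superexp P v L)
  (z1 := fun z => Z1 z.1 z.2) (z2 := fun z => Z2 z.1 z.2) (k' := k')) => [||l1 l2].
- by rewrite /k'; lra.
- by rewrite /k'; lra.
- by apply: superexp_halfplane; rewrite /k'; lra.
Qed.

(** Exact second-order expansion of [qform] at the slope [(l1, l2)]. Where [(Z1, Z2)] exceeds the
    centre by [de] in the direction [u], moving the slope by [s * u] increases the exponent by
    nearly [s * de]. *)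
Let tilt_bound l1 l2 u1 u2 e s de n w : 0 <= s ->
  `|D l1 l2 n w - (l1 * Z1 n w + l2 * Z2 n w - qform a b c l1 l2)| < e ->
  `|D (l1 + s * u1) (l2 + s * u2) n w - ((l1 + s * u1) * Z1 n w + (l2 + s * u2) * Z2 n w
      - qform a b c (l1 + s * u1) (l2 + s * u2))| < e ->
  de <= u1 * (Z1 n w - (a * l1 + b * l2)) + u2 * (Z2 n w - (b * l1 + c * l2)) ->
  D l1 l2 n w <= D (l1 + s * u1) (l2 + s * u2) n w +
    (2 * e + s ^+ 2 * qform a b c u1 u2 - s * de).
Proof.
move=> s0 /[!ltr_norml] /andP[_ h1] /andP[h2 _] h3.
have {}h3 := ler_wpM2l s0 h3.
have E : qform a b c (l1 + s * u1) (l2 + s * u2) = qform a b c l1 l2 +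
    s * (u1 * (a * l1 + b * l2) + u2 * (b * l1 + c * l2)) + s ^+ 2 * qform a b c u1 u2.
  by rewrite /qform; field.
by move: h2; rewrite E; lra.
Qed.

(* The tilted mass [expR (v n * D l1 l2)] has mean one and concentrates near the
   point of slope [(l1, l2)]. *)
Lemma tilted_lower_bound l1 l2 de eta : 0 < de -> 0 < eta ->
  \forall n \near \oo, ((expR (- (qform a b c l1 l2 + eta) * v n))%:E <=
    P [set w | (`|Z1 n w - (a * l1 + b * l2)| < de)%R /\
               (`|Z2 n w - (b * l1 + c * l2)| < de)%R])%E.
Proof.
move=> de0 eta0.
set x1 := a * l1 + b * l2; set x2 := b * l1 + c * l2.
(* The window is narrowed so that [l1 * Z1 + l2 * Z2] varies by at most [eta / 4] on it. *)
pose de' := Num.min de (eta / 4 / (`|l1| + `|l2| + 1)).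
have l0 : 0 < `|l1| + `|l2| + 1 by rewrite ltr_wpDl// addr_ge0.
have de'0 : 0 < de' by rewrite lt_min de0/= divr_gt0// divr_gt0.
have de'de : de' <= de by rewrite ge_min lexx.
have de'eta : (`|l1| + `|l2|) * de' <= eta / 4.
  apply: (@le_trans _ _ ((`|l1| + `|l2| + 1) * de')).
    by rewrite ler_wpM2r ?lerDl// ltW.
  by rewrite mulrC -ler_pdivlMr// ge_min lexx orbT.
have a0' := a0; have c0 := qform_c0 a0 disc0.
(* This step length keeps the quadratic loss [s * qform] below [de' / 2] in the four directions of
   the axes. *)
pose s := de' / (a + c + 1).
have s0 : 0 < s by rewrite divr_gt0// ?addr_gt0.
have sa : s * a <= de' by rewrite /s mulrAC ler_pdivrMr ?addr_gt0// ler_pM2l//; lra.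
have sc : s * c <= de' by rewrite /s mulrAC ler_pdivrMr ?addr_gt0// ler_pM2l//; lra.
have qa : s * qform a b c 1 0 <= de' / 2 by rewrite /qform; lra.
have qa' : s * qform a b c (- 1) 0 <= de' / 2 by rewrite /qform; lra.
have qc : s * qform a b c 0 1 <= de' / 2 by rewrite /qform; lra.
have qc' : s * qform a b c 0 (- 1) <= de' / 2 by rewrite /qform; lra.
pose e := Num.min (s * de' / 8) (eta / 4).
have sd0 : 0 < s * de' by exact: mulr_gt0.
have e0 : 0 < e by rewrite lt_min !divr_gt0.
have e1 : e <= s * de' / 8 by rewrite ge_min lexx.
have e2 : e <= eta / 4 by rewrite ge_min lexx orbT.
have [C hC] := D_sqr l1 l2.
pose good l z := `|D l.1 l.2 z.1 z.2 - (l.1 * Z1 z.1 z.2 + l.2 * Z2 z.1 z.2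
  - qform a b c l.1 l.2)| < e.
have nearG l L : superexp P v L [set z | good l z].
  have /cvgrPdist_lt/(_ _ e0) := D_cvg L l.1 l.2.
  by apply: filterS => z /=; rewrite sub0r normrN.
pose kap := s * de' / 4.
have kap0 : 0 < kap by rewrite divr_gt0.
(* The exceptional set must be rarer than [expR (- (C + 2) * v n)] to compensate the growth
   [expR (C * v n)] of the second moment of the tilt. *)
pose L0 := C + 2.
have [L' LL' hG] : superexp P v L0 (fun z => [/\ good (l1, l2) z,
    good (l1 + s * 1, l2 + s * 0) z, good (l1 + s * - 1, l2 + s * 0) z,
    good (l1 + s * 0, l2 + s * 1) z & good (l1 + s * 0, l2 + s * - 1) z]).
  have nearGG l l' : superexp P v L0 (fun z => good l z /\ good l' z).
    by apply: filterS2 (nearG l L0) (nearG l' L0) => z.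
  apply: filterS3 (nearG (l1, l2) L0)
    (nearGG (l1 + s * 1, l2 + s * 0) (l1 + s * - 1, l2 + s * 0))
    (nearGG (l1 + s * 0, l2 + s * 1) (l1 + s * 0, l2 + s * - 1)).
  by move=> z ? [? ?] [].
have nB1 := D_ge l1 l2.
have nb := eventually_and (eventually_and (D_le (l1 + s * 1) (l2 + s * 0))
                     (D_le (l1 + s * - 1) (l2 + s * 0)))
           (eventually_and (D_le (l1 + s * 0) (l2 + s * 1))
                    (D_le (l1 + s * 0) (l2 + s * - 1))).
have nv := eventually_and (near_speed_ge voo 7) (eventually_and (near_speed_ge voo (16 / kap))
  (near_speed_ge voo (4 / eta))).
have nall := eventually_and (eventually_and hG nv) (eventually_and (eventually_and nb hC) (eventually_and nB1 (D_le l1 l2))).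
move: nall; apply: filterS.
move=> n [[[A [mA PA AG]] [v2 [vk ve]]] [[[[b1 b2] [b3 b4]] hDC] [ge1 [mD _ _]]]].
set G := [set w | _ /\ _].
have mG : measurable G.
  have -> : G = [set w | `|Z1 n w - x1| < de] `&` [set w | `|Z2 n w - x2| < de] by [].
  apply: measurableI; apply: measurable_lt_set => //;
    by apply: measurableT_comp => //; exact: measurable_funB.
have vn0 : 0 < v n by exact: lt_le_trans v2.
pose K := qform a b c l1 l2 + eta / 2.
(* The weight in [y <= k / 2 * y ^+ 2 + k^-1 / 2], applied on the exceptional set. With this value
   both terms have mean at most [expR (- v n) / 2], the second thanks to [L' > C + 2]. *)
pose k := expR (- (C + 1) * v n).
have k0 : 0 < k := expR_gt0 _.
(* A majorant of the tilt, one group of terms per region: the exceptional set [A], an excess of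
   [de'] in one of the four directions, and the target event [G]. *)
pose f w := k / 2 * expR (v n * D l1 l2 n w) ^+ 2 + (k^-1 / 2) * \1_A w +
  (expR (- kap * v n) * ((expR (v n * D (l1 + s * 1) (l2 + s * 0) n w) +
    expR (v n * D (l1 + s * - 1) (l2 + s * 0) n w)) +
   (expR (v n * D (l1 + s * 0) (l2 + s * 1) n w) +
    expR (v n * D (l1 + s * 0) (l2 + s * - 1) n w)))) +
  expR (K * v n) * \1_G w.
have fD w : expR (v n * D l1 l2 n w) <= f w.
  rewrite /f; set y := expR (v n * D l1 l2 n w).
  have y0 : 0 < y := expR_gt0 _.
  have i0 (B : set T) : 0 <= \1_B w :> R by rewrite indicE.
  have t1 : 0 <= k / 2 * y ^+ 2 by rewrite mulr_ge0 ?sqr_ge0// divr_ge0// ltW.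
  have t2 : 0 <= (k^-1 / 2) * \1_A w by rewrite mulr_ge0// divr_ge0// invr_ge0 ltW.
  set y1 := expR (v n * D (l1 + s * 1) _ n w).
  set y2 := expR (v n * D (l1 + s * - 1) _ n w).
  set y3 := expR (v n * D _ (l2 + s * 1) n w).
  set y4 := expR (v n * D _ (l2 + s * - 1) n w).
  have y10 : 0 < y1 := expR_gt0 _.
  have y20 : 0 < y2 := expR_gt0 _.
  have y30 : 0 < y3 := expR_gt0 _.
  have y40 : 0 < y4 := expR_gt0 _.
  have t4 : 0 <= expR (K * v n) * \1_G w by rewrite mulr_ge0// expR_ge0.
  have q0 : 0 < expR (- kap * v n) := expR_gt0 _.
  have [Aw|nAw] := pselect (A w).
    apply: (tilt_sum_ge t1 t2 t4 q0 (And4 y10 y20 y30 y40)); apply: Or41.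
    rewrite (_ : \1_A w = 1); last by rewrite indicE mem_set.
    rewrite -subr_ge0.
    have -> : k / 2 * y ^+ 2 + k^-1 / 2 * 1 - y = k / 2 * (y - k^-1) ^+ 2.
      by field; rewrite gt_eqF.
    by rewrite mulr_ge0 ?sqr_ge0// divr_ge0// ltW.
  have [g0 g1 g2 g3 g4] := AG w nAw; rewrite /good/= in g0 g1 g2 g3 g4.
  have tb u1 u2 : `|u1| + `|u2| = 1 ->
      s * qform a b c u1 u2 <= de' / 2 ->
      `|D (l1 + s * u1) (l2 + s * u2) n w - ((l1 + s * u1) * Z1 n w +
        (l2 + s * u2) * Z2 n w - qform a b c (l1 + s * u1) (l2 + s * u2))| < e ->
      de' <= u1 * (Z1 n w - x1) + u2 * (Z2 n w - x2) ->
      y <= expR (- kap * v n) * expR (v n * D (l1 + s * u1) (l2 + s * u2) n w).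
    move=> _ hq hg hd; rewrite -expRD ler_expR.
    have := tilt_bound (ltW s0) g0 hg hd.
    exact: (tilt_gain_le vn0 e1 (ltW s0) hq).
  have [z1|z1] := leP de' (Z1 n w - x1).
    have := tb 1 0 _ qa g1 _; rewrite normr1 normr0 addr0 mul0r addr0 mul1r -/y1.
    move=> /(_ erefl z1) h; apply: (tilt_sum_ge t1 t2 t4 q0 (And4 y10 y20 y30 y40)); apply: Or43.
    by exists y1 => //; left.
  have [z2|z2] := leP de' (x1 - Z1 n w).
    have := tb (- 1) 0 _ qa' g2 _; rewrite normrN normr1 normr0 addr0 mul0r addr0 mulN1r opprB -/y2.
    move=> /(_ erefl z2) h; apply: (tilt_sum_ge t1 t2 t4 q0 (And4 y10 y20 y30 y40)); apply: Or43.
    by exists y2 => //; right.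
  have [z3|z3] := leP de' (Z2 n w - x2).
    have := tb 0 1 _ qc g3 _; rewrite normr1 normr0 add0r mul0r add0r mul1r -/y3.
    move=> /(_ erefl z3) h; apply: (tilt_sum_ge t1 t2 t4 q0 (And4 y10 y20 y30 y40)); apply: Or44.
    by exists y3 => //; left.
  have [z4|z4] := leP de' (x2 - Z2 n w).
    have := tb 0 (- 1) _ qc' g4 _; rewrite normrN normr1 normr0 add0r mul0r add0r mulN1r opprB -/y4.
    move=> /(_ erefl z4) h; apply: (tilt_sum_ge t1 t2 t4 q0 (And4 y10 y20 y30 y40)); apply: Or44.
    by exists y4 => //; right.
  have Gw : G w.
    by split; apply: lt_le_trans de'de; exact: ltr_norm_dist.
  have : y <= expR (K * v n).
    rewrite ler_expR mulrC ler_pM2r//.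
    move: g0; rewrite ltr_norml => /andP[_ g0].
    have n1 : l1 * (Z1 n w - x1) <= `|l1| * de'.
      by apply: le_trans (ler_norm _) _; rewrite normrM ler_wpM2l// ltW// ltr_norm_dist.
    have n2 : l2 * (Z2 n w - x2) <= `|l2| * de'.
      by apply: le_trans (ler_norm _) _; rewrite normrM ler_wpM2l// ltW// ltr_norm_dist.
    have E : l1 * x1 + l2 * x2 = 2 * qform a b c l1 l2 by rewrite /x1 /x2 /qform; field.
    by apply: (tilt_exponent_le g0 n1 n2 E) => //; rewrite -mulrDl.
  move=> h; apply: (tilt_sum_ge t1 t2 t4 q0 (And4 y10 y20 y30 y40)); apply: Or42.
  by rewrite (_ : \1_G w = 1) ?mulr1// indicE mem_set.
pose p := fine (P A); pose g := fine (P G).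
have k2 : 0 <= k / 2 by rewrite divr_ge0// ltW.
have k2' : 0 <= k^-1 / 2 by rewrite divr_ge0// invr_ge0 ltW.
have mf : mean_le P f (k / 2 * expR (C * v n) + k^-1 / 2 * p +
    expR (- kap * v n) * ((1 + 1) + (1 + 1)) + expR (K * v n) * g).
  apply: mean_leD; last first.
    by apply: mean_leZ; [exact: expR_ge0|exact: mean_le_indic].
  apply: mean_leD; last first.
    apply: mean_leZ; first exact: expR_ge0.
    by apply: mean_leD; apply: mean_leD.
  by apply: mean_leD; apply: mean_leZ => //; exact: mean_le_indic.
have {mf} [_ _ le1] := mean_le_dom (g := fun w => expR (v n * D l1 l2 n w)) mD
  (fun w => introT andP (conj (expR_ge0 _) (fD w))) mf.
have {le1} := le_trans ge1 le1; rewrite lee_fin => le1.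
have -> : P G = g%:E by rewrite fineK// fin_num_measure.
rewrite lee_fin.
have e8 : expR (- v n) <= 8^-1 by apply: expRN_le_inv => //; lra.
have pA : k^-1 / 2 * p <= 8^-1.
  have pL : p <= expR (- L' * v n) by rewrite -lee_fin fineK// fin_num_measure.
  rewrite mulrAC -mulrA -expRN.
  apply: (@le_trans _ _ (expR (- v n) / 2)); last first.
    by apply: le_trans e8; rewrite ler_pdivrMr// ler_peMr ?expR_ge0// ler1n.
  rewrite mulrA ler_pM2r// (le_trans (ler_wpM2l (expR_ge0 _) pL))//.
  rewrite -expRD ler_expR.
  have -> : - (- (C + 1) * v n) + - L' * v n = - (L' - (C + 1)) * v n by ring.
  rewrite mulNr lerN2 ler_peMl ?ltW//; move: LL'; rewrite /L0; lra.
have pC : k / 2 * expR (C * v n) <= 8^-1.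
  rewrite mulrAC -expRD.
  have -> : - (C + 1) * v n + C * v n = - v n by ring.
  by have := expR_gt0 (- v n); lra.
have pk : expR (- kap * v n) <= 16^-1.
  rewrite mulNr; apply: expRN_le_inv => //.
  by rewrite ler_wpDl// mulrC -ler_pdivrMr.
(* The second half of [eta] pays for the constant factor [2^-1] below. *)
have pe : expR (- (eta / 2) * v n) <= 2^-1.
  rewrite mulNr; apply: expRN_le_inv => //.
  by move: ve; rewrite ler_pdivrMr//; lra.
(* The tilt has mean at least one, and the other terms account for at most
   [8^-1 + 8^-1 + 4 * 16^-1 = 2^-1]: at least half of the mass is on [G]. *)
have {le1} : 2^-1 <= expR (K * v n) * g by lra.
have g0 : 0 <= g by exact: fine_ge0.
have -> : - (qform a b c l1 l2 + eta) * v n = - (K * v n) + - (eta / 2) * v n.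
  by rewrite /K; field.
rewrite expRD expRN => gK.
have EK := expR_gt0 (K * v n).
rewrite mulrC ler_pdivrMr// (le_trans pe)//.
by rewrite mulrC.
Qed.

End gaussian_tilting.

Lemma limn_esup_le_near {R : realType} (u : nat -> \bar R) (l : \bar R) :
  (\forall n \near \oo, (u n <= l)%E) -> (limn_esup u <= l)%E.
Proof.
move=> h; rewrite /limn_esup limf_esupE.
apply: (@le_trans _ _ (ereal_sup [set u n | n in [set n | (u n <= l)%E]])).
  by apply: ereal_inf_lbound; exists [set n | (u n <= l)%E].
by apply: ub_ereal_sup => _ [n un <-].
Qed.

Lemma limn_einf_ge_near {R : realType} (u : nat -> \bar R) (l : \bar R) :
  (\forall n \near \oo, (l <= u n)%E) -> (l <= limn_einf u)%E.
Proof.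
move=> h; rewrite /limn_einf leeNr; apply: limn_esup_le_near.
by apply: filterS h => n; rewrite leeN2.
Qed.

(** * From superexponential and local bounds to the large deviation principle *)

Section large_deviations.
Context {d : measure_display} {T : measurableType d} {R : realType}.
Variables (P : probability T R) (v : nat -> R).
Hypothesis voo : v n @[n --> \oo] --> +oo.

Let FF L : Filter (superexp P v L) := superexp_filter P voo L.
Local Existing Instance FF.

Lemma borel_preimage (E : topologicalType) (f : T -> E) :
  (forall U, open U -> measurable (f @^-1` U)) ->
  forall B, <<s @open E >> B -> measurable (f @^-1` B).
Proof.
move=> mf; apply: smallest_sub => //; split.
- by rewrite /= preimage_set0.
- by move=> A /= mA; rewrite setTD preimage_setC; exact: measurableC.
- by move=> F mF /=; rewrite preimage_bigcup; exact: bigcup_measurable.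
Qed.

(** Bounds on the sublevel sets of [I] are enough above: a Borel set whose closure has infimum [r]
    lies in the region [I >= r], so closed sets need no covering. Below, neighbourhoods of the
    points of the interior are enough. *)
Lemma ldp_of_bounds (E : topologicalType) (Z : nat -> T -> E) (I : E -> R) :
    good_rate_function (fun x => (I x)%:E) ->
    (forall n U, open U -> measurable (Z n @^-1` U)) ->
    (forall k L, 0 < k -> L < k -> superexp P v L [set z | I (Z z.1 z.2) < k]) ->
    (forall x U eta, open U -> U x -> 0 < eta -> \forall n \near \oo,
      ((expR (- (I x + eta) * v n))%:E <= P (Z n @^-1` U))%E) ->
  large_deviation_principle P Z v (fun x => (I x)%:E).
Proof.
move=> hI mZ UB LB; split=> // B sB u.
have mB n : measurable (Z n @^-1` B) by apply: borel_preimage => //; exact: mZ.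
split; last 2 first.
- exact: limn_einf_sup.
- have IB x : B x -> (ereal_inf [set (I x)%:E | x in closure B] <= (I x)%:E)%E.
    by move=> Bx; apply: ereal_inf_lbound; exists x => //; exact: subset_closure.
  have u_le n r : 0 < v n -> (P (Z n @^-1` B) <= (expR (- r * v n))%:E)%E ->
      (u n <= - r%:E)%E.
    move=> vn0 h; rewrite /u lee_pdivrMl// -EFinN -EFinM.
    have -> : (v n * - r)%:E = lne (expR (- r * v n))%:E.
      by rewrite lne_EFin ?expR_gt0// expRK; congr EFin; ring.
    by rewrite lee_lne// ?in_itv/= ?leey ?andbT ?lee_fin ?expR_ge0//.
  case Em : (ereal_inf _) => [r| |]; last by rewrite leey.
  + rewrite leeNr; apply/lee_subgt0Pr => eta eta0; rewrite -EFinB leeNr.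
    apply: limn_esup_le_near.
    (* When [r - eta <= 0], the bound of a probability by one already gives the claim; otherwise the
       level [r - eta / 2] is positive. *)
    have [re|re] := leP (r - eta) 0.
      apply: filterS (near_speed_ge voo 1) => n v1.
      apply: u_le; first exact: lt_le_trans v1.
      apply: le_trans (probability_le1 _ _) _; rewrite ?lee_fin//.
      by rewrite -expR0 ler_expR mulr_ge0 ?oppr_ge0//; lra.
    have [] := UB (r - eta / 2) (r - eta); [lra|lra|].
    move=> L' LL' h; apply: filterS2 h (near_speed_ge voo 1) => n [A [mA PA AI]] v1.
    have vn0 : 0 < v n by exact: lt_le_trans v1.
    apply: u_le => //; apply: le_trans (le_trans PA _); last first.
      by rewrite lee_fin ler_expR ler_pM2r// lerN2 ltW.
    apply: le_measure; rewrite ?inE// => w Bw; apply: contrapT => /AI /=.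
    by have := IB _ Bw; rewrite Em lee_fin; lra.
  (* As [I] takes finite values, an infinite infimum forces [B] to be empty. *)
  + have B0 : B = set0.
      by apply/seteqP; split => // x /IB; rewrite Em leye_eq.
    rewrite /= leeNy_eq; apply/eqP; apply/eqP; rewrite -leeNy_eq.
    apply: limn_esup_le_near; apply: filterS (near_speed_ge voo 1) => n v1.
    have vn0 : 0 < v n by exact: lt_le_trans v1.
    rewrite /u B0 preimage_set0 measure0 le0_lneNy// mulrNy gtr0_sg ?invr_gt0//.
    by rewrite mul1e.
rewrite leeNl; apply: le_ereal_inf_tmp => _ [x Bx <-].
rewrite leeNl; apply/lee_subgt0Pr => eta eta0.
apply: limn_einf_ge_near.
apply: filterS2 (LB x _ eta (open_interior B) Bx eta0) (near_speed_ge voo 1) => n hn v1.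
have vn0 : 0 < v n by lra.
rewrite /u lee_pdivlMl// -EFinN -EFinB -EFinM.
have le1 : ((expR (- (I x + eta) * v n))%:E <= P (Z n @^-1` B))%E.
  apply: le_trans hn _; apply: le_measure; rewrite ?inE//.
    by apply: mZ; exact: open_interior.
  by apply: preimage_subset; exact: interior_subset.
have -> : (v n * (- I x - eta))%:E = lne (expR (- (I x + eta) * v n))%:E.
  by rewrite lne_EFin ?expR_gt0// expRK; congr EFin; ring.
rewrite lee_lne// ?in_itv/= ?leey ?andbT ?lee_fin ?expR_ge0//.
Qed.

End large_deviations.

Lemma cvg0_mul_bounded {R : realType} {I : Type} {F : set_system I} {FF : Filter F}
    (f g : I -> R) (K : R) :
  f z @[z --> F] --> 0 -> (\forall z \near F, `|g z| <= K) ->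
  g z * f z @[z --> F] --> 0.
Proof.
move=> f0 gK; apply/cvgrPdist_lt => e e0.
have K0 : 0 < `|K| + 1 by rewrite ltr_wpDl.
have eK : 0 < e / (`|K| + 1) by exact: divr_gt0.
move/cvgrPdist_lt : f0 => /(_ _ eK); apply: filterS2 gK => z gK.
rewrite !sub0r !normrN normrM => fz.
rewrite ltr_pdivlMr// in fz; apply: le_lt_trans fz.
rewrite mulrC ler_wpM2l//; apply: le_trans gK _.
by rewrite (le_trans (ler_norm _))// lerDl.
Qed.

Lemma filterS4 {T : Type} {F : set_system T} {FF : Filter F} (P1 P2 P3 P4 Q : T -> Prop) :
  (forall z, P1 z -> P2 z -> P3 z -> P4 z -> Q z) ->
  F P1 -> F P2 -> F P3 -> F P4 -> F Q.
Proof.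
move=> h h1 h2 h3 h4.
have h12 : F (P1 `&` P2) by exact: filterI.
by apply: (@filterS3 _ _ FF _ _ _ _ _ h12 h3 h4) => z [] *; exact: h.
Qed.

Lemma cvg_near_eq {R : realType} {I : Type} {F : set_system I} {FF : Filter F}
    (f g : I -> R) (l : R) :
  (\forall z \near F, f z = g z) -> g z @[z --> F] --> l -> f z @[z --> F] --> l.
Proof.
move=> fg; apply: cvg_trans; apply: near_eq_cvg.
by apply: filterS fg => z ->.
Qed.

(* Dispatching on the syntax of the function avoids unification attempts that
   fail slowly. *)
Ltac cvg_field := repeat match goal with
  | H : ?G |- ?G => exact: H
  | |- context [fmap (fun _ => ?c) _] => exact: cvg_cst
  | |- context [fmap (fun z => @?f z - @?g z) _] => apply: cvgB
  | |- context [fmap (fun z => @?f z + @?g z) _] => apply: cvgD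
  | |- context [fmap (fun z => - @?f z) _] => apply: cvgN
  | |- context [fmap (fun z => @?f z * @?g z) _] => apply: cvgM
  end.

(** The variance of the stationary solution of the recursion of order two with characteristic roots
    [theta] and [rho]. *)
Definition stationary_variance {R : realType} (theta rho sigma : R) : R :=
  (1 + theta * rho) * sigma ^+ 2 /
  ((1 - theta * rho) * ((1 - theta ^+ 2) * (1 - rho ^+ 2))).

(** * Limits deduced from the normal equations, along an arbitrary filter *)

Section yule_walker_limits.
Context {R : realType} {I : Type} {F : set_system I} {FF : Filter F}.
Variables theta rho sigma : R.
Hypothesis htheta : `|theta| < 1.
Hypothesis hrho : `|rho| < 1.
Hypothesis sigma0 : 0 < sigma.
Let phi := theta + rho.
Let psi := theta * rho.
Let th := theta_star theta rho.
Let kap := (1 - psi) * ((1 - theta ^+ 2) * (1 - rho ^+ 2)).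
Let ell := stationary_variance theta rho sigma.

Lemma theta_sqr_lt1 : 0 < 1 - theta ^+ 2.
Proof. by rewrite subr_gt0 -[_ ^+ 2]ger0_norm ?sqr_ge0// normrX exprn_ilt1. Qed.

Lemma rho_sqr_lt1 : 0 < 1 - rho ^+ 2.
Proof. by rewrite subr_gt0 -[_ ^+ 2]ger0_norm ?sqr_ge0// normrX exprn_ilt1. Qed.

Lemma psi_lt1 : `|psi| < 1.
Proof. by rewrite /psi normrM mulr_ilt1. Qed.

Lemma onepsi_gt0 : 0 < 1 + psi.
Proof. by move: psi_lt1; rewrite ltr_norml => /andP[]; lra. Qed.

Lemma onempsi_gt0 : 0 < 1 - psi.
Proof. by move: psi_lt1; rewrite ltr_norml => /andP[]; lra. Qed.

Lemma kap_gt0 : 0 < kap.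
Proof. by rewrite !mulr_gt0 ?onempsi_gt0 ?theta_sqr_lt1 ?rho_sqr_lt1. Qed.

Lemma stationary_variance_gt0 : 0 < ell.
Proof. by rewrite divr_gt0 ?kap_gt0// mulr_gt0 ?onepsi_gt0// exprn_gt0. Qed.

Lemma theta_starE : th = phi / (1 + psi). Proof. by []. Qed.

Lemma theta_star_sqrE : 1 - th ^+ 2 = (1 - theta ^+ 2) * (1 - rho ^+ 2) / (1 + psi) ^+ 2.
Proof. by rewrite theta_starE /phi /psi; field; rewrite gt_eqF// onepsi_gt0. Qed.

Lemma theta_star_sqr_lt1 : 0 < 1 - th ^+ 2.
Proof.
by rewrite theta_star_sqrE divr_gt0 ?exprn_gt0 ?onepsi_gt0// mulr_gt0 ?theta_sqr_lt1 ?rho_sqr_lt1.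
Qed.

(** [N] is the number of terms; [S], [C], [Q] are the sums of X_k^2 and of the products at lags one
    and two; [M], [M'] are the sums of X_(k-1) V_k and X_(k-2) V_k; [L] is the sum of V_k^2; the
    [r]s are boundary terms. *)
Variables N S C Q M M' L r1 r2 r3 : I -> R.
Hypothesis N0 : \forall z \near F, 0 < N z.
Hypothesis hC : \forall z \near F, (1 + psi) * C z = phi * S z + M z + r1 z.
Hypothesis hQ : \forall z \near F, Q z = phi * C z - psi * S z + M' z + r2 z.
Hypothesis hS : \forall z \near F,
  S z = phi * C z - psi * Q z + phi * M z - psi * M' z + L z + r3 z.
Hypothesis cvgL : L z / N z @[z --> F] --> sigma ^+ 2.

Section first_order.
Hypothesis cvgM0 : M z / N z @[z --> F] --> 0.
Hypothesis cvgM'0 : M' z / N z @[z --> F] --> 0.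
Hypothesis cvgr1 : r1 z / N z @[z --> F] --> 0.
Hypothesis cvgr2 : r2 z / N z @[z --> F] --> 0.
Hypothesis cvgr3 : r3 z / N z @[z --> F] --> 0.

(** Eliminating [C] and [Q] from the three linear equations leaves [kap * S] as a combination of
    noise sums, and among these only [L] survives the division by [N]. *)
Lemma cvg_square_sum : S z / N z @[z --> F] --> ell.
Proof.
apply: (@cvg_near_eq _ _ _ _ _ (fun z => (phi * (1 - psi) * (M z / N z + r1 z / N z) +
  (1 + psi) * (phi * (M z / N z) - 2 * psi * (M' z / N z) + L z / N z + r3 z / N z
    - psi * (r2 z / N z))) / kap)).
  apply: (filterS4 _ hC hQ hS N0) => z h1 h2 h3 Nz; have nz := lt0r_neq0 Nz; have kz := lt0r_neq0 kap_gt0.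
  have E : S z * kap = phi * (1 - psi) * (M z + r1 z) +
      (1 + psi) * (phi * M z - 2 * psi * M' z + L z + r3 z - psi * r2 z).
    have -> : kap = (1 - psi) * ((1 + psi) ^+ 2 - phi ^+ 2) by rewrite /kap /phi /psi; ring.
    have h4 : S z * (1 + psi) = phi * ((1 + psi) * C z) - psi * ((1 + psi) * Q z) +
        (1 + psi) * (phi * M z - psi * M' z + L z + r3 z).
      by rewrite {1}h3; ring.
    have h5 : (1 + psi) * Q z = phi * ((1 + psi) * C z) +
        (1 + psi) * (- psi * S z + M' z + r2 z).
      by rewrite h2; ring.
    rewrite h5 h1 in h4.
    by move: h4; lra.
  apply: (mulIf nz); apply: (mulIf kz); rewrite divfK// E; field.
  by rewrite nz kz.
have -> : ell = (phi * (1 - psi) * (0 + 0) +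
  (1 + psi) * (phi * 0 - 2 * psi * 0 + sigma ^+ 2 + 0 - psi * 0)) / kap.
  by rewrite /ell /stationary_variance; congr (_ / _); rewrite -/psi; ring.
cvg_field.
Qed.

Lemma cvg_product_sum : C z / N z @[z --> F] --> th * ell.
Proof.
have cS := cvg_square_sum.
apply: (@cvg_near_eq _ _ _ _ _ (fun z => (phi * (S z / N z) + M z / N z + r1 z / N z)
  * (1 + psi)^-1)).
  apply: filterS2 hC N0 => z h1 Nz.
  have -> : C z = (phi * S z + M z + r1 z) / (1 + psi).
    by rewrite -h1; field; rewrite lt0r_neq0 ?onepsi_gt0.
  by field; rewrite !lt0r_neq0 ?onepsi_gt0.
have -> : th * ell = (phi * ell + 0 + 0) * (1 + psi)^-1.
  by rewrite theta_starE; field; rewrite lt0r_neq0 ?onepsi_gt0.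
cvg_field.
Qed.

End first_order.

Section second_order.
(** [eta] is the scale of the deviations, [tau] the estimator of [theta], [J] and [H] the numerator
    and denominator of the estimator of [rho]. At the scale [N * eta] the sums [M] and [M'] are
    merely bounded, while the boundary terms vanish. *)
Variables (eta J H r4 r5 : I -> R) (K : R).
Hypothesis eta_gt0 : \forall z \near F, 0 < eta z.
Hypothesis cvgeta : eta z @[z --> F] --> 0.
Hypothesis bndM : \forall z \near F, `|M z / (N z * eta z)| <= K.
Hypothesis bndM' : \forall z \near F, `|M' z / (N z * eta z)| <= K.
Hypothesis cvgr1 : r1 z / (N z * eta z) @[z --> F] --> 0.
Hypothesis cvgr2 : r2 z / (N z * eta z) @[z --> F] --> 0.
Hypothesis cvgr3 : r3 z / (N z * eta z) @[z --> F] --> 0.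
Let tau z := C z / S z.
Hypothesis hJ : \forall z \near F,
  J z = C z - tau z * Q z - tau z * S z + tau z ^+ 2 * C z + r4 z.
Hypothesis hH : \forall z \near F, H z = S z - 2 * tau z * C z + tau z ^+ 2 * S z + r5 z.

Let scale (f : I -> R) : f z / (N z * eta z) @[z --> F] --> 0 ->
  f z / N z @[z --> F] --> 0.
Proof.
move=> cf; apply: (@cvg_near_eq _ _ _ _ _ (fun z => (f z / (N z * eta z)) * eta z)).
  by apply: filterS2 eta_gt0 N0 => z ez Nz; field; rewrite !lt0r_neq0.
rewrite -[X in _ --> X](mulr0 0); cvg_field.
Qed.

Let scaleM (f : I -> R) : (\forall z \near F, `|f z / (N z * eta z)| <= K) ->
  f z / N z @[z --> F] --> 0.
Proof.
move=> cf; apply: (@cvg_near_eq _ _ _ _ _ (fun z => (f z / (N z * eta z)) * eta z)).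
  by apply: filterS2 eta_gt0 N0 => z ez Nz; field; rewrite !lt0r_neq0.
exact: cvg0_mul_bounded cf.
Qed.

Lemma cvg_square_sum_scaled : S z / N z @[z --> F] --> ell.
Proof. by apply: cvg_square_sum; [exact: scaleM|exact: scaleM|exact: scale|exact: scale|exact: scale]. Qed.

Lemma cvg_product_sum_scaled : C z / N z @[z --> F] --> th * ell.
Proof. by apply: cvg_product_sum; [exact: scaleM|exact: scaleM|exact: scale|exact: scale|exact: scale]. Qed.

Let cS := cvg_square_sum_scaled.
Let cC := cvg_product_sum_scaled.

Let S0 : \forall z \near F, 0 < S z.
Proof.
have : \forall z \near F, 0 < S z / N z by apply: (cvgr_gt _ cS); exact: stationary_variance_gt0.
by apply: filterS2 N0 => z Nz; rewrite pmulr_lgt0// invr_gt0.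
Qed.

Lemma cvg_tau : tau z @[z --> F] --> th.
Proof.
apply: (@cvg_near_eq _ _ _ _ _ (fun z => (C z / N z) * (S z / N z)^-1)).
  by apply: filterS2 S0 N0 => z Sz Nz; rewrite /tau; field; rewrite !lt0r_neq0.
have -> : th = (th * ell) * ell^-1 by rewrite mulfK// lt0r_neq0 ?stationary_variance_gt0.
by apply: cvgM => //; apply: cvgV => //; rewrite lt0r_neq0 ?stationary_variance_gt0.
Qed.

(** The first normal equation gives exactly [tau - th = (M + r1) / ((1 + psi) * S)]. Replacing
    [S / N] by its limit multiplies a bounded quantity by a vanishing one. *)
Lemma cvg_theta_hat :
  (tau z - th) / eta z - (M z / (N z * eta z)) / ((1 + psi) * ell) @[z --> F] --> 0.
Proof.
pose f z := (M z / (N z * eta z)) * (((S z / N z)^-1 - ell^-1) / (1 + psi)) +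
  (r1 z / (N z * eta z)) * ((S z / N z)^-1 / (1 + psi)).
have el0 := lt0r_neq0 stationary_variance_gt0; have op0 := lt0r_neq0 onepsi_gt0.
apply: (@cvg_near_eq _ _ _ _ _ f).
  apply: (filterS4 _ hC S0 N0 eta_gt0) => z h1 Sz Nz ez.
  have {}h1 : C z = (phi * S z + M z + r1 z) / (1 + psi) by rewrite -h1; field.
  by rewrite /f /tau theta_starE h1; field; rewrite op0 el0 !lt0r_neq0.
have cSV : (S z / N z)^-1 @[z --> F] --> ell^-1 by exact: cvgV.
have -> : 0 = 0 + 0 * (ell^-1 / (1 + psi)) :> R by rewrite mul0r addr0.
apply: cvgD; last by cvg_field.
apply: cvg0_mul_bounded bndM.
have -> : 0 = (ell^-1 - ell^-1) * (1 + psi)^-1 :> R by rewrite subrr mul0r.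
cvg_field.
Qed.

Hypothesis cvgr4 : r4 z / (N z * eta z) @[z --> F] --> 0.
Hypothesis cvgr5 : r5 z / (N z * eta z) @[z --> F] --> 0.
Let rs := rho_star theta rho.

Lemma cvg_rho_hat :
  (J z / H z - rs) / eta z -
    ((M z / (N z * eta z)) * ((th ^+ 2 + psi) / ((1 + psi) * (1 - th ^+ 2) * ell)) -
     (M' z / (N z * eta z)) * (th / ((1 - th ^+ 2) * ell))) @[z --> F] --> 0.
Proof.
have el0 := lt0r_neq0 stationary_variance_gt0; have op0 := lt0r_neq0 onepsi_gt0.
have t0 := lt0r_neq0 theta_star_sqr_lt1.
have ct := cvg_tau.
have ct2 : tau z ^+ 2 @[z --> F] --> th ^+ 2 by exact: cvgM.
have cr5 := scale cvgr5.
have cH : H z / N z @[z --> F] --> (1 - th ^+ 2) * ell.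
  apply: (@cvg_near_eq _ _ _ _ _ (fun z => (1 - tau z ^+ 2) * (S z / N z) + r5 z / N z)).
    apply: filterS3 hH S0 N0 => z -> Sz Nz.
    by rewrite /tau; field; rewrite !lt0r_neq0.
  rewrite -[X in _ --> X]addr0; cvg_field.
have Hl0 : 0 < (1 - th ^+ 2) * ell by rewrite mulr_gt0 ?stationary_variance_gt0 ?theta_star_sqr_lt1.
have H0 : \forall z \near F, 0 < H z.
  have : \forall z \near F, 0 < H z / N z by exact: (cvgr_gt _ cH).
  by apply: filterS2 N0 => z Nz; rewrite pmulr_lgt0// invr_gt0.
have cHV : (H z / N z)^-1 @[z --> F] --> ((1 - th ^+ 2) * ell)^-1.
  by apply: cvgV => //; rewrite lt0r_neq0.
pose f z := (M z / (N z * eta z)) * ((tau z ^+ 2 + psi) / (1 + psi) * (H z / N z)^-1 -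
    (th ^+ 2 + psi) / (1 + psi) * ((1 - th ^+ 2) * ell)^-1) +
  (M' z / (N z * eta z)) * (th * ((1 - th ^+ 2) * ell)^-1 - tau z * (H z / N z)^-1) +
  ((r1 z / (N z * eta z)) * ((tau z ^+ 2 + psi) / (1 + psi)) -
   tau z * (r2 z / (N z * eta z)) + r4 z / (N z * eta z) - rs * (r5 z / (N z * eta z)))
  * (H z / N z)^-1.
apply: (@cvg_near_eq _ _ _ _ _ f).
  have hSNe : \forall z \near F, [/\ 0 < S z, 0 < N z & 0 < eta z].
    by apply: filterS3 S0 N0 eta_gt0.
  have hJHQ : \forall z \near F, [/\ J z = C z - tau z * Q z - tau z * S z + tau z ^+ 2 * C z + r4 z,
    H z = S z - 2 * tau z * C z + tau z ^+ 2 * S z + r5 z &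
    Q z = phi * C z - psi * S z + M' z + r2 z].
    by apply: filterS3 hJ hH hQ.
  apply: (filterS4 _ hC hSNe hJHQ H0) => z h1 [Sz Nz ez] [hJz hHz hQz] Hz.
  have CE : C z = tau z * S z by rewrite /tau divfK// lt0r_neq0.
  have phiE : phi = th * (1 + psi) by rewrite theta_starE divfK.
  have {}h1 : M z = (1 + psi) * (tau z - th) * S z - r1 z.
    by move: h1; rewrite CE phiE => h1; lra.
  (* In [J - rs * H] the part proportional to [S] factors as [S * (tau - th) * (tau ^+ 2 + psi)],
     and [(1 + psi) * (tau - th) * S] is [M + r1]. Thus [rs] is exactly the centring that leaves
     only noise sums and boundary terms. *)
  have JE : J z = rs * H z + ((M z + r1 z) * ((tau z ^+ 2 + psi) / (1 + psi)) -
      tau z * (M' z + r2 z) + r4 z - rs * r5 z).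
    rewrite hJz hHz hQz CE h1 phiE /rs /rho_star -/th -/psi.
    by field.
  rewrite JE /f; field.
  by rewrite op0 el0 t0 !lt0r_neq0.
have -> : 0 = 0 + 0 + (0 * ((th ^+ 2 + psi) / (1 + psi)) - th * 0 + 0 - rs * 0) *
    ((1 - th ^+ 2) * ell)^-1 :> R by ring.
apply: cvgD; last by cvg_field.
apply: cvgD.
  apply: cvg0_mul_bounded bndM.
  rewrite -(subrr ((th ^+ 2 + psi) / (1 + psi) * ((1 - th ^+ 2) * ell)^-1)).
  cvg_field.
apply: cvg0_mul_bounded bndM'.
rewrite -(subrr (th * ((1 - th ^+ 2) * ell)^-1)).
cvg_field.
Qed.

End second_order.
End yule_walker_limits.

(** * Exact summation identities for the recursion of order two *)

Section autoregressive_sums.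
Context {R : comRingType}.
Variables (theta rho : R) (x e v : nat -> R).
Hypothesis hx : forall k, x k.+1 = theta * x k + e k.+1.
Hypothesis he : forall k, e k.+1 = rho * e k + v k.+1.
Let phi := theta + rho.
Let psi := theta * rho.

Definition sum_sq n := \sum_(k < n) x k ^+ 2.
Definition sum_lag1 n := \sum_(k < n) x k.+1 * x k.
Definition sum_lag2 n := \sum_(k < n) x k.+1 * x k.-1.
Definition sum_noise1 n := \sum_(k < n) x k * v k.+1.
Definition sum_noise2 n := \sum_(k < n) x k.-1 * v k.+1.
Definition sum_noise_sq n := \sum_(k < n) v k.+1 ^+ 2.

(* [x 0] stands for the missing [x (-1)], at the cost of this term in the
   recursion of order two. *)
Definition init_term := rho * e 0 - rho * x 0 + psi * x 0.

Lemma ar2 k : x k.+2 = phi * x k.+1 - psi * x k + v k.+2.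
Proof. by rewrite hx he [in RHS]hx /phi /psi (hx k); ring. Qed.

Lemma ar2_init : x 1 = phi * x 0 - psi * x 0 + v 1%N + init_term.
Proof. by rewrite hx he /init_term /phi /psi; ring. Qed.

(** The recursion multiplied by [x k] and summed. The lagged product [x k * x k.-1] sums to
    [sum_lag1] up to a boundary product, whence the factor [1 + psi]. *)
Lemma sum_lag1E n : (1 + psi) * sum_lag1 n.+1 = phi * sum_sq n.+1 + sum_noise1 n.+1 +
  (psi * (x n.+1 * x n) - psi * x 0 ^+ 2 + init_term * x 0).
Proof.
rewrite /sum_lag1 /sum_sq /sum_noise1.
elim: n => [|n ih]; first by rewrite !big_ord1 /= ar2_init; ring.
rewrite big_ord_recr [in RHS]big_ord_recr/= mulrDr ih.
rewrite [\sum_(k < n.+2) x k * v k.+1]big_ord_recr/=.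
by rewrite ar2; ring.
Qed.

(** The recursion multiplied by [x k.-1] and summed. *)
Lemma sum_lag2E n : sum_lag2 n.+1 = phi * sum_lag1 n.+1 - psi * sum_sq n.+1 +
  sum_noise2 n.+1 + (- phi * (x n.+1 * x n) + phi * x 0 ^+ 2 + psi * x n ^+ 2
    - psi * x 0 ^+ 2 + init_term * x 0).
Proof.
rewrite /sum_lag1 /sum_lag2 /sum_sq /sum_noise2.
elim: n => [|n ih]; first by rewrite !big_ord1 /= ar2_init; ring.
rewrite big_ord_recr/= ih.
rewrite [\sum_(k < n.+2) x k.+1 * x k]big_ord_recr/=.
rewrite [\sum_(k < n.+2) x k ^+ 2]big_ord_recr/=.
rewrite [\sum_(k < n.+2) x k.-1 * v k.+1]big_ord_recr/=.
by rewrite ar2; ring.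
Qed.

(** The recursion multiplied by [x k.+1] and summed; expanding [x k.+1 * v k.+1] by the recursion
    once more brings in the noise sums and the squared noise. *)
Lemma sum_sqE n : sum_sq n.+1 = phi * sum_lag1 n.+1 - psi * sum_lag2 n.+1 +
  phi * sum_noise1 n.+1 - psi * sum_noise2 n.+1 + sum_noise_sq n.+1 +
  (init_term * v 1%N + init_term * x 1%N - x n.+1 ^+ 2 + x 0 ^+ 2).
Proof.
rewrite /sum_lag1 /sum_lag2 /sum_sq /sum_noise1 /sum_noise2 /sum_noise_sq.
elim: n => [|n ih]; first by rewrite !big_ord1 /= ar2_init; ring.
rewrite big_ord_recr/= ih.
rewrite [\sum_(k < n.+2) x k.+1 * x k]big_ord_recr/=.
rewrite [\sum_(k < n.+2) x k.+1 * x k.-1]big_ord_recr/=.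
rewrite [\sum_(k < n.+2) x k * v k.+1]big_ord_recr/=.
rewrite [\sum_(k < n.+2) x k.-1 * v k.+1]big_ord_recr/=.
rewrite [\sum_(k < n.+2) v k.+1 ^+ 2]big_ord_recr/=.
by rewrite ar2; ring.
Qed.

Variable tau : R.
Let res k := if k is k'.+1 then x k - tau * x k' else x 0.

(** The boundary terms come from the two ends of the shifted sums and from the residual of index 0,
    which is [x 0] itself. *)
Lemma sum_residual_lag1E n : \sum_(k < n.+1) res k.+1 * res k =
  sum_lag1 n.+1 - tau * sum_lag2 n.+1 - tau * sum_sq n.+1 + tau ^+ 2 * sum_lag1 n.+1 +
  (tau ^+ 2 * (x 0 ^+ 2 - x n.+1 * x n) + (x 1%N - tau * x 0) * tau * x 0).
Proof.
rewrite /sum_lag1 /sum_lag2 /sum_sq.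
elim: n => [|n ih]; first by rewrite !big_ord1 /=; ring.
rewrite big_ord_recr/= ih.
rewrite [\sum_(k < n.+2) x k.+1 * x k]big_ord_recr/=.
rewrite [\sum_(k < n.+2) x k.+1 * x k.-1]big_ord_recr/=.
rewrite [\sum_(k < n.+2) x k ^+ 2]big_ord_recr/=.
by ring.
Qed.

Lemma sum_residual_sqE n : \sum_(k < n.+1) res k ^+ 2 =
  sum_sq n.+1 - 2 * tau * sum_lag1 n.+1 + tau ^+ 2 * sum_sq n.+1 +
  (2 * tau * (x n.+1 * x n) - tau ^+ 2 * x n ^+ 2).
Proof.
rewrite /sum_lag1 /sum_sq.
elim: n => [|n ih]; first by rewrite !big_ord1 /=; ring.
rewrite big_ord_recr/= ih.
rewrite [\sum_(k < n.+2) x k.+1 * x k]big_ord_recr/=.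
rewrite [\sum_(k < n.+2) x k ^+ 2]big_ord_recr/=.
by ring.
Qed.

End autoregressive_sums.

(** * Pathwise bounds for stable recursions *)

Section autoregressive_bounds.
Context {R : realType}.
Implicit Types a r : R.

(** Young's inequality for the cross term, with the weight [1 - |a|] chosen so that the coefficients
    of [y ^+ 2] add up to [|a|] exactly. *)
Lemma ar1_sqr_le a (y u : R) : `|a| < 1 ->
  (a * y + u) ^+ 2 <= `|a| * y ^+ 2 + u ^+ 2 / (1 - `|a|).
Proof.
move=> a1; have s0 : 0 < 1 - `|a| by lra.
have -> : u ^+ 2 / (1 - `|a|) = u ^+ 2 + `|a| * u ^+ 2 / (1 - `|a|).
  by field; rewrite lt0r_neq0.
have E : a ^+ 2 = `|a| ^+ 2 by rewrite -normrX ger0_norm ?sqr_ge0.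
have h1 : 2 * (a * y * u) <= 2 * (`|a| * `|y| * `|u|).
  by rewrite ler_pM2l// -!normrM ler_norm.
have h2 : 2 * (`|y| * `|u|) <= (1 - `|a|) * y ^+ 2 + u ^+ 2 / (1 - `|a|).
  rewrite -(real_normK (num_real y)) -(real_normK (num_real u)) -subr_ge0.
  have -> : (1 - `|a|) * `|y| ^+ 2 + `|u| ^+ 2 / (1 - `|a|) - 2 * (`|y| * `|u|) =
      ((1 - `|a|) * `|y| - `|u|) ^+ 2 / (1 - `|a|).
    by field; rewrite lt0r_neq0.
  by rewrite divr_ge0 ?sqr_ge0// ltW.
have {}h2 := ler_wpM2l (normr_ge0 a) h2.
rewrite sqrrD exprMn E mulr2n; lra.
Qed.

Lemma ar1_sum_sqr_le a (y u : nat -> R) n : `|a| < 1 -> y 0%N = 0 ->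
  (forall k, y k.+1 = a * y k + u k.+1) ->
  \sum_(k < n.+1) y k ^+ 2 <= (1 - `|a|) ^- 2 * \sum_(k < n) u k.+1 ^+ 2.
Proof.
move=> a1 y0 hy; have s0 : 0 < 1 - `|a| by lra.
(* The last square, with coefficient [|a|], is retained to make the induction close. *)
have h m : (1 - `|a|) * (\sum_(k < m.+1) y k ^+ 2) + `|a| * y m ^+ 2 <=
    (\sum_(k < m) u k.+1 ^+ 2) / (1 - `|a|).
  elim: m => [|m ih].
    by rewrite big_ord1 big_ord0 /= y0 expr0n/= !mulr0 addr0 mul0r.
  rewrite big_ord_recr/= [X in _ <= X / _]big_ord_recr/= mulrDl.
  have := ar1_sqr_le (y m) (u m.+1) a1; rewrite -hy; lra.
have := h n; have := mulr_ge0 (normr_ge0 a) (sqr_ge0 (y n)) => p1 p2.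
rewrite -(ler_pM2l s0) mulrA.
have -> : (1 - `|a|) * (1 - `|a|) ^- 2 = (1 - `|a|)^-1 by field; rewrite lt0r_neq0.
by rewrite [X in _ <= X]mulrC; lra.
Qed.

(** Meant for the difference of two solutions driven by the same noise. Taking [r] strictly above
    both [|theta|] and [|rho|] absorbs the polynomial factor that appears when the roots have equal
    modulus, and keeps [r] positive when both vanish. *)
Lemma ar2_geometric_decay (theta rho : R) : `|theta| < 1 -> `|rho| < 1 ->
  exists r A : R, [/\ 0 < r, r < 1, 0 <= A & forall y z : nat -> R,
    (forall k, y k.+1 = theta * y k + z k.+1) -> (forall k, z k.+1 = rho * z k) ->
    forall k, `|y k| <= A * (`|y 0%N| + `|z 0%N|) * r ^+ k].
Proof.
move=> t1 r1; pose r0 := Num.max `|theta| `|rho|; pose r := (1 + r0) / 2.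
have r00 : 0 <= r0 by rewrite le_max normr_ge0.
have r01 : r0 < 1 by rewrite gt_max t1.
have rr0 : 0 < r - r0 by rewrite /r; lra.
have rp : 0 < r by rewrite /r; lra.
pose B := (r - r0)^-1.
have B1 : 1 <= B by rewrite -invr1 lef_pV2 ?posrE//; rewrite /r; lra.
exists r, B; split => //; [by rewrite /r; lra|by lra|].
move=> y z hy hz.
have hzk k : `|z k| <= `|z 0%N| * r0 ^+ k.
  elim: k => [|k ih]; first by rewrite expr0 mulr1.
  rewrite hz normrM exprS mulrCA; apply: ler_pM => //.
  by rewrite le_max lexx orbT.
have rk k : r0 ^+ k <= r ^+ k by apply: lerXn2r; rewrite ?nnegrE//; lra.
have h k : `|y k| <= (`|y 0%N| + B * `|z 0%N|) * r ^+ k.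
  elim: k => [|k ih].
    by rewrite expr0 mulr1 lerDl mulr_ge0//; lra.
  rewrite hy (le_trans (ler_normD _ _))// normrM.
  have h1 : `|theta| * `|y k| <= r0 * ((`|y 0%N| + B * `|z 0%N|) * r ^+ k).
    by apply: ler_pM => //; rewrite le_max lexx.
  have h2 : `|z k.+1| <= `|z 0%N| * r ^+ k.
    apply: le_trans (hzk _) _; rewrite exprS ler_wpM2l//.
    by apply: le_trans (rk k); rewrite ler_piMl ?exprn_ge0// ltW.
  apply: le_trans (lerD h1 h2) _.
  have -> : (`|y 0%N| + B * `|z 0%N|) * r ^+ k.+1 =
      r0 * ((`|y 0%N| + B * `|z 0%N|) * r ^+ k) +
      (r - r0) * `|y 0%N| * r ^+ k + `|z 0%N| * r ^+ k.
    by rewrite exprS /B; field; rewrite lt0r_neq0.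
  rewrite addrAC lerDl.
  by rewrite mulr_ge0 ?mulr_ge0 ?exprn_ge0// ltW.
move=> k; apply: le_trans (h k) _.
apply: ler_wpM2r; first by rewrite exprn_ge0// ltW.
by rewrite mulrDr lerD2r ler_peMl.
Qed.

Lemma sum_geometric_le r n : 0 <= r -> r < 1 -> \sum_(k < n) (1 - r) * r ^+ k <= 1.
Proof.
move=> r0 r1.
have -> : \sum_(k < n) (1 - r) * r ^+ k = 1 - r ^+ n.
  elim: n => [|n ih]; first by rewrite big_ord0 expr0 subrr.
  by rewrite big_ord_recr/= ih exprS; ring.
by rewrite gerBl exprn_ge0.
Qed.

(** The bound involves squares, the only quantities with exponential moments, and weights of sum at
    most one, so that convexity of [expR] applies to it. *)
Lemma geometric_noise_bound r (A c0 : R) (c u : nat -> R) n : 0 < r -> r < 1 ->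
  0 <= A -> (forall k, `|c k| <= A * c0 * r ^+ k) ->
  `|\sum_(k < n) c k * u k| <= A / (2 * (1 - r)) *
    (c0 ^+ 2 + \sum_(k < n) (1 - r) * r ^+ k * u k ^+ 2).
Proof.
move=> r0 r1 A0 hc.
have s0 : 0 < 1 - r by lra.
apply: le_trans (ler_norm_sum _ _ _) _.
apply: (@le_trans _ _ (\sum_(k < n) (A / (2 * (1 - r)) * c0 ^+ 2 * ((1 - r) * r ^+ k) +
    A / (2 * (1 - r)) * ((1 - r) * r ^+ k * u k ^+ 2)))).
  apply: ler_sum => k _; rewrite normrM.
  apply: (@le_trans _ _ (A * r ^+ k * (`|c0| * `|u k|))).
    have -> : A * r ^+ k * (`|c0| * `|u k|) = A * `|c0| * r ^+ k * `|u k| by ring.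
    apply: ler_wpM2r => //; apply: le_trans (hc k) _.
    apply: ler_wpM2r; first by rewrite exprn_ge0// ltW.
    by rewrite ler_wpM2l// ler_norm.
  have -> : A / (2 * (1 - r)) * c0 ^+ 2 * ((1 - r) * r ^+ k) +
      A / (2 * (1 - r)) * ((1 - r) * r ^+ k * u k ^+ 2) =
      A * r ^+ k * ((c0 ^+ 2 + u k ^+ 2) / 2).
    by field; rewrite lt0r_neq0.
  apply: ler_wpM2l; first by rewrite mulr_ge0// exprn_ge0// ltW.
  rewrite ler_pdivlMr// -(real_normK (num_real c0)) -(real_normK (num_real (u k))).
  by have := sqr_ge0 (`|c0| - `|u k|); rewrite sqrrB mulr2n; lra.
have K0 : 0 <= A / (2 * (1 - r)) by rewrite divr_ge0// mulr_ge0// ltW.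
set K := A / (2 * (1 - r)) in K0 *.
rewrite big_split/= -[X in X + _ <= _]mulr_sumr -[X in _ + X <= _]mulr_sumr mulrDr lerD2r.
rewrite -[leRHS]mulr1; apply: ler_wpM2l; last by apply: sum_geometric_le; rewrite ?ltW.
by rewrite mulr_ge0 ?sqr_ge0.
Qed.

(* The tangent line to [expR] at the barycentre. *)
Lemma expR_convex_sum (w a : nat -> R) n : (forall k, 0 <= w k) ->
  \sum_(k < n) w k <= 1 ->
  expR (\sum_(k < n) w k * a k) <= 1 + \sum_(k < n) w k * expR (a k).
Proof.
move=> w0 w1; set A := \sum_(k < n) w k * a k; set W := \sum_(k < n) w k in w1.
have tangent x : expR A * (1 + x - A) <= expR x.
  have -> : expR x = expR A * expR (x - A) by rewrite -expRD addrC subrK.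
  by rewrite ler_wpM2l ?expR_ge0// -addrA expR_ge1Dx.
apply: (@le_trans _ _ ((1 - W) * expR 0 + \sum_(k < n) w k * expR (a k))); last first.
  by rewrite expR0 mulr1 lerD2r gerBl sumr_ge0.
apply: (@le_trans _ _ ((1 - W) * (expR A * (1 + 0 - A)) +
    \sum_(k < n) w k * (expR A * (1 + a k - A)))); last first.
  apply: lerD; first by rewrite ler_wpM2l// subr_ge0.
  by apply: ler_sum => k _; rewrite ler_wpM2l.
have -> : \sum_(k < n) w k * (expR A * (1 + a k - A)) = expR A * (W * (1 - A) + A).
  rewrite /W {3}/A mulr_suml -big_split/= mulr_sumr.
  by apply: eq_bigr => k _; ring.
by rewrite le_eqVlt; apply/orP; left; apply/eqP; ring.
Qed.

End autoregressive_bounds.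

(** * Uniform exponential moments *)

Section exponential_moments.
Context {d : measure_display} {T : measurableType d} {R : realType}.
Variable P : probability T R.
Implicit Types U W : nat -> T -> R.

Definition exp_bounded U := [/\ forall n, measurable_fun setT (U n),
  forall n w, 0 <= U n w &
  exists s C, 0 < s /\ forall n, mean_le P (fun w => expR (s * U n w)) C].

Lemma mean_le_sum (I : Type) (r : seq I) (f : I -> T -> R) (c : I -> R) :
  (forall i, mean_le P (f i) (c i)) ->
  mean_le P (fun w => \sum_(i <- r) f i w) (\sum_(i <- r) c i).
Proof.
move=> h; elim: r => [|i r ih].
  rewrite big_nil; have := mean_le_cst P (lexx (0 : R)).
  by congr mean_le; apply/funext => w; rewrite big_nil.
rewrite big_cons; have := mean_leD (h i) ih.
by congr mean_le; apply/funext => w; rewrite big_cons.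
Qed.

Lemma mean_le_ge0 (f : T -> R) (c : R) : mean_le P f c -> 0 <= c.
Proof.
move=> [mf f0 h]; rewrite -lee_fin; apply: le_trans h.
by apply: integral_ge0 => w _; rewrite lee_fin.
Qed.

Lemma exp_bounded_le U W K : 0 < K -> (forall n, measurable_fun setT (U n)) ->
  (forall n w, 0 <= U n w <= K * W n w) -> exp_bounded W -> exp_bounded U.
Proof.
move=> K0 mU UW [mW W0 [s [C [s0 h]]]]; split => //.
  by move=> n w; have /andP[] := UW n w.
exists (s / K), C; split; first exact: divr_gt0.
move=> n; apply: mean_le_dom (h n).
  by apply: measurableT_comp => //; exact: measurable_funM.
move=> w; rewrite expR_ge0/= ler_expR mulrAC ler_pdivrMr// -mulrA ler_pM2l//.
by rewrite mulrC; have /andP[] := UW n w.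
Qed.

(** Without independence: the exponential of the mean of two numbers is at most the sum of their
    exponentials, at the cost of halving the exponent. *)
Lemma exp_boundedD U W : exp_bounded U -> exp_bounded W ->
  exp_bounded (fun n w => U n w + W n w).
Proof.
move=> [mU U0 [s [C [s0 h]]]] [mW W0 [s' [C' [s'0 h']]]]; split.
- by move=> n; exact: measurable_funD.
- by move=> n w; rewrite addr_ge0.
pose m := Num.min s s'; have m0 : 0 < m by rewrite lt_min s0.
have ms : m <= s by rewrite ge_min lexx.
have ms' : m <= s' by rewrite ge_min lexx orbT.
exists (m / 2), (C + C'); split; first exact: divr_gt0.
move=> n; apply: mean_le_dom (mean_leD (h n) (h' n)).
  by apply: measurableT_comp => //; apply: measurable_funM => //; exact: measurable_funD.
move=> w; rewrite expR_ge0/=.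
have h1 : m * U n w <= s * U n w by rewrite ler_wpM2r.
have h2 : m * W n w <= s' * W n w by rewrite ler_wpM2r.
have e1 := expR_ge0 (s * U n w); have e2 := expR_ge0 (s' * W n w).
have [UW|/ltW UW] := leP (m * U n w) (m * W n w).
  apply: (@le_trans _ _ (expR (s' * W n w))); last by rewrite lerDr.
  by rewrite ler_expR; lra.
apply: (@le_trans _ _ (expR (s * U n w))); last by rewrite lerDl.
by rewrite ler_expR; lra.
Qed.

Lemma exp_bounded_shift U : exp_bounded U -> exp_bounded (fun n => U n.-1).
Proof.
by move=> [mU U0 [s [C [s0 h]]]]; split => //; exists s, C.
Qed.

Lemma exp_bounded_convex (w : nat -> R) U : (forall k, 0 <= w k) ->
  (forall n, \sum_(k < n) w k <= 1) -> exp_bounded U ->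
  exp_bounded (fun n x => \sum_(k < n) w k * U k x).
Proof.
move=> w0 w1 [mU U0 [s [C [s0 h]]]].
have mS n : measurable_fun setT (fun x => \sum_(k < n) w k * U k x).
  by apply: measurable_sum => k; exact: measurable_funM.
split => //.
  by move=> n x; apply: sumr_ge0 => k _; rewrite mulr_ge0.
exists s, (1 + C); split => // n.
have C0 := mean_le_ge0 (h 0%N).
apply: (@mean_leW _ _ _ _ _ (1 + \sum_(k < n) w k * C)).
  by rewrite lerD2l -mulr_suml ler_piMl.
apply: (@mean_le_dom _ _ _ _ (fun x => 1 + \sum_(k < n) w k * expR (s * U k x))).
- by apply: measurableT_comp => //; exact: measurable_funM.
- move=> x; rewrite expR_ge0/=.
  have -> : s * (\sum_(k < n) w k * U k x) = \sum_(k < n) w k * (s * U k x).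
    by rewrite mulr_sumr; apply: eq_bigr => k _; rewrite mulrCA.
  exact: (@expR_convex_sum _ _ (fun k => s * U k x)).
apply: mean_leD; first exact: mean_le_cst.
by apply: mean_le_sum => k; exact: mean_leZ.
Qed.

(** By convexity of [expR], one step turns a bound [B] on the exponential moment into
    [r * B + (1 - r) * C'], and [B = C + C'] is preserved. *)
Lemma exp_bounded_rec (r : R) U W : 0 <= r -> r < 1 ->
  (forall n, measurable_fun setT (U n)) -> (forall n w, 0 <= U n w) ->
  (forall n w, U n.+1 w <= r * U n w + (1 - r) * W n w) ->
  (exists s C, 0 < s /\ mean_le P (fun w => expR (s * U 0%N w)) C) ->
  exp_bounded W -> exp_bounded U.
Proof.
move=> r0 r1 mU U0 UW [s [C [s0 h]]] [mW W0 [s' [C' [s'0 h']]]]; split => //.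
pose m := Num.min s s'; have m0 : 0 < m by rewrite lt_min s0.
have ms : m <= s by rewrite ge_min lexx.
have ms' : m <= s' by rewrite ge_min lexx orbT.
have C0 := mean_le_ge0 h; have C'0 := mean_le_ge0 (h' 0%N).
have mexp n : measurable_fun setT (fun w => expR (m * U n w)).
  by apply: measurableT_comp => //; exact: measurable_funM.
exists m, (C + C'); split => //; elim=> [|n ih].
  apply: (@mean_leW _ _ _ _ _ C); first by rewrite lerDl.
  by apply: mean_le_dom h => // w; rewrite expR_ge0/= ler_expR ler_wpM2r.
have := mean_leD (mean_leZ r0 ih) (mean_leZ (k := 1 - r) _ (h' n)).
move=> /(_ _)/wrap[]; first by rewrite subr_ge0 ltW.
move=> hn; apply: (@mean_leW _ _ _ _ _ (r * (C + C') + (1 - r) * C')).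
  rewrite -subr_ge0.
  have -> : C + C' - (r * (C + C') + (1 - r) * C') = (1 - r) * C by ring.
  by rewrite mulr_ge0// subr_ge0 ltW.
apply: mean_le_dom hn => // w; rewrite expR_ge0/=.
apply: (@le_trans _ _ (expR (r * (m * U n w) + (1 - r) * (s' * W n w)))).
  rewrite ler_expR (le_trans (ler_wpM2l (ltW m0) (UW n w)))//.
  rewrite mulrDr mulrCA lerD2l mulrCA ler_wpM2l ?subr_ge0 ?(ltW r1)//.
  by rewrite ler_wpM2r.
set a := m * U n w; set c := s' * W n w; pose A := r * a + (1 - r) * c.
rewrite -/A.
have tangent x : expR A * (1 + x - A) <= expR x.
  have -> : expR x = expR A * expR (x - A) by rewrite -expRD addrC subrK.
  by rewrite ler_wpM2l ?expR_ge0// -addrA expR_ge1Dx.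
have -> : expR A = r * (expR A * (1 + a - A)) + (1 - r) * (expR A * (1 + c - A)).
  set y := expR A; rewrite /A; ring.
by apply: lerD; apply: ler_wpM2l; rewrite ?subr_ge0 ?(ltW r1).
Qed.

End exponential_moments.

(** * The scale of moderate deviations *)

Section moderate_scale.
Context {d : measure_display} {T : measurableType d} {R : realType}.
Variables (P : probability T R) (b : nat -> R).
Hypothesis b_gt0 : forall n, (1 <= n)%N -> 0 < b n.
Hypothesis b_oo : b n @[n --> \oo] --> +oo.
Hypothesis b_small : b n / Num.sqrt n%:R @[n --> \oo] --> 0.

Let speed n := b n ^+ 2.
Let eta n : R := b n / Num.sqrt n%:R.

Lemma speed_oo : speed n @[n --> \oo] --> +oo.
Proof.
apply/cvgryPge => A; move/cvgryPge : b_oo => /(_ (`|A| + 1)).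
apply: filterS => n bn; rewrite /speed.
have : 0 <= `|A| by []. have := ler_norm A.
by nra.
Qed.

Let FF L : Filter (superexp P speed L) := superexp_filter P speed_oo L.
Local Existing Instance FF.

Lemma near_eta_gt0 : \forall n \near \oo, 0 < n%:R * eta n.
Proof.
near=> n; have n0 : (0 < n)%N by near: n; exact: nbhs_infty_gt.
by rewrite mulr_gt0 ?ltr0n// divr_gt0 ?b_gt0// sqrtr_gt0 ltr0n.
Unshelve. all: by end_near. Qed.

Lemma near_eta_lt (e : R) : 0 < e -> \forall n \near \oo, `|eta n| < e.
Proof.
move=> e0; move/cvgrPdist_lt : b_small => /(_ _ e0).
by apply: filterS => n; rewrite sub0r normrN.
Qed.

Lemma speedE n : (0 < n)%N -> speed n = n%:R * eta n * eta n.
Proof.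
move=> n0; have h := sqr_sqrtr (ler0n R n); rewrite /speed /eta -{1}h; field.
by rewrite lt0r_neq0// sqrtr_gt0 ltr0n.
Qed.

(** Markov's inequality at height [K * e] gives a rate of order [K * e]; as [K] is arbitrary, of
    either sign, every rate [L] is reached for every [e]. *)
Lemma superexp_cvg0 L (U : nat -> T -> R) :
  (forall K, \forall n \near \oo,
    mean_le P (fun w => expR (speed n * (K * U n w))) (expR (1 * speed n))) ->
  U z.1 z.2 @[z --> superexp P speed L] --> 0.
Proof.
move=> h; apply/cvgrPdist_lt => e e0.
pose K := (`|L| + 2) / e.
have K0 : 0 < K by rewrite divr_gt0// ltr_wpDl.
have hL : L + 1 < `|L| + 2 by have := ler_norm L; lra.
have h1 := superexp_lt speed_oo hL (h K).
have h2 := superexp_lt speed_oo hL (h (- K)).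
apply: filterS2 h1 h2 => z /=; rewrite sub0r normrN ltr_norml.
have -> : `|L| + 2 = K * e by rewrite /K divfK// lt0r_neq0.
rewrite mulNr ltrNl -mulrN !ltr_pM2l// => -> ->//.
Qed.

(** Since [speed n / (n * eta n) = eta n], the exponent is [eta n * K * U], eventually below [s * U]
    for any fixed [K]. *)
Lemma superexp_exp_bounded L U : exp_bounded P U ->
  U z.1 z.2 / (z.1%:R * eta z.1) @[z --> superexp P speed L] --> 0.
Proof.
move=> [mU U0 [s [C [s0 h]]]].
apply: (@superexp_cvg0 L (fun n w => U n w / (n%:R * eta n))) => K.
have es : 0 < s / (`|K| + 1) by rewrite divr_gt0// ltr_wpDl.
have hC := near_speed_ge speed_oo C.
near=> n.
have n0 : (0 < n)%N by near: n; exact: nbhs_infty_gt.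
have ne0 : 0 < n%:R * eta n by near: n; exact: near_eta_gt0.
have e0 : 0 < eta n by move: ne0; rewrite pmulr_rgt0// ltr0n.
have hn : eta n < s / (`|K| + 1).
  apply: le_lt_trans (ler_norm _) _; near: n; exact: near_eta_lt.
apply: (@mean_leW _ _ _ _ _ C).
  rewrite mul1r; apply: le_trans (expR_ge1Dx _).
  by apply: ler_wpDl => //; near: n.
apply: mean_le_dom (h n).
  by apply: measurableT_comp => //; do 3 apply: measurable_funM => //.
move=> w; rewrite expR_ge0/= ler_expR speedE//.
have -> : n%:R * eta n * eta n * (K * (U n w / (n%:R * eta n))) = (eta n * K) * U n w.
  by field; rewrite !lt0r_neq0// ltr0n.
apply: ler_wpM2r => //.
move: hn; rewrite ltr_pdivlMr ?ltr_wpDl// => /ltW; apply: le_trans.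
by rewrite ler_pM2l// (le_trans (ler_norm K))// lerDl.
Unshelve. all: by end_near. Qed.

End moderate_scale.

(** * The process started at zero and its exponential martingale *)

Section gaussian_autoregression.
Context {d : measure_display} {T : measurableType d} {R : realType}.
Variable P : probability T R.
Variables (theta rho sigma : R) (V : nat -> {RV P >-> R}).
Hypothesis htheta : `|theta| < 1.
Hypothesis hrho : `|rho| < 1.
Hypothesis sigma0 : 0 < sigma.
Hypothesis hindep : mutually_independent P (fun n w => V n.+1 w).
Hypothesis hnormal : forall k (A : set R), measurable A ->
  distribution P (V k.+1) A = normal_prob 0 sigma A.

Let phi := theta + rho.
Let psi := theta * rho.

Definition ar_step (z : (R * R) * R) : R * R :=
  (phi * z.1.1 - psi * z.1.2 + z.2, z.1.1).

Definition ar_state : nat -> T -> R * R :=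
  state (fun n => V n.+1) ar_step ((0 : R), (0 : R)).

(** The state carries the current and the previous value, both zero initially, so that the recursion
    of order two becomes Markovian. *)
Definition ar0 (n : nat) (w : T) : R := (ar_state n w).1.

Definition ar0_noise (n : nat) (w : T) : R := ar0 n w - theta * ar0 n.-1 w.

Lemma ar_stateE n w : ar_state n w = (ar0 n w, ar0 n.-1 w).
Proof. by case: n. Qed.

Lemma ar00 w : ar0 0 w = 0. Proof. by []. Qed.

Lemma ar0E n w : ar0 n.+1 w = theta * ar0 n w + ar0_noise n.+1 w.
Proof. by rewrite /ar0_noise/=; ring. Qed.

Lemma ar0_noiseE n w : ar0_noise n.+1 w = rho * ar0_noise n w + V n.+1 w.
Proof.
rewrite /ar0_noise/= {1}/ar0 /ar_state/= -/ar_state ar_stateE/= /phi /psi.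
by ring.
Qed.

Lemma measurable_ar_step : measurable_fun setT ar_step.
Proof.
have m1 : measurable_fun setT (fun z : (R * R) * R => z.1.1) by exact: measurableT_comp.
have m2 : measurable_fun setT (fun z : (R * R) * R => z.1.2) by exact: measurableT_comp.
apply: measurable_fun_pair => //.
apply: measurable_funD => //.
by apply: measurable_funB; exact: measurable_funM.
Qed.

Lemma measurable_ar0 n : measurable_fun setT (ar0 n).
Proof.
apply: measurableT_comp => //; apply: measurable_state; exact: measurable_ar_step.
Qed.

Definition ar0_mart al be n w :=
  \sum_(k < n) (al * ar0 k w + be * ar0 k.-1 w) * V k.+1 w.

Definition ar0_bracket al be n w :=
  \sum_(k < n) (al * ar0 k w + be * ar0 k.-1 w) ^+ 2.

Definition noise_sq n w : R := \sum_(k < n) V k.+1 w ^+ 2.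

Lemma measurable_ar0_lin al be k :
  measurable_fun setT (fun w => al * ar0 k w + be * ar0 k.-1 w).
Proof.
by apply: measurable_funD; apply: measurable_funM => //; exact: measurable_ar0.
Qed.

Lemma measurable_ar0_mart al be n : measurable_fun setT (ar0_mart al be n).
Proof.
by apply: measurable_sum => k; apply: measurable_funM => //; exact: measurable_ar0_lin.
Qed.

Lemma measurable_ar0_bracket al be n : measurable_fun setT (ar0_bracket al be n).
Proof.
by apply: measurable_sum => k; apply: measurable_funX; exact: measurable_ar0_lin.
Qed.

Lemma measurable_noise_sq n : measurable_fun setT (noise_sq n).
Proof. by apply: measurable_sum => k; exact: measurable_funX. Qed.

(* [normal_prob] is a measure on [measurableTypeR R], whose measurable structure
   is not convertible to the canonical one of [R]. *)
Lemma integral_noise k (f : R -> \bar R) :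
  measurable_fun setT f -> (forall v, (0 <= f v)%E) ->
  (\int[distribution P (V k.+1)]_v f v = \int[normal_prob 0 sigma]_v f v)%E.
Proof.
move=> mf f0.
have mid : measurable_fun setT (id : measurableTypeR R -> R).
  by move=> _ A mA; rewrite setTI preimage_id.
rewrite (eq_measure_integral (pushforward (normal_prob 0 sigma) (id : measurableTypeR R -> R))).
  by rewrite ge0_integral_pushforward.
by move=> A mA _; exact: hnormal.
Qed.

Let measurable_noise_fun (g : (R * R) * R -> R) (s : R * R) : measurable_fun setT g ->
  measurable_fun setT (fun v => (expR (g (s, v)))%:E).
Proof.
move=> mg; have ms : measurable_fun setT (fun v : R => (s, v)).
  exact: measurable_fun_pair.
apply/measurable_EFinP; apply: measurableT_comp => //.
exact: (measurableT_comp mg ms).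
Qed.

(** Given the state, one step is [normal_exp_martingale] with [c = t * (al * x + be * x')]. As that
    identity holds for every real [c], neither truncation nor a restriction on [t] is required. *)
Lemma integral_exp_ar0_mart t al be n :
  (\int[P]_w (expR (t * ar0_mart al be n w -
    t ^+ 2 * sigma ^+ 2 / 2 * ar0_bracket al be n w))%:E = 1)%E.
Proof.
pose g (z : (R * R) * R) := t * (al * z.1.1 + be * z.1.2) * z.2 -
  (t * (al * z.1.1 + be * z.1.2)) ^+ 2 * sigma ^+ 2 / 2.
have mg : measurable_fun setT g.
  have m1 : measurable_fun setT (fun z : (R * R) * R => z.1.1) by exact: measurableT_comp.
  have m2 : measurable_fun setT (fun z : (R * R) * R => z.1.2) by exact: measurableT_comp.
  have m3 : measurable_fun setT (fun z : (R * R) * R => t * (al * z.1.1 + be * z.1.2)).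
    by apply: measurable_funM => //; apply: measurable_funD; exact: measurable_funM.
  apply: measurable_funB; first exact: measurable_funM.
  by do 2 apply: measurable_funM => //; exact: measurable_funX.
have := @integral_exp_sum_state _ _ T _ R P (fun n => V n.+1) hindep ar_step (0, 0)
  measurable_ar_step g 1 n ler01 mg.
move=> /(_ _)/wrap[].
  move=> k s; apply: etrans (integral_noise k _ _) _.
  - exact: measurable_noise_fun.
  - by move=> v; rewrite lee_fin expR_ge0.
  have := normal_exp_martingale sigma0 (t * (al * s.1 + be * s.2)).
  by apply: etrans; apply: eq_integral => v _.
rewrite expr1n => <-; apply: eq_integral => w _; congr (expR _)%:E.
rewrite /ar0_mart /ar0_bracket !mulr_sumr -sumrB; apply: eq_bigr => k _.
by rewrite -/ar_state ar_stateE /g/=; ring.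
Qed.

Lemma integral_exp_noise_sq u n : 2 * u * sigma ^+ 2 < 1 ->
  (\int[P]_w (expR (u * noise_sq n w))%:E =
   ((Num.sqrt (1 - 2 * u * sigma ^+ 2))^-1 ^+ n)%:E)%E.
Proof.
move=> hu.
pose g (z : (R * R) * R) := u * z.2 ^+ 2.
have mg : measurable_fun setT g.
  by apply: measurable_funM => //; exact: measurable_funX.
have c0 : 0 <= (Num.sqrt (1 - 2 * u * sigma ^+ 2))^-1 by rewrite invr_ge0 sqrtr_ge0.
have := @integral_exp_sum_state _ _ T _ R P (fun n => V n.+1) hindep ar_step (0, 0)
  measurable_ar_step g _ n c0 mg.
move=> /(_ _)/wrap[].
  move=> k s; apply: etrans (integral_noise k _ _) _.
  - exact: measurable_noise_fun.
  - by move=> v; rewrite lee_fin expR_ge0.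
  have := normal_exp_sqr sigma0 hu.
  by apply: etrans; apply: eq_integral => v _.
move=> <-; apply: eq_integral => w _; congr (expR _)%:E.
by rewrite /noise_sq mulr_sumr.
Qed.

Lemma mean_exp_noise_sq u n : `|u * sigma ^+ 2| <= 8^-1 ->
  mean_le P (fun w => expR (u * noise_sq n w))
    (expR (n%:R * (u * sigma ^+ 2 + 4 * (u * sigma ^+ 2) ^+ 2))).
Proof.
move=> hu; split.
- apply: measurableT_comp => //; apply: measurable_funM => //.
  exact: measurable_noise_sq.
- by move=> w; exact: expR_ge0.
rewrite integral_exp_noise_sq; last first.
  by move: hu; rewrite ler_norml -mulrA => /andP[]; lra.
rewrite lee_fin expRM_natl; apply: lerXn2r.
- by rewrite nnegrE invr_ge0 sqrtr_ge0.
- by rewrite nnegrE expR_ge0.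
- by rewrite -mulrA; exact: invr_sqrt_le_expR.
Qed.

(** [ar1_sum_sqr_le] is applied twice, with root [theta] and then with root [rho]; the zero start
    leaves no additive constant. *)
Lemma ar0_sum_sq_le : exists2 C, 0 <= C & forall n w,
  \sum_(k < n) ar0 k w ^+ 2 <= C * noise_sq n w.
Proof.
have rh0 : 0 < 1 - `|rho| by rewrite subr_gt0.
have th0 : 0 < 1 - `|theta| by rewrite subr_gt0.
exists ((1 - `|theta|) ^- 2 * (1 - `|rho|) ^- 2).
  by rewrite mulr_ge0// invr_ge0 exprn_ge0// ltW.
move=> n w.
have e00 : ar0_noise 0 w = 0 by rewrite /ar0_noise/= ar00 mulr0 subrr.
have h1 := @ar1_sum_sqr_le R theta (ar0^~ w) (ar0_noise^~ w) n htheta (ar00 w) (fun k => ar0E k w).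
have h2 := @ar1_sum_sqr_le R rho (ar0_noise^~ w) (fun k => V k w) n hrho e00 (fun k => ar0_noiseE k w).
have i0 : 0 <= (1 - `|theta|) ^- 2 by rewrite invr_ge0 exprn_ge0// ltW.
have {h1} h1 : \sum_(k < n) ar0 k w ^+ 2 <= (1 - `|theta|) ^- 2 *
    (\sum_(k < n.+1) ar0_noise k w ^+ 2).
  apply: (@le_trans _ _ (\sum_(k < n.+1) ar0 k w ^+ 2)).
    by rewrite [leRHS]big_ord_recr/= lerDl sqr_ge0.
  apply: (le_trans h1).
  apply: ler_wpM2l => //; rewrite [leRHS]big_ord_recl/=.
  by rewrite lerDr sqr_ge0.
by apply: le_trans h1 _; rewrite -mulrA; exact: ler_wpM2l.
Qed.

Lemma ar0_bracket_le al be : exists2 C, 0 <= C & forall n w,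
  ar0_bracket al be n w <= C * noise_sq n w.
Proof.
have [C C0 hC] := ar0_sum_sq_le.
exists (2 * (al ^+ 2 + be ^+ 2) * C).
  by rewrite mulr_ge0// mulr_ge0// addr_ge0 ?sqr_ge0.
move=> n w; apply: (@le_trans _ _ (\sum_(k < n) (2 * al ^+ 2 * ar0 k w ^+ 2 +
    2 * be ^+ 2 * ar0 k.-1 w ^+ 2))).
  apply: ler_sum => k _; rewrite -subr_ge0.
  have -> : 2 * al ^+ 2 * ar0 k w ^+ 2 + 2 * be ^+ 2 * ar0 k.-1 w ^+ 2 -
    (al * ar0 k w + be * ar0 k.-1 w) ^+ 2 = (al * ar0 k w - be * ar0 k.-1 w) ^+ 2.
    by ring.
  exact: sqr_ge0.
have hp : \sum_(k < n) ar0 k.-1 w ^+ 2 <= \sum_(k < n) ar0 k w ^+ 2.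
  case: n => [|n]; first by rewrite !big_ord0.
  rewrite big_ord_recl [leRHS]big_ord_recr/= ar00 expr0n/= add0r.
  by rewrite lerDl sqr_ge0.
rewrite big_split/= -!mulr_sumr.
have -> : 2 * (al ^+ 2 + be ^+ 2) * C * noise_sq n w =
  2 * al ^+ 2 * (C * noise_sq n w) + 2 * be ^+ 2 * (C * noise_sq n w) by ring.
have a0 : 0 <= 2 * al ^+ 2 by rewrite mulr_ge0// sqr_ge0.
have b0 : 0 <= 2 * be ^+ 2 by rewrite mulr_ge0// sqr_ge0.
apply: lerD; apply: ler_wpM2l => //; first exact: hC.
exact: le_trans hp (hC _ _).
Qed.

(** In the manner of Cauchy-Schwarz, [expR (t * M)] is at most half the sum of the exponential
    martingale at [2 * t] and of [expR (2 * t^2 * sigma^2 * bracket)]. The bracket is dominated by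
    the squared noise, whose exponential moments are finite only for small arguments, hence the
    restriction on [t]. *)
Lemma mean_exp_ar0_mart al be : exists C e, [/\ 0 <= C, 0 < e &
  forall t n, `|t| <= e ->
    mean_le P (fun w => expR (t * ar0_mart al be n w)) (expR (C * t ^+ 2 * n%:R))].
Proof.
have [C C0 hC] := ar0_bracket_le al be.
(* Chosen so that the argument of [mean_exp_noise_sq] is [t ^+ 2 * B], which the bound on [t] keeps
   below [8^-1]. *)
pose B := 2 * sigma ^+ 2 * C * sigma ^+ 2.
have s20 : 0 <= sigma ^+ 2 by exact: sqr_ge0.
have B0 : 0 <= B by do 3 (apply: mulr_ge0 => //).
exists (2 * B), (Num.min 1 (8 * (B + 1))^-1); split.
- by rewrite mulr_ge0.
- by rewrite lt_min ltr01 invr_gt0 mulr_gt0// ltr_wpDl.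
move=> t n; rewrite le_min => /andP[t1 tB].
pose u := 2 * t ^+ 2 * sigma ^+ 2 * C.
have uE : u * sigma ^+ 2 = t ^+ 2 * B by rewrite /u /B; ring.
have t2 : t ^+ 2 * B <= 8^-1.
  rewrite -(real_normK (num_real t)) expr2.
  have h : `|t| * (8 * (B + 1)) <= 1 by rewrite -ler_pdivlMr ?div1r// mulr_gt0// ltr_wpDl.
  have n0 : 0 <= `|t| by [].
  have : `|t| * `|t| * B <= `|t| * B by rewrite ler_wpM2r// ler_piMl.
  by lra.
have t20 : 0 <= t ^+ 2 * B by rewrite mulr_ge0// sqr_ge0.
have hu : `|u * sigma ^+ 2| <= 8^-1 by rewrite uE ger0_norm.
pose f1 w := expR ((2 * t) * ar0_mart al be n w -
    (2 * t) ^+ 2 * sigma ^+ 2 / 2 * ar0_bracket al be n w).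
have h1 : mean_le P f1 1.
  split; [|by move=> w; exact: expR_ge0|by rewrite integral_exp_ar0_mart].
  apply: measurableT_comp => //; apply: measurable_funB; apply: measurable_funM => //.
    exact: measurable_ar0_mart.
  exact: measurable_ar0_bracket.
have i2 : 0 <= 2^-1 :> R by rewrite invr_ge0.
have h2 := mean_leD (mean_leZ i2 h1) (mean_leZ i2 (mean_exp_noise_sq n hu)).
apply: (@mean_leW _ _ _ _ _ (2^-1 * 1 + 2^-1 * expR (n%:R * (u * sigma ^+ 2 + 4 * (u * sigma ^+ 2) ^+ 2)))).
  have E : expR (n%:R * (u * sigma ^+ 2 + 4 * (u * sigma ^+ 2) ^+ 2)) <=
      expR (2 * B * t ^+ 2 * n%:R).
    rewrite ler_expR mulrC ler_wpM2r// uE.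
    have : (t ^+ 2 * B) ^+ 2 <= (t ^+ 2 * B) * 8^-1 by rewrite expr2 ler_wpM2l.
    by lra.
  have : 1 <= expR (2 * B * t ^+ 2 * n%:R).
    have Bt : 0 <= 2 * B * t ^+ 2 by rewrite -mulrA [B * _]mulrC mulr_ge0.
    by rewrite -[leLHS]expR0 ler_expR mulr_ge0.
  by lra.
apply: mean_le_dom h2.
  by apply: measurableT_comp => //; apply: measurable_funM => //; exact: measurable_ar0_mart.
move=> w; rewrite expR_ge0/=.
have {}hC : 2 * t ^+ 2 * sigma ^+ 2 * ar0_bracket al be n w <= u * noise_sq n w.
  have p0 : 0 <= 2 * t ^+ 2 * sigma ^+ 2.
    by do 2 (apply: mulr_ge0 => //); exact: sqr_ge0.
  by apply: le_trans (ler_wpM2l p0 (hC n w)) _; rewrite /u mulrA.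
apply: (@le_trans _ _ (2^-1 * f1 w + 2^-1 * expR (2 * t ^+ 2 * sigma ^+ 2 * ar0_bracket al be n w))); last first.
  by rewrite lerD2l ler_wpM2l// ler_expR.
set x := ar0_mart _ _ _ _; set y := _ * ar0_bracket al be n w.
have -> : t * x = (2 * t * x - y) / 2 + y / 2 by field.
have -> : f1 w = expR ((2 * t * x - y) / 2) ^+ 2.
  by rewrite -expRM_natr /f1 -/x /y; congr expR; field.
have -> : expR y = expR (y / 2) ^+ 2 by rewrite -expRM_natr; congr expR; field.
rewrite expRD; set p := expR _; set q := expR _.
by have := sqr_ge0 (p - q); rewrite sqrrB mulr2n; lra.
Qed.

End gaussian_autoregression.

Section exponential_moments_autoregression.
Context {d : measure_display} {T : measurableType d} {R : realType}.
Variable P : probability T R.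

Lemma exp_bounded_at (U : nat -> T -> R) k : exp_bounded P U -> exp_bounded P (fun=> U k).
Proof. by move=> [mU U0 [s [C [s0 h]]]]; split => //; exists s, C. Qed.

Lemma exp_bounded_succ (U : nat -> T -> R) : exp_bounded P U -> exp_bounded P (fun n => U n.+1).
Proof. by move=> [mU U0 [s [C [s0 h]]]]; split => //; exists s, C. Qed.

Lemma exp_bounded_ar1 (a : R) (y u : nat -> T -> R) : `|a| < 1 ->
  (forall n, measurable_fun setT (y n)) ->
  (forall n w, y n.+1 w = a * y n w + u n.+1 w) ->
  (exists s C, 0 < s /\ mean_le P (fun w => expR (s * y 0%N w ^+ 2)) C) ->
  exp_bounded P (fun n w => u n.+1 w ^+ 2) ->
  exp_bounded P (fun n w => y n w ^+ 2).
Proof.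
move=> a1 my hy h0 hu; have s0 : 0 < 1 - `|a| by rewrite subr_gt0.
apply: (@exp_bounded_rec _ _ _ P `|a| _ (fun n w => (1 - `|a|) ^- 2 * u n.+1 w ^+ 2)) => //.
- by move=> n; exact: measurable_funX.
- by move=> n w; exact: sqr_ge0.
- move=> n w; rewrite hy.
  have -> : (1 - `|a|) * ((1 - `|a|) ^- 2 * u n.+1 w ^+ 2) = u n.+1 w ^+ 2 / (1 - `|a|).
    by field; rewrite lt0r_neq0.
  exact: ar1_sqr_le.
have i0 : 0 < (1 - `|a|) ^- 2 by rewrite invr_gt0 exprn_gt0.
have [mu _ _] := hu; apply: (exp_bounded_le i0) hu.
- by move=> n; apply: measurable_funM.
- by move=> n w; rewrite lexx mulr_ge0 ?sqr_ge0// ltW.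
Qed.

End exponential_moments_autoregression.

(** * Negligible terms, squared noise and martingales at the moderate scale *)

Section moderate_autoregression.
Context {d : measure_display} {T : measurableType d} {R : realType}.
Variables (P : probability T R) (b : nat -> R).
Hypothesis b_gt0 : forall n, (1 <= n)%N -> 0 < b n.
Hypothesis b_oo : b n @[n --> \oo] --> +oo.
Hypothesis b_small : b n / Num.sqrt n%:R @[n --> \oo] --> 0.
Let speed n := b n ^+ 2.
Let eta n : R := b n / Num.sqrt n%:R.
Let speed_oo := speed_oo b_oo.
Let FF L : Filter (superexp P speed L) := superexp_filter P speed_oo L.
Local Existing Instance FF.

(** Small relative to [b n * sqrt n], the normalisation of the martingale. *)
Definition negligible (f : nat -> T -> R) L :=
  f z.1 z.2 / (z.1%:R * eta z.1) @[z --> superexp P speed L] --> 0.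

Lemma negligibleD L f g : negligible f L -> negligible g L ->
  negligible (fun n w => f n w + g n w) L.
Proof.
move=> hf hg; rewrite /negligible.
have -> : (fun z : nat * T => (f z.1 z.2 + g z.1 z.2) / (z.1%:R * eta z.1)) =
  (fun z => f z.1 z.2 / (z.1%:R * eta z.1) + g z.1 z.2 / (z.1%:R * eta z.1)).
  by apply/funext => z; rewrite mulrDl.
by rewrite -[X in _ --> X]addr0; exact: cvgD.
Qed.

Lemma negligibleZ L (k : R) f : negligible f L -> negligible (fun n w => k * f n w) L.
Proof.
move=> hf; rewrite /negligible.
have -> : (fun z : nat * T => k * f z.1 z.2 / (z.1%:R * eta z.1)) =
  (fun z => k * (f z.1 z.2 / (z.1%:R * eta z.1))).
  by apply/funext => z; rewrite mulrA.
by rewrite -[X in _ --> X](mulr0 k); apply: cvgM => //; exact: cvg_cst.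
Qed.

Lemma negligible_cvgM L (g : nat * T -> R) (l : R) f :
  g z @[z --> superexp P speed L] --> l -> negligible f L ->
  negligible (fun n w => g (n, w) * f n w) L.
Proof.
move=> hg hf; rewrite /negligible.
have -> : (fun z : nat * T => g (z.1, z.2) * f z.1 z.2 / (z.1%:R * eta z.1)) =
  (fun z => g z * (f z.1 z.2 / (z.1%:R * eta z.1))).
  by apply/funext => -[n w]/=; rewrite mulrA.
by rewrite -[X in _ --> X](mulr0 l); apply: cvgM.
Qed.

Lemma negligible_bounded L (K : R) f U : exp_bounded P U ->
  (forall n w, `|f n w| <= K * U n w) -> negligible f L.
Proof.
move=> eU fU; have hU := superexp_exp_bounded b_gt0 b_oo b_small L eU.
have hKU := negligibleZ K hU.
apply/cvgrPdist_lt => e e0.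
move/cvgrPdist_lt : hKU => /(_ _ e0).
have := superexp_near P speed L (near_eta_gt0 b_gt0).
apply: filterS2 => -[n w] /= nz; rewrite !sub0r !normrN; apply: le_lt_trans.
rewrite !normrM ler_wpM2r//; apply: le_trans (fU n w) _; rewrite -normrM.
exact: ler_norm.
Qed.

Lemma negligible_prod L f g : exp_bounded P (fun n w => f n w ^+ 2) ->
  exp_bounded P (fun n w => g n w ^+ 2) -> negligible (fun n w => f n w * g n w) L.
Proof.
move=> hf hg; have h := exp_boundedD hf hg; apply: (@negligible_bounded L 1 _ _ h) => n w.
rewrite mul1r normrM -(real_normK (num_real (f n w))) -(real_normK (num_real (g n w))).
have := sqr_ge0 (`|f n w| - `|g n w|); rewrite sqrrB mulr2n.
have := mulr_ge0 (normr_ge0 (f n w)) (normr_ge0 (g n w)); lra.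
Qed.

Variables (theta rho sigma : R) (V : nat -> {RV P >-> R}).
Hypothesis htheta : `|theta| < 1.
Hypothesis hrho : `|rho| < 1.
Hypothesis sigma0 : 0 < sigma.
Hypothesis hindep : mutually_independent P (fun n w => V n.+1 w).
Hypothesis hnormal : forall k (A : set R), measurable A ->
  distribution P (V k.+1) A = normal_prob 0 sigma A.

(** With [u = K * eta n ^+ 2], centring cancels the first-order term of the log-Laplace bound; what
    is left is [4 * n * (u * sigma^2)^2], which is [speed n] times a quantity of order
    [eta n ^+ 2]. *)
Lemma superexp_noise_sq L :
  noise_sq V z.1 z.2 / z.1%:R @[z --> superexp P speed L] --> sigma ^+ 2.
Proof.
suff h : noise_sq V z.1 z.2 / z.1%:R - sigma ^+ 2 @[z --> superexp P speed L] --> 0.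
  rewrite -[sigma ^+ 2]add0r.
  have -> : (fun z : nat * T => noise_sq V z.1 z.2 / z.1%:R) =
      (fun z => (noise_sq V z.1 z.2 / z.1%:R - sigma ^+ 2) + sigma ^+ 2).
    by apply/funext => z; rewrite subrK.
  by apply: cvgD => //; exact: cvg_cst.
apply: (@superexp_cvg0 _ _ _ P b b_oo L (fun n w => noise_sq V n w / n%:R - sigma ^+ 2)) => K.
pose q := `|K| * sigma ^+ 2.
have q0 : 0 <= q by rewrite mulr_ge0// sqr_ge0.
have i0 : 0 < (8 * (q + 1))^-1 by rewrite invr_gt0 mulr_gt0// ltr_wpDl.
near=> n.
have n0 : (0 < n)%N by near: n; exact: nbhs_infty_gt.
have nR : 0 < n%:R :> R by rewrite ltr0n.
have ne0 : 0 < n%:R * eta n by near: n; exact: near_eta_gt0.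
have e0 : 0 < eta n by move: ne0; rewrite pmulr_rgt0.
have hn : eta n < (8 * (q + 1))^-1.
  apply: le_lt_trans (ler_norm _) _; near: n; exact: near_eta_lt.
have e8 : eta n * (8 * (q + 1)) <= 1 by rewrite -ler_pdivlMr ?div1r ?ltW// mulr_gt0// ltr_wpDl.
have eq0 : 0 <= eta n * q by rewrite mulr_ge0// ltW.
have e1 : eta n <= 1 by lra.
have eq1 : eta n * q <= 8^-1 by lra.
have eeq : eta n * (eta n * q) <= eta n * q by rewrite ler_piMl.
pose u := K * eta n ^+ 2.
have uE : `|u * sigma ^+ 2| = eta n * (eta n * q).
  rewrite /u normrM (normrM K) (ger0_norm (sqr_ge0 sigma)) (ger0_norm (sqr_ge0 (eta n))) /q; ring.
have hu : `|u * sigma ^+ 2| <= 8^-1 by rewrite uE (le_trans eeq).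
have hS := speedE b n0; rewrite -/(eta n) in hS.
have := mean_leZ (expR_ge0 (- (u * sigma ^+ 2 * n%:R)))
  (mean_exp_noise_sq theta rho sigma0 hindep hnormal n hu).
rewrite -expRD => hm; apply: mean_leW (_ : mean_le _ _ (expR _)); last first.
  have -> : (fun w => expR (speed n * (K * (noise_sq V n w / n%:R - sigma ^+ 2)))) =
      (fun w => expR (- (u * sigma ^+ 2 * n%:R)) * expR (u * noise_sq V n w)).
    apply/funext => w; rewrite -expRD; congr expR; rewrite /speed hS /u; field.
    by rewrite lt0r_neq0.
  exact: hm.
rewrite ler_expR mul1r /speed hS.
have -> : - (u * sigma ^+ 2 * n%:R) + n%:R * (u * sigma ^+ 2 + 4 * (u * sigma ^+ 2) ^+ 2) =
  4 * n%:R * (u * sigma ^+ 2) ^+ 2 by ring.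
rewrite -(real_normK (num_real (u * sigma ^+ 2))) uE.
have -> : 4 * n%:R * (eta n * (eta n * q)) ^+ 2 =
  n%:R * eta n * eta n * (4 * (eta n * q) ^+ 2) by ring.
rewrite ler_piMr//; first by rewrite mulr_ge0 ?ltW.
have : (eta n * q) ^+ 2 <= 8^-1 * 8^-1 by rewrite expr2 ler_pM.
lra.
Unshelve. all: by end_near. Qed.

(** The choice [t = eta n], with either sign, gives the moment bound [expR (C * speed n)]. At this
    scale the martingale is of order one, so the bound [K] depends on the level [L]. *)
Lemma superexp_mart_bounded L al be : exists K, \forall z \near superexp P speed L,
  `|ar0_mart theta rho V al be z.1 z.2 / (z.1%:R * eta z.1)| <= K.
Proof.
have [C [e [C0 e0 h]]] := mean_exp_ar0_mart htheta hrho sigma0 hindep hnormal al be.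
exists (`|L| + C + 1).
have LC : L + C < `|L| + C + 1 by have := ler_norm L; lra.
have hs (s : R) : `|s| = 1 -> \forall n \near \oo,
    mean_le P (fun w => expR (speed n * (s * (ar0_mart theta rho V al be n w / (n%:R * eta n)))))
      (expR (C * speed n)).
  move=> s1; near=> n.
  have n0 : (0 < n)%N by near: n; exact: nbhs_infty_gt.
  have ne0 : 0 < n%:R * eta n by near: n; exact: near_eta_gt0.
  have e1 : 0 < eta n by move: ne0; rewrite pmulr_rgt0// ltr0n.
  have se : `|s * eta n| <= e.
    by rewrite normrM s1 mul1r ltW//; near: n; exact: near_eta_lt.
  have := h _ n se.
  have s2 : s ^+ 2 = 1 by rewrite -(real_normK (num_real s)) s1 expr1n.
  have -> : C * (s * eta n) ^+ 2 * n%:R = C * speed n.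
    by rewrite /speed (speedE b n0) -/(eta n) exprMn s2; ring.
  congr mean_le; apply/funext => w; congr expR.
  by rewrite /speed (speedE b n0) -/(eta n); field; rewrite !lt0r_neq0// ltr0n.
have h1 := superexp_lt speed_oo LC (hs 1 (normr1 _)).
have h2 := superexp_lt speed_oo LC (hs (- 1) (etrans (normrN _) (normr1 _))).
apply: filterS2 h1 h2 => z /=; rewrite mul1r mulN1r => g1 g2.
by rewrite ler_norml; apply/andP; split; lra.
Unshelve. all: by end_near. Qed.

Lemma exp_bounded_noise : exp_bounded P (fun n w => V n.+1 w ^+ 2).
Proof.
have s0 : 0 < (4 * sigma ^+ 2)^-1 by rewrite invr_gt0 mulr_gt0// exprn_gt0.
split.
- by move=> n; exact: measurable_funX.
- by move=> n w; exact: sqr_ge0.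
(* For this exponent [2 * t * sigma ^+ 2] equals [2^-1], within the range of [normal_exp_sqr]. *)
exists (4 * sigma ^+ 2)^-1, (Num.sqrt (1 - 2 * (4 * sigma ^+ 2)^-1 * sigma ^+ 2))^-1.
split => // n.
have mf : measurable_fun setT (fun x : R => expR ((4 * sigma ^+ 2)^-1 * x ^+ 2)).
  by apply: measurableT_comp => //; apply: measurable_funM => //; exact: measurable_funX.
split.
- by apply: (measurableT_comp mf).
- by move=> w; exact: expR_ge0.
pose g (x : R) := (expR ((4 * sigma ^+ 2)^-1 * x ^+ 2))%:E.
have mg : measurable_fun setT g by exact/measurable_EFinP.
have g0 x : (0 <= g x)%E by rewrite lee_fin expR_ge0.
have <- := @ge0_integral_distribution _ _ _ _ _ P (V n.+1) g mg g0.
rewrite (integral_noise hnormal)//.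
rewrite normal_exp_sqr// -mulrA.
have -> : (4 * sigma ^+ 2)^-1 * sigma ^+ 2 = 4^-1.
  by field; rewrite lt0r_neq0.
lra.
Qed.

End moderate_autoregression.

(** * Normal equations and linearised estimators at the moderate scale *)

Section moderate_yule_walker.
Context {d : measure_display} {T : measurableType d} {R : realType}.
Variables (P : probability T R) (b : nat -> R).
Hypothesis b_gt0 : forall n, (1 <= n)%N -> 0 < b n.
Hypothesis b_oo : b n @[n --> \oo] --> +oo.
Hypothesis b_small : b n / Num.sqrt n%:R @[n --> \oo] --> 0.
Let speed n := b n ^+ 2.
Let eta n : R := b n / Num.sqrt n%:R.
Let FF L : Filter (superexp P speed L) := superexp_filter P (speed_oo b_oo) L.
Local Existing Instance FF.

Variables (theta rho sigma : R) (V : nat -> {RV P >-> R}).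
Hypothesis htheta : `|theta| < 1.
Hypothesis hrho : `|rho| < 1.
Hypothesis sigma0 : 0 < sigma.
Hypothesis hindep : mutually_independent P (fun n w => V n.+1 w).
Hypothesis hnormal : forall k (A : set R), measurable A ->
  distribution P (V k.+1) A = normal_prob 0 sigma A.

Let expV : exp_bounded P (fun n w => V n.+1 w ^+ 2).
Proof. exact: (exp_bounded_noise sigma0 hnormal). Qed.

Section process.
(** Used twice: with the given process, to linearise the estimators, and with the process started at
    zero, to find the limit of the bracket. *)
Variables X E : nat -> T -> R.
Hypothesis hX : forall n w, X n.+1 w = theta * X n w + E n.+1 w.
Hypothesis hE : forall n w, E n.+1 w = rho * E n w + V n.+1 w.
Hypothesis expX : exp_bounded P (fun n w => X n w ^+ 2).
Hypothesis expE : exp_bounded P (fun n w => E n w ^+ 2).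

Let x w k := X k w.
Let e w k := E k w.
Let v w k : R := V k w.
Let psi := theta * rho.
Let phi := theta + rho.
Let r1 n w := psi * (X n w * X n.-1 w) + - psi * (X 0%N w * X 0%N w) +
  (rho * (E 0%N w * X 0%N w) + (psi - rho) * (X 0%N w * X 0%N w)).
Let r2 n w := - phi * (X n w * X n.-1 w) + phi * (X 0%N w * X 0%N w) +
  psi * (X n.-1 w * X n.-1 w) + - psi * (X 0%N w * X 0%N w) +
  (rho * (E 0%N w * X 0%N w) + (psi - rho) * (X 0%N w * X 0%N w)).
Let r3 n w := (rho * (E 0%N w * V 1%N w) + (psi - rho) * (X 0%N w * V 1%N w)) +
  (rho * (E 0%N w * X 1%N w) + (psi - rho) * (X 0%N w * X 1%N w)) +
  - 1 * (X n w * X n w) + X 0%N w * X 0%N w.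

Variable L : R.

Let nprod := @negligible_prod _ _ _ P b b_gt0 b_oo b_small L.
Let nD := @negligibleD _ _ _ P b b_oo L.
Let nZ := @negligibleZ _ _ _ P b b_oo L.
Let X0 := exp_bounded_at 0 expX.
Let X1 := exp_bounded_at 1 expX.
Let E0 := exp_bounded_at 0 expE.
Let V1 := exp_bounded_at 0 expV.
Let Xp := exp_bounded_shift expX.

Let pnp : negligible P b (fun n w => X n w * X n.-1 w) L := nprod expX Xp.
Let pnn : negligible P b (fun n w => X n w * X n w) L := nprod expX expX.
Let ppp : negligible P b (fun n w => X n.-1 w * X n.-1 w) L := nprod Xp Xp.
Let p00 : negligible P b (fun n w => X 0%N w * X 0%N w) L := nprod X0 X0.
Let p10 : negligible P b (fun n w => X 1%N w * X 0%N w) L := nprod X1 X0.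
Let p01 : negligible P b (fun n w => X 0%N w * X 1%N w) L := nprod X0 X1.
Let pE0 : negligible P b (fun n w => E 0%N w * X 0%N w) L := nprod E0 X0.
Let pE1 : negligible P b (fun n w => E 0%N w * X 1%N w) L := nprod E0 X1.
Let pEV : negligible P b (fun n w => E 0%N w * V 1%N w) L := nprod E0 V1.
Let p0V : negligible P b (fun n w => X 0%N w * V 1%N w) L := nprod X0 V1.

Let pi0 := nD (nZ rho pE0) (nZ (psi - rho) p00).

Let hr1 : negligible P b r1 L := nD (nD (nZ psi pnp) (nZ (- psi) p00)) pi0.

Let hr2 : negligible P b r2 L :=
  nD (nD (nD (nD (nZ (- phi) pnp) (nZ phi p00)) (nZ psi ppp)) (nZ (- psi) p00)) pi0.

Let hr3 : negligible P b r3 L :=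
  nD (nD (nD (nD (nZ rho pEV) (nZ (psi - rho) p0V))
             (nD (nZ rho pE1) (nZ (psi - rho) p01))) (nZ (- 1) pnn)) p00.

Let F := superexp P speed L.
Let S (z : nat * T) := sum_sq (x z.2) z.1.
Let C (z : nat * T) := sum_lag1 (x z.2) z.1.
Let Q (z : nat * T) := sum_lag2 (x z.2) z.1.
Let M (z : nat * T) := sum_noise1 (x z.2) (v z.2) z.1.
Let M' (z : nat * T) := sum_noise2 (x z.2) (v z.2) z.1.
Let LL (z : nat * T) := sum_noise_sq (v z.2) z.1.

Let npos : \forall z \near F, (0 < z.1)%N.
Proof. exact: (@superexp_near _ _ _ P speed L (fun n => (0 < n)%N) (nbhs_infty_gt 0)). Qed.

Let N0 : \forall z \near F, 0 < z.1%:R :> R.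
Proof. by apply: filterS npos => z; rewrite ltr0n. Qed.

Let eta0 : \forall z \near F, 0 < eta z.1.
Proof.
have := superexp_near P speed L (near_eta_gt0 b_gt0).
by apply: filterS2 N0 => z Nz; rewrite /= pmulr_rgt0.
Qed.

Let cvgeta : eta z.1 @[z --> F] --> 0.
Proof.
apply/cvgrPdist_lt => r r0; have := superexp_near P speed L (near_eta_lt b_small r0).
by apply: filterS => z /=; rewrite sub0r normrN.
Qed.

Let hx w k : x w k.+1 = theta * x w k + e w k.+1. Proof. exact: hX. Qed.
Let he w k : e w k.+1 = rho * e w k + v w k.+1. Proof. exact: hE. Qed.

Let hC : \forall z \near F, (1 + psi) * C z = phi * S z + M z + r1 z.1 z.2.
Proof.
apply: filterS npos => -[[|n] w]//= _.
by rewrite /C /S /M /= (sum_lag1E (hx w) (he w)) /r1 /init_term /x /e -/psi -/phi /=; ring.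
Qed.

Let hQ : \forall z \near F, Q z = phi * C z - psi * S z + M' z + r2 z.1 z.2.
Proof.
apply: filterS npos => -[[|n] w]//= _.
by rewrite /Q /C /S /M' /= (sum_lag2E (hx w) (he w)) /r2 /init_term /x /e -/psi -/phi /=; ring.
Qed.

Let hS : \forall z \near F,
  S z = phi * C z - psi * Q z + phi * M z - psi * M' z + LL z + r3 z.1 z.2.
Proof.
apply: filterS npos => -[[|n] w]//= _.
rewrite /Q /C /M /M' /LL /= {1}/S /= (sum_sqE (hx w) (he w)) /r3 /init_term /x /e /v -/psi -/phi /=; ring.
Qed.

Let cvgLL : LL z / z.1%:R @[z --> F] --> sigma ^+ 2.
Proof. exact: (superexp_noise_sq b_gt0 b_oo b_small theta rho sigma0 hindep hnormal). Qed.

Variable K : R.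
Hypothesis bndM : \forall z \near F, `|M z / (z.1%:R * eta z.1)| <= K.
Hypothesis bndM' : \forall z \near F, `|M' z / (z.1%:R * eta z.1)| <= K.

Lemma superexp_square_sum :
  S z / z.1%:R @[z --> F] --> stationary_variance theta rho sigma.
Proof.
exact: (cvg_square_sum_scaled htheta hrho N0 hC hQ hS cvgLL eta0 cvgeta bndM bndM'
  hr1 hr2 hr3).
Qed.

Lemma superexp_product_sum : C z / z.1%:R @[z --> F] -->
  theta_star theta rho * stationary_variance theta rho sigma.
Proof.
exact: (cvg_product_sum_scaled htheta hrho N0 hC hQ hS cvgLL eta0 cvgeta bndM bndM'
  hr1 hr2 hr3).
Qed.

Let theta_hatE z : theta_hat X z.1 z.2 = C z / S z.
Proof. by rewrite /theta_hat !big_add1/= !big_mkord. Qed.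

Lemma superexp_theta_hat :
  (theta_hat X z.1 z.2 - theta_star theta rho) / eta z.1 -
  (M z / (z.1%:R * eta z.1)) / ((1 + psi) * stationary_variance theta rho sigma)
    @[z --> F] --> 0.
Proof.
under eq_fun do rewrite theta_hatE.
exact: (cvg_theta_hat htheta hrho sigma0 N0 hC hQ hS cvgLL eta0 cvgeta bndM bndM'
  hr1 hr2 hr3).
Qed.

Let tau (z : nat * T) := C z / S z.
Let tau2 (z : nat * T) := tau z ^+ 2.
(** The coefficients [tau] and [tau2] are random but converge, so multiplying by them preserves
    negligibility. *)
Let r4 n w := tau2 (n, w) * (X 0%N w * X 0%N w + - 1 * (X n w * X n.-1 w)) +
  (tau (n, w) * (X 1%N w * X 0%N w) + tau2 (n, w) * (- 1 * (X 0%N w * X 0%N w))).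
Let r5 n w := tau (n, w) * (2 * (X n w * X n.-1 w)) + tau2 (n, w) * (- 1 * (X n.-1 w * X n.-1 w)).

Let ctau : tau z @[z --> F] --> theta_star theta rho.
Proof.
exact: (cvg_tau htheta hrho sigma0 N0 hC hQ hS cvgLL eta0 cvgeta bndM bndM'
  hr1 hr2 hr3).
Qed.

Let ctau2 : tau2 z @[z --> F] --> theta_star theta rho ^+ 2.
Proof. exact: cvgM. Qed.

Let nM1 f := @negligible_cvgM _ _ _ P b b_oo L tau _ f ctau.
Let nM2 f := @negligible_cvgM _ _ _ P b b_oo L tau2 _ f ctau2.

Let hr4 : negligible P b r4 L :=
  nD (nM2 (nD p00 (nZ (- 1) pnp))) (nD (nM1 p10) (nM2 (nZ (- 1) p00))).

Let hr5 : negligible P b r5 L := nD (nM1 (nZ 2 pnp)) (nM2 (nZ (- 1) ppp)).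

Let th := theta_star theta rho.
Let ell := stationary_variance theta rho sigma.

Lemma superexp_rho_hat :
  (rho_hat X z.1 z.2 - rho_star theta rho) / eta z.1 -
    ((M z / (z.1%:R * eta z.1)) * ((th ^+ 2 + psi) / ((1 + psi) * (1 - th ^+ 2) * ell)) -
     (M' z / (z.1%:R * eta z.1)) * (th / ((1 - th ^+ 2) * ell))) @[z --> F] --> 0.
Proof.
pose J (z : nat * T) := \sum_(1 <= k < z.1.+1) residual X z.1 k z.2 * residual X z.1 k.-1 z.2.
pose H (z : nat * T) := \sum_(1 <= k < z.1.+1) residual X z.1 k.-1 z.2 ^+ 2.
have hJ : \forall z \near F,
    J z = C z - tau z * Q z - tau z * S z + tau z ^+ 2 * C z + r4 z.1 z.2.
  apply: filterS npos => -[[|n] w]//= _; rewrite /J big_add1/= big_mkord.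
  apply: etrans (sum_residual_lag1E (x w) (theta_hat X n.+1 w) n) _.
  rewrite (theta_hatE (n.+1, w)) -/(tau (n.+1, w)).
  by rewrite /C /Q /S /r4 /tau2 /x /=; ring.
have hH : \forall z \near F,
    H z = S z - 2 * tau z * C z + tau z ^+ 2 * S z + r5 z.1 z.2.
  apply: filterS npos => -[[|n] w]//= _; rewrite /H big_add1/= big_mkord.
  apply: etrans (sum_residual_sqE (x w) (theta_hat X n.+1 w) n) _.
  rewrite (theta_hatE (n.+1, w)) -/(tau (n.+1, w)).
  by rewrite /C /S /r5 /tau2 /x /=; ring.
exact: (cvg_rho_hat htheta hrho sigma0 N0 hC hQ hS cvgLL eta0 cvgeta bndM bndM'
  hr1 hr2 hr3 hJ hH hr4 hr5).
Qed.

End process.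
End moderate_yule_walker.

(** * The weights of the noise sums and the matrix Gamma *)

Section covariance.
Context {R : realType}.
Variables theta rho sigma : R.
Hypothesis htheta : `|theta| < 1.
Hypothesis hrho : `|rho| < 1.
Hypothesis sigma0 : 0 < sigma.
Let psi := theta * rho.
Let th := theta_star theta rho.
Let ell := stationary_variance theta rho sigma.

Let op0 : 0 < 1 + psi := onepsi_gt0 htheta hrho.
Let om0 : 0 < 1 - psi := onempsi_gt0 htheta hrho.
Let t0 : 0 < 1 - theta ^+ 2 := theta_sqr_lt1 htheta.
Let r0 : 0 < 1 - rho ^+ 2 := rho_sqr_lt1 hrho.

(** The three weights are the coefficients of [M] and [M'] in the linearised estimators, the last
    one up to sign. *)
Definition theta_weight : R := ((1 + psi) * ell)^-1.
Definition rho_weight1 : R := (th ^+ 2 + psi) / ((1 + psi) * (1 - th ^+ 2) * ell).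
Definition rho_weight2 : R := th / ((1 - th ^+ 2) * ell).

(** The left-hand side is half the limit of [sigma ^+ 2 / n] times the bracket: [ell] is the
    stationary variance of the process and [th * ell] its covariance at lag one. This is where the
    entries of [Gamma] come from. *)
Lemma qform_Gamma l1 l2 (al := l1 * theta_weight + l2 * rho_weight1)
    (be := - (l2 * rho_weight2)) :
  sigma ^+ 2 / 2 * (ell * (al ^+ 2 + 2 * al * be * th + be ^+ 2)) =
  qform (sigma2_theta theta rho) (psi * sigma2_theta theta rho)
    (sigma2_rho theta rho) l1 l2.
Proof.
rewrite /al /be /rho_weight1 /rho_weight2 /theta_weight.
have -> : 1 - th ^+ 2 = (1 - theta ^+ 2) * (1 - rho ^+ 2) / (1 + psi) ^+ 2.
  exact: theta_star_sqrE.
rewrite /th /theta_star /ell /stationary_variance /qform /sigma2_theta /sigma2_rho -/psi.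
have p1 := lt0r_neq0 op0; have p2 := lt0r_neq0 om0.
have p3 := lt0r_neq0 t0; have p4 := lt0r_neq0 r0; have p5 := lt0r_neq0 sigma0.
move: p1 p2 p3 p4; rewrite /psi => p1 p2 p3 p4.
by field; rewrite p1 p2 p3 p4 p5.
Qed.

Lemma sigma2_theta_gt0 : 0 < sigma2_theta theta rho.
Proof. by rewrite /sigma2_theta divr_gt0 ?exprn_gt0// !mulr_gt0. Qed.

Lemma sigma2_rhoE : sigma2_rho theta rho =
  psi ^+ 2 * sigma2_theta theta rho + (1 - psi) * (theta + rho) ^+ 2 / (1 + psi).
Proof.
rewrite /sigma2_rho /sigma2_theta -/psi; field.
by rewrite lt0r_neq0.
Qed.

(** The determinant factors with [(theta + rho) ^+ 2], so it vanishes exactly in the excluded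
    case. *)
Lemma Gamma_disc_gt0 : theta <> - rho ->
  0 < sigma2_theta theta rho * sigma2_rho theta rho -
      (psi * sigma2_theta theta rho) ^+ 2.
Proof.
move=> hne.
have -> : sigma2_theta theta rho * sigma2_rho theta rho - (psi * sigma2_theta theta rho) ^+ 2
   = sigma2_theta theta rho * ((1 - psi) * (theta + rho) ^+ 2 / (1 + psi)).
  by rewrite sigma2_rhoE; ring.
rewrite mulr_gt0 ?sigma2_theta_gt0// divr_gt0// mulr_gt0//.
rewrite exprn_even_gt0//=; apply/eqP => h; apply: hne.
by apply/eqP; rewrite -addr_eq0; apply/eqP.
Qed.

End covariance.

(** * Comparison of the estimators with the martingale of the process started at zero *)

Section moderate_estimators.
Context {d : measure_display} {T : measurableType d} {R : realType}.
Variables (P : probability T R) (b : nat -> R).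
Hypothesis b_gt0 : forall n, (1 <= n)%N -> 0 < b n.
Hypothesis b_oo : b n @[n --> \oo] --> +oo.
Hypothesis b_small : b n / Num.sqrt n%:R @[n --> \oo] --> 0.
Let speed n := b n ^+ 2.
Let eta n : R := b n / Num.sqrt n%:R.
Let FF L : Filter (superexp P speed L) := superexp_filter P (speed_oo b_oo) L.
Local Existing Instance FF.

Variables (theta rho sigma : R) (X eps V : nat -> {RV P >-> R}).
Hypothesis htheta : `|theta| < 1.
Hypothesis hrho : `|rho| < 1.
Hypothesis sigma0 : 0 < sigma.
Hypothesis hindep : mutually_independent P (fun n w => V n.+1 w).
Hypothesis hnormal : forall k (A : set R), measurable A ->
  distribution P (V k.+1) A = normal_prob 0 sigma A.
Hypothesis hX : forall n w, X n.+1 w = theta * X n w + eps n.+1 w.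
Hypothesis heps : forall n w, eps n.+1 w = rho * eps n w + V n.+1 w.
Hypothesis X0_exp : exists s C, 0 < s /\ mean_le P (fun w => expR (s * X 0%N w ^+ 2)) C.
Hypothesis eps0_exp : exists s C, 0 < s /\ mean_le P (fun w => expR (s * eps 0%N w ^+ 2)) C.

Let expV : exp_bounded P (fun n w => V n.+1 w ^+ 2).
Proof. exact: (exp_bounded_noise sigma0 hnormal). Qed.

Let exp_ar0_term (y : T -> R) : (forall w, y w = 0) ->
  exists s C, 0 < s /\ mean_le P (fun w => expR (s * y w ^+ 2)) C.
Proof.
move=> y0; exists 1, 1; split => //.
have -> : (fun w => expR (1 * y w ^+ 2)) = cst 1.
  by apply/funext => w; rewrite y0 expr0n/= mulr0 expR0.
exact: mean_le_cst.
Qed.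

Let expeps : exp_bounded P (fun n w => eps n w ^+ 2).
Proof.
exact: (@exp_bounded_ar1 _ _ _ P rho (fun n => eps n) (fun n => V n) hrho
  (fun n => measurable_funPT (eps n)) heps eps0_exp expV).
Qed.

Let expX : exp_bounded P (fun n w => X n w ^+ 2).
Proof.
exact: (@exp_bounded_ar1 _ _ _ P theta (fun n => X n) (fun n => eps n) htheta
  (fun n => measurable_funPT (X n)) hX X0_exp (exp_bounded_succ expeps)).
Qed.

Let Y := ar0 theta rho V.
Let YE := ar0_noise theta rho V.
Let hY n w : Y n.+1 w = theta * Y n w + YE n.+1 w.
Proof. exact: ar0E. Qed.
Let hYE n w : YE n.+1 w = rho * YE n w + V n.+1 w.
Proof. exact: ar0_noiseE. Qed.
Let Y0 w : Y 0%N w = 0. Proof. exact: ar00. Qed.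
Let YE0 w : YE 0%N w = 0.
Proof. by rewrite /YE /ar0_noise/= ar00 mulr0 subrr. Qed.
Let mY n : measurable_fun setT (Y n).
Proof. exact: measurable_ar0. Qed.

Let expYE : exp_bounded P (fun n w => YE n w ^+ 2).
Proof.
have mYE n : measurable_fun setT (YE n).
  rewrite /YE /ar0_noise; apply: measurable_funB => //.
  exact: measurable_funM.
exact: (@exp_bounded_ar1 _ _ _ P rho YE (fun n => V n) hrho mYE hYE
  (exp_ar0_term YE0) expV).
Qed.

Let expY : exp_bounded P (fun n w => Y n w ^+ 2).
Proof.
exact: (@exp_bounded_ar1 _ _ _ P theta Y YE htheta mY hY
  (exp_ar0_term (ar00 theta rho V)) (exp_bounded_succ expYE)).
Qed.

Variable L : R.
Let F := superexp P speed L.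

Let M (z : nat * T) := sum_noise1 (X^~ z.2) (V^~ z.2) z.1.
Let M' (z : nat * T) := sum_noise2 (X^~ z.2) (V^~ z.2) z.1.
Let MY (z : nat * T) := sum_noise1 (Y^~ z.2) (V^~ z.2) z.1.
Let MY' (z : nat * T) := sum_noise2 (Y^~ z.2) (V^~ z.2) z.1.

Let martE al be z :
  ar0_mart theta rho V al be z.1 z.2 = al * MY z + be * MY' z.
Proof.
rewrite /ar0_mart /MY /MY' /sum_noise1 /sum_noise2 !mulr_sumr -big_split/=.
by apply: eq_bigr => k _; rewrite -/Y; ring.
Qed.

Let bndMY : exists K, \forall z \near F,
  `|MY z / (z.1%:R * eta z.1)| <= K /\ `|MY' z / (z.1%:R * eta z.1)| <= K.
Proof.
have [K1 h1] := superexp_mart_bounded b_gt0 b_oo b_small htheta hrho sigma0 hindep hnormal L 1 0.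
have [K2 h2] := superexp_mart_bounded b_gt0 b_oo b_small htheta hrho sigma0 hindep hnormal L 0 1.
exists (Num.max K1 K2); apply: filterS2 h1 h2 => z.
rewrite !martE !mul1r !mul0r addr0 add0r => h1 h2.
by split; rewrite le_max ?h1 ?h2 ?orbT.
Qed.

(** [X - Y] solves the recursion without noise, hence decays geometrically; its product with the
    noise is controlled by the squared initial values and a convex combination of squared noise
    variables. *)
Let decay : exists U K, exp_bounded P U /\ forall n w,
  `|M (n, w) - MY (n, w)| <= K * U n w /\ `|M' (n, w) - MY' (n, w)| <= K * U n w.
Proof.
have [r [A [r0 r1 A0 h]]] := ar2_geometric_decay htheta hrho.
pose c0 w := `|X 0%N w| + `|eps 0%N w|.
pose U n w := c0 w ^+ 2 + \sum_(k < n) (1 - r) * r ^+ k * V k.+1 w ^+ 2.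
have B0 : 0 <= A / r by rewrite divr_ge0// ltW.
have hd w k : `|X k w - Y k w| <= A * c0 w * r ^+ k.
  have := h (fun k => X k w - Y k w) (fun k => eps k w - YE k w) _ _ k.
  rewrite Y0 YE0 !subr0; apply.
    by move=> {}k; rewrite hX hY; ring.
  by move=> {}k; rewrite heps hYE; ring.
have c00 w : 0 <= c0 w by rewrite addr_ge0.
have Ar : A <= A / r by rewrite ler_peMr// -invr1 lef_pV2 ?posrE// ltW.
have hd1 w k : `|X k w - Y k w| <= A / r * c0 w * r ^+ k.
  apply: le_trans (hd w k) _; apply: ler_wpM2r; first by rewrite exprn_ge0// ltW.
  exact: ler_wpM2r.
(* The lag costs a factor [r^-1]; at [k = 0] the predecessor is 0 again, which [hd1] covers. *)
have hd2 w k : `|X k.-1 w - Y k.-1 w| <= A / r * c0 w * r ^+ k.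
  case: k => [|k]; first exact: hd1.
  apply: le_trans (hd w k) _; rewrite le_eqVlt; apply/orP; left; apply/eqP.
  by rewrite exprS; field; rewrite lt0r_neq0.
exists U, (A / r / (2 * (1 - r))); split.
  apply: exp_boundedD; last first.
    have w0 k : 0 <= (1 - r) * r ^+ k by rewrite mulr_ge0 ?exprn_ge0 ?subr_ge0 ?ltW.
    have w1 n : \sum_(k < n) (1 - r) * r ^+ k <= 1.
      by apply: sum_geometric_le => //; exact: ltW.
    exact: (@exp_bounded_convex _ _ _ P (fun k => (1 - r) * r ^+ k) _ w0 w1 expV).
  have h0 := exp_boundedD (exp_bounded_at 0 expX) (exp_bounded_at 0 expeps).
  apply: (@exp_bounded_le _ _ _ P _ _ 2 _ _ _ h0) => //.
    by move=> _; apply: measurable_funX; apply: measurable_funD; exact: measurableT_comp.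
  move=> _ w; rewrite sqr_ge0/= /c0 -(real_normK (num_real (X 0%N w))).
  rewrite -(real_normK (num_real (eps 0%N w))).
  by have := sqr_ge0 (`|X 0%N w| - `|eps 0%N w|); rewrite sqrrB sqrrD !mulr2n; lra.
move=> n w; split.
  have -> : M (n, w) - MY (n, w) = \sum_(k < n) (X k w - Y k w) * V k.+1 w.
    by rewrite /M /MY /sum_noise1 -sumrB; apply: eq_bigr => k _; rewrite mulrBl.
  exact: (geometric_noise_bound (fun k => V k.+1 w) n r0 r1 B0 (hd1 w)).
have -> : M' (n, w) - MY' (n, w) = \sum_(k < n) (X k.-1 w - Y k.-1 w) * V k.+1 w.
  by rewrite /M' /MY' /sum_noise2 -sumrB; apply: eq_bigr => k _; rewrite mulrBl.
exact: (geometric_noise_bound (fun k => V k.+1 w) n r0 r1 B0 (hd2 w)).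
Qed.

Let cvgM : M z / (z.1%:R * eta z.1) - MY z / (z.1%:R * eta z.1) @[z --> F] --> 0.
Proof.
have [U [K [eU hU]]] := decay.
have h : negligible P b (fun n w => M (n, w) - MY (n, w)) L.
  exact: (negligible_bounded b_gt0 b_oo b_small L eU (fun n w => proj1 (hU n w))).
have -> : (fun z => M z / (z.1%:R * eta z.1) - MY z / (z.1%:R * eta z.1)) =
    (fun z => (M (z.1, z.2) - MY (z.1, z.2)) / (z.1%:R * eta z.1)).
  by apply/funext => -[n w]; rewrite mulrBl.
exact: h.
Qed.

Let cvgM' : M' z / (z.1%:R * eta z.1) - MY' z / (z.1%:R * eta z.1) @[z --> F] --> 0.
Proof.
have [U [K [eU hU]]] := decay.
have h : negligible P b (fun n w => M' (n, w) - MY' (n, w)) L.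
  exact: (negligible_bounded b_gt0 b_oo b_small L eU (fun n w => proj2 (hU n w))).
have -> : (fun z => M' z / (z.1%:R * eta z.1) - MY' z / (z.1%:R * eta z.1)) =
    (fun z => (M' (z.1, z.2) - MY' (z.1, z.2)) / (z.1%:R * eta z.1)).
  by apply/funext => -[n w]; rewrite mulrBl.
exact: h.
Qed.

Let bndM : exists K, \forall z \near F,
  `|M z / (z.1%:R * eta z.1)| <= K /\ `|M' z / (z.1%:R * eta z.1)| <= K.
Proof.
have [K hK] := bndMY; exists (K + 1).
move/cvgrPdist_lt : cvgM => /(_ _ ltr01); move/cvgrPdist_lt : cvgM' => /(_ _ ltr01).
apply: filterS3 hK => z [k1 k2]; rewrite !sub0r !normrN => h' h.
split.
  rewrite -[X in `|X|](subrK (MY z / (z.1%:R * eta z.1))).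
  by rewrite (le_trans (ler_normD _ _))// addrC lerD// ltW.
rewrite -[X in `|X|](subrK (MY' z / (z.1%:R * eta z.1))).
by rewrite (le_trans (ler_normD _ _))// addrC lerD// ltW.
Qed.

Definition mart_weight1 l1 l2 :=
  l1 * theta_weight theta rho sigma + l2 * rho_weight1 theta rho sigma.
Definition mart_weight2 (l2 : R) := - (l2 * rho_weight2 theta rho sigma).

(* The logarithm of the exponential martingale which, at speed [b n ^+ 2], is
   close to [l1 * Z1 + l2 * Z2 - qform l1 l2]. *)
Definition log_tilt l1 l2 n w :=
  (eta n * ar0_mart theta rho V (mart_weight1 l1 l2) (mart_weight2 l2) n w -
   eta n ^+ 2 * sigma ^+ 2 / 2 *
     ar0_bracket theta rho V (mart_weight1 l1 l2) (mart_weight2 l2) n w) / speed n.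

Let bracketE al be n w : ar0_bracket theta rho V al be n.+1 w =
  al ^+ 2 * sum_sq (Y^~ w) n.+1 + 2 * al * be * (sum_lag1 (Y^~ w) n.+1 - Y n.+1 w * Y n w) +
  be ^+ 2 * (sum_sq (Y^~ w) n.+1 - Y n w * Y n w).
Proof.
rewrite /ar0_bracket /sum_sq /sum_lag1 -/Y.
elim: n => [|n ih]; first by rewrite !big_ord1 /= !Y0; ring.
rewrite big_ord_recr/= ih.
rewrite [\sum_(k < n.+2) Y k w ^+ 2]big_ord_recr/=.
rewrite [\sum_(k < n.+2) Y k.+1 w * Y k w]big_ord_recr/=.
by ring.
Qed.

Let ell := stationary_variance theta rho sigma.
Let th := theta_star theta rho.

Let negl_div f : negligible P b f L -> f z.1 z.2 / z.1%:R @[z --> F] --> 0.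
Proof.
move=> hf.
have cvgeta : eta z.1 @[z --> F] --> 0.
  apply/cvgrPdist_lt => r r0; have := superexp_near P speed L (near_eta_lt b_small r0).
  by apply: filterS => z /=; rewrite sub0r normrN.
apply: (@cvg_near_eq _ _ _ _ _ (fun z => (f z.1 z.2 / (z.1%:R * eta z.1)) * eta z.1)).
  have := superexp_near P speed L (near_eta_gt0 b_gt0).
  apply: filterS => z /= /lt0r_neq0; rewrite mulf_eq0 negb_or => /andP[n0 e0].
  by field; rewrite n0 e0.
by rewrite -[X in _ --> X](mulr0 0); apply: normed_module.cvgM.
Qed.

Let cvg_bracket al be : ar0_bracket theta rho V al be z.1 z.2 / z.1%:R @[z --> F] -->
  ell * (al ^+ 2 + 2 * al * be * th + be ^+ 2).
Proof.
have [K hK] := bndMY.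
have hK1 : \forall z \near F, `|MY z / (z.1%:R * eta z.1)| <= K.
  by apply: filterS hK => z [].
have hK2 : \forall z \near F, `|MY' z / (z.1%:R * eta z.1)| <= K.
  by apply: filterS hK => z [].
have cS := superexp_square_sum b_gt0 b_oo b_small htheta hrho sigma0 hindep hnormal
  hY hYE expY expYE hK1 hK2.
have cC := superexp_product_sum b_gt0 b_oo b_small htheta hrho sigma0 hindep hnormal
  hY hYE expY expYE hK1 hK2.
have c1 := negl_div (negligible_prod b_gt0 b_oo b_small L expY (exp_bounded_shift expY)).
have c2 := negl_div (negligible_prod b_gt0 b_oo b_small L
  (exp_bounded_shift expY) (exp_bounded_shift expY)).
apply: (@cvg_near_eq _ _ _ _ _ (fun z =>
  al ^+ 2 * (sum_sq (Y^~ z.2) z.1 / z.1%:R) +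
  2 * al * be * (sum_lag1 (Y^~ z.2) z.1 / z.1%:R - Y z.1 z.2 * Y z.1.-1 z.2 / z.1%:R) +
  be ^+ 2 * (sum_sq (Y^~ z.2) z.1 / z.1%:R - Y z.1.-1 z.2 * Y z.1.-1 z.2 / z.1%:R))).
  have := @superexp_near _ _ _ P speed L (fun n => (0 < n)%N) (nbhs_infty_gt 0).
  by apply: filterS => -[[|n] w]//= _; rewrite bracketE; ring.
have -> : ell * (al ^+ 2 + 2 * al * be * th + be ^+ 2) =
  al ^+ 2 * ell + 2 * al * be * (th * ell - 0) + be ^+ 2 * (ell - 0) by ring.
cvg_field.
Qed.

Let Z1 n w := Num.sqrt n%:R / b n * (theta_hat X n w - th).
Let Z2 n w := Num.sqrt n%:R / b n * (rho_hat X n w - rho_star theta rho).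

Lemma log_tilt_cvg l1 l2 :
  log_tilt l1 l2 z.1 z.2 - (l1 * Z1 z.1 z.2 + l2 * Z2 z.1 z.2 -
    qform (sigma2_theta theta rho) (theta * rho * sigma2_theta theta rho)
      (sigma2_rho theta rho) l1 l2) @[z --> F] --> 0.
Proof.
have [K hK] := bndM.
have hK1 : \forall z \near F, `|M z / (z.1%:R * eta z.1)| <= K.
  by apply: filterS hK => z [].
have hK2 : \forall z \near F, `|M' z / (z.1%:R * eta z.1)| <= K.
  by apply: filterS hK => z [].
have c1 := superexp_theta_hat b_gt0 b_oo b_small htheta hrho sigma0 hindep hnormal
  hX heps expX expeps hK1 hK2.
have c2 := superexp_rho_hat b_gt0 b_oo b_small htheta hrho sigma0 hindep hnormal
  hX heps expX expeps hK1 hK2.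
pose al := mart_weight1 l1 l2; pose be := mart_weight2 l2.
have c3 := @cvg_bracket al be.
pose q := qform (sigma2_theta theta rho) (theta * rho * sigma2_theta theta rho)
      (sigma2_rho theta rho) l1 l2.
pose e1 z := (theta_hat X z.1 z.2 - th) / eta z.1 -
  M z / (z.1%:R * eta z.1) / ((1 + theta * rho) * ell).
pose e2 z := (rho_hat X z.1 z.2 - rho_star theta rho) / eta z.1 -
  (M z / (z.1%:R * eta z.1) *
     ((th ^+ 2 + theta * rho) / ((1 + theta * rho) * (1 - th ^+ 2) * ell)) -
   M' z / (z.1%:R * eta z.1) * (th / ((1 - th ^+ 2) * ell))).
pose e3 z := M z / (z.1%:R * eta z.1) - MY z / (z.1%:R * eta z.1).
pose e4 z := M' z / (z.1%:R * eta z.1) - MY' z / (z.1%:R * eta z.1).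
(* The error splits into the linearisation of the two estimators ([e1], [e2]), the change of initial
   values ([e3], [e4]) and the convergence of the bracket to [q]. *)
apply: (@cvg_near_eq _ _ _ _ _ (fun z => - al * e3 z - be * e4 z - l1 * e1 z - l2 * e2 z -
  (sigma ^+ 2 / 2 * (ar0_bracket theta rho V al be z.1 z.2 / z.1%:R) - q))).
  have := superexp_near P speed L (near_eta_gt0 b_gt0).
  have := @superexp_near _ _ _ P speed L (fun n => (0 < n)%N) (nbhs_infty_gt 0).
  apply: filterS2 => z /= z0 /lt0r_neq0; rewrite mulf_eq0 negb_or => /andP[n0 ez0].
  rewrite /log_tilt martE -/al -/be /speed (speedE b z0) -/(eta z.1) -/q.
  have -> : Z1 z.1 z.2 = (theta_hat X z.1 z.2 - th) / eta z.1.
    by rewrite /Z1 /eta invf_div mulrC.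
  have -> : Z2 z.1 z.2 = (rho_hat X z.1 z.2 - rho_star theta rho) / eta z.1.
    by rewrite /Z2 /eta invf_div mulrC.
  have key (m m' y y' w w1 w2 x1 x2 br : R) :
      (l1 * w^-1 + l2 * w1) * y + (- (l2 * w2)) * y' - br - (l1 * x1 + l2 * x2 - q) =
      - (l1 * w^-1 + l2 * w1) * (m - y) - (- (l2 * w2)) * (m' - y') - l1 * (x1 - m / w) -
      l2 * (x2 - (m * w1 - m' * w2)) - (br - q) by ring.
  set br := ar0_bracket _ _ _ _ _ _ _.
  have -> : (eta z.1 * (al * MY z + be * MY' z) - eta z.1 ^+ 2 * sigma ^+ 2 / 2 * br) /
      (z.1%:R * eta z.1 * eta z.1) =
      al * (MY z / (z.1%:R * eta z.1)) + be * (MY' z / (z.1%:R * eta z.1)) -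
      sigma ^+ 2 / 2 * (br / z.1%:R).
    by field; rewrite n0 ez0.
  exact: key.
have qE : sigma ^+ 2 / 2 * (ell * (al ^+ 2 + 2 * al * be * th + be ^+ 2)) - q = 0.
  by rewrite /al /be /mart_weight1 /mart_weight2 (qform_Gamma htheta hrho sigma0) subrr.
have -> : 0 = - al * 0 - be * 0 - l1 * 0 - l2 * 0 -
  (sigma ^+ 2 / 2 * (ell * (al ^+ 2 + 2 * al * be * th + be ^+ 2)) - q) :> R.
  by rewrite qE; ring.
cvg_field.
Qed.

End moderate_estimators.

(** * Moments of the exponential tilt *)

Section exponential_tilt.
Context {d : measure_display} {T : measurableType d} {R : realType}.
Variables (P : probability T R) (b : nat -> R).
Hypothesis b_oo : b n @[n --> \oo] --> +oo.
Hypothesis b_small : b n / Num.sqrt n%:R @[n --> \oo] --> 0.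
Let speed n := b n ^+ 2.
Let eta n : R := b n / Num.sqrt n%:R.
Variables (theta rho sigma : R) (V : nat -> {RV P >-> R}).
Hypothesis htheta : `|theta| < 1.
Hypothesis hrho : `|rho| < 1.
Hypothesis sigma0 : 0 < sigma.
Hypothesis hindep : mutually_independent P (fun n w => V n.+1 w).
Hypothesis hnormal : forall k (A : set R), measurable A ->
  distribution P (V k.+1) A = normal_prob 0 sigma A.

Let speed_gt0 : \forall n \near \oo, 0 < speed n.
Proof.
by apply: filterS (near_speed_ge (speed_oo b_oo) 1) => n; exact: lt_le_trans.
Qed.

Let speed_log_tilt l1 l2 n w : 0 < speed n ->
  speed n * log_tilt b theta rho sigma V l1 l2 n w =
  eta n * ar0_mart theta rho V (mart_weight1 theta rho sigma l1 l2)
    (mart_weight2 theta rho sigma l2) n w -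
  eta n ^+ 2 * sigma ^+ 2 / 2 * ar0_bracket theta rho V
    (mart_weight1 theta rho sigma l1 l2) (mart_weight2 theta rho sigma l2) n w.
Proof. by move=> s0; rewrite /log_tilt mulrC divfK// lt0r_neq0. Qed.

Lemma measurable_log_tilt l1 l2 n :
  measurable_fun setT (log_tilt b theta rho sigma V l1 l2 n).
Proof.
apply: measurable_funM => //; apply: measurable_funB; apply: measurable_funM => //.
  exact: measurable_ar0_mart.
exact: measurable_ar0_bracket.
Qed.

Let integral_log_tilt l1 l2 : \forall n \near \oo,
  (\int[P]_w (expR (speed n * log_tilt b theta rho sigma V l1 l2 n w))%:E = 1)%E.
Proof.
apply: filterS speed_gt0 => n s0.
under eq_integral do rewrite speed_log_tilt//.
exact: (integral_exp_ar0_mart theta rho sigma0 hindep hnormal).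
Qed.

Lemma log_tilt_le l1 l2 : \forall n \near \oo,
  mean_le P (fun w => expR (speed n * log_tilt b theta rho sigma V l1 l2 n w)) 1.
Proof.
apply: filterS (integral_log_tilt l1 l2) => n h; split; [|by move=> w; exact: expR_ge0|by rewrite h].
apply: measurableT_comp => //; apply: measurable_funM => //.
exact: measurable_log_tilt.
Qed.

Lemma log_tilt_ge l1 l2 : \forall n \near \oo,
  (1 <= \int[P]_w (expR (speed n * log_tilt b theta rho sigma V l1 l2 n w))%:E)%E.
Proof. by apply: filterS (integral_log_tilt l1 l2) => n ->. Qed.

(** Squaring doubles the parameter of the martingale; the bracket enters with a negative sign and is
    dropped. *)
Lemma log_tilt_sqr l1 l2 : exists C, \forall n \near \oo,
  mean_le P (fun w => expR (speed n * log_tilt b theta rho sigma V l1 l2 n w) ^+ 2)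
    (expR (C * speed n)).
Proof.
set al := mart_weight1 theta rho sigma l1 l2.
set be := mart_weight2 theta rho sigma l2.
have [C [e [C0 e0 h]]] := mean_exp_ar0_mart htheta hrho sigma0 hindep hnormal al be.
exists (4 * C); near=> n.
have n0 : (0 < n)%N by near: n; exact: nbhs_infty_gt.
have s0 : 0 < speed n by near: n.
have e2 : `|2 * eta n| <= e.
  rewrite normrM ger0_norm// -ler_pdivlMl// mulrC ltW//.
  by near: n; apply: near_eta_lt => //; exact: divr_gt0.
have := h _ n e2.
have -> : C * (2 * eta n) ^+ 2 * n%:R = 4 * C * speed n.
  by rewrite /speed (speedE b n0) -/(eta n); ring.
apply: mean_le_dom.
  apply: measurable_funX; apply: measurableT_comp => //; apply: measurable_funM => //.
  exact: measurable_log_tilt.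
move=> w; rewrite sqr_ge0/= -expRM_natr ler_expR speed_log_tilt// -/al -/be.
have : 0 <= ar0_bracket theta rho V al be n w.
  by apply: sumr_ge0 => k _; exact: sqr_ge0.
have : 0 <= eta n ^+ 2 * sigma ^+ 2 by rewrite mulr_ge0 ?sqr_ge0.
by nra.
Unshelve. all: by end_near. Qed.

End exponential_tilt.

(** * Measurability of the estimators and of open sets of the plane *)

Section measurability.
Context {d : measure_display} {T : measurableType d} {R : realType}.

(** Continuity away from 0, together with the convention that the inverse of 0 is 0. *)
Lemma measurable_inv : measurable_fun setT (@GRing.inv R).
Proof.
have -> : setT = [set x : R | x != 0] `|` [set 0].
  by apply/seteqP; split => // x _; case: (eqVneq x 0) => [->|]; [right|left].
have o0 : open [set x : R | x != 0] by exact: open_neq.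
apply/measurable_funU => //; first exact: open_measurable.
split; last exact: measurable_fun_set1.
apply: open_continuous_measurable_fun => // x; rewrite inE /= => x0.
exact: inv_continuous.
Qed.

(** Measurability in [R * R] refers to the product sigma-algebra; an open set is the countable union
    of the squares of rational centre and radius that it contains. *)
Lemma open_prod_measurable (U : set (R * R)) : open U -> measurable U.
Proof.
move=> oU.
pose box (q1 q2 r : rat) := [set x : R | `|x - ratr q1| < ratr r] `*`
                            [set x : R | `|x - ratr q2| < ratr r].
have mbox q1 q2 r : measurable (box q1 q2 r).
  by apply: measurableX; apply: measurable_lt_set => //; apply: measurableT_comp => //;
    exact: measurable_funB.
have -> : U = \bigcup_q1 \bigcup_q2 \bigcup_r
    (if `[< box q1 q2 r `<=` U >] then box q1 q2 r else set0).
  apply/seteqP; split; last first.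
    by move=> x [q1 _ [q2 _ [r _]]]; case: asboolP => // h; exact: h.
  move=> x Ux; have /nbhs_ballP[e /= e0 eU] : nbhs x U by exact: open_nbhs_nbhs.
  have [r] := rat_in_itvoo (divr_gt0 e0 (ltr0n R 2)).
  rewrite in_itv/= => /andP[r0 re].
  have near_rat (y : R) : exists q : rat, `|y - ratr q| < ratr r.
    have [q] : exists q : rat, ratr q \in `]y - ratr r, y[.
      by apply: rat_in_itvoo; rewrite ltrBlDr ltrDl.
    rewrite in_itv/= => /andP[q1 q2]; exists q.
    by rewrite ltr_norml; apply/andP; split; lra.
  have [q1 hq1] := near_rat x.1; have [q2 hq2] := near_rat x.2.
  exists q1 => //; exists q2 => //; exists r => //; case: asboolP => // -[].
  move=> y [/= y1 y2]; apply: eU; split; rewrite /ball/=.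
    rewrite (le_lt_trans (ler_distD (ratr q1) _ _))// [X in _ + X]distrC.
    by rewrite [e]splitr; apply: ltrD; [exact: lt_trans hq1 re|exact: lt_trans y1 re].
  rewrite (le_lt_trans (ler_distD (ratr q2) _ _))// [X in _ + X]distrC.
  by rewrite [e]splitr; apply: ltrD; [exact: lt_trans hq2 re|exact: lt_trans y2 re].
apply: bigcupT_measurable_rat => q1; apply: bigcupT_measurable_rat => q2.
by apply: bigcupT_measurable_rat => r; case: ifP.
Qed.

Variable X : nat -> {mfun T >-> R}.

Lemma measurable_theta_hat n : measurable_fun setT (theta_hat X n).
Proof.
apply: measurable_funM.
  by apply: measurable_sum => k; exact: measurable_funM.
apply: (measurableT_comp measurable_inv).
by apply: measurable_sum => k; exact: measurable_funX.
Qed.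

Lemma measurable_residual n k : measurable_fun setT (residual X n k).
Proof.
case: k => [|k] //=; apply: measurable_funB => //.
by apply: measurable_funM => //; exact: measurable_theta_hat.
Qed.

Lemma measurable_rho_hat n : measurable_fun setT (rho_hat X n).
Proof.
apply: measurable_funM.
  by apply: measurable_sum => k; apply: measurable_funM; exact: measurable_residual.
apply: (measurableT_comp measurable_inv).
by apply: measurable_sum => k; apply: measurable_funX; exact: measurable_residual.
Qed.

End measurability.

(** * Column vectors and the rate function *)

Section plane.
Context {R : realType}.

Lemma continuous_col2 : continuous (fun p : R * R => col2 p.1 p.2).
Proof.
move=> p; apply/cvg_ballP => e e0.
have h1 : q.1 @[q --> p] --> p.1 by exact: cvg_fst.
have h2 : q.2 @[q --> p] --> p.2 by exact: cvg_snd.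
move/cvgrPdist_lt : h1 => /(_ _ e0); move/cvgrPdist_lt : h2 => /(_ _ e0).
apply: filterS2 => q q2 q1; split => // i j.
by rewrite /col2 !mxE /ball/=; case: i => -[|[|//]].
Qed.

Lemma col2_eta (x : 'cV[R]_2) : col2 (x ord0 ord0) (x 1 ord0) = x.
Proof.
apply/matrixP => i j; rewrite mxE (ord1 j).
by case: i => -[|[|//]] hi /=; congr (x _ _); apply/val_inj.
Qed.

Lemma scale_col2 (k u v : R) : k *: col2 u v = col2 (k * u) (k * v).
Proof.
apply/matrixP => i j; rewrite !mxE.
by case: i => -[|[|//]].
Qed.

Lemma good_rate_continuous (E : topologicalType) (I : E -> R) :
  continuous I -> (forall x, 0 <= I x) -> (forall c, compact [set x | I x <= c]) ->
  good_rate_function (fun x => (I x)%:E).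
Proof.
move=> cI I0 kI; split.
- move=> x a; rewrite lte_fin => aI; exists [set y | a < I y].
    exact: (cvgr_gt _ (cI x)).
  by move=> y; rewrite lte_fin.
- by move=> x; rewrite lee_fin.
- move=> c; have -> : [set x | ((I x)%:E <= c%:E)%E] = [set x | I x <= c].
    by apply/seteqP; split => x /=; rewrite lee_fin.
  exact: kI.
Qed.

Variables theta rho : R.
Let a := sigma2_theta theta rho.
Let b := theta * rho * sigma2_theta theta rho.
Let c := sigma2_rho theta rho.
Hypothesis disc0 : 0 < a * c - b ^+ 2.

(** [invmx] is the inverse only for a unit, so an explicit inverse [H] is exhibited first; then
    [x = Gamma y], with [y] the dual slope, lets [invmx] cancel without being computed. *)
Lemma rate_KE (x : 'cV[R]_2) :
  rate_K theta rho x = (dual_qform a b c (x ord0 ord0) (x 1 ord0))%:E.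
Proof.
rewrite /rate_K; congr EFin.
have GE i j : Gamma theta rho i j = nth 0 (nth [::] [:: [:: a; b]; [:: b; c]] i) j.
  by rewrite mxE.
have uG : Gamma theta rho \in unitmx.
  pose H : 'M[R]_2 := \matrix_(i < 2, j < 2) (nth 0 (nth [::]
    [:: [:: c; - b]; [:: - b; a]] i) j / (a * c - b ^+ 2)).
  suff GH : Gamma theta rho *m H = 1%:M by have [] := mulmx1_unit GH.
  apply/matrixP => i j; rewrite !mxE !big_ord_recl big_ord0 !GE !mxE /= addr0.
  have d0 := lt0r_neq0 disc0.
  by case: i => -[|[|//]] hi; case: j => -[|[|//]] hj /=; field.
set x1 := x ord0 ord0; set x2 := x 1 ord0.
pose y := col2 (dual1 a b c x1 x2) (dual2 a b c x1 x2).
have Gy : Gamma theta rho *m y = x.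
  rewrite -(col2_eta x); apply/matrixP => i j.
  rewrite !mxE !big_ord_recl big_ord0 /= !GE /y !mxE /=.
  case: i => -[|[|//]] hi /=; rewrite addr0.
    exact: dual_inv1.
  exact: dual_inv2.
have -> : x^T *m invmx (Gamma theta rho) *m x = x^T *m y.
  by rewrite -{2}Gy -mulmxA mulKmx.
rewrite !mxE !big_ord_recl big_ord0 /= !mxE /= addr0.
have -> : x (lift ord0 ord0) ord0 = x2 by congr (x _ _); apply/val_inj.
rewrite -/x1 /dual_qform /dual1 /dual2; field.
by rewrite lt0r_neq0.
Qed.

End plane.

(** * The two large deviation principles *)

Section planar_ldp.
Context {d : measure_display} {T : measurableType d} {R : realType}.
Variables (P : probability T R) (v : nat -> R).
Hypothesis voo : v n @[n --> \oo] --> +oo.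
Variables theta rho : R.
Let a := sigma2_theta theta rho.
Let b := theta * rho * sigma2_theta theta rho.
Let c := sigma2_rho theta rho.
Hypothesis a0 : 0 < a.
Hypothesis disc0 : 0 < a * c - b ^+ 2.
Variables Z1 Z2 : nat -> T -> R.
Hypothesis mZ1 : forall n, measurable_fun setT (Z1 n).
Hypothesis mZ2 : forall n, measurable_fun setT (Z2 n).
Hypothesis upper : forall k L, 0 < k -> L < k ->
  superexp P v L [set z | dual_qform a b c (Z1 z.1 z.2) (Z2 z.1 z.2) < k].
Hypothesis lower : forall x1 x2 de eta, 0 < de -> 0 < eta ->
  \forall n \near \oo, ((expR (- (dual_qform a b c x1 x2 + eta) * v n))%:E <=
    P [set w | (`|Z1 n w - x1| < de)%R /\ (`|Z2 n w - x2| < de)%R])%E.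

Let FF L : Filter (superexp P v L) := superexp_filter P voo L.
Local Existing Instance FF.

Let c0 : 0 < c := qform_c0 a0 disc0.

Let mZ n : measurable_fun setT (fun w => (Z1 n w, Z2 n w)).
Proof. exact: measurable_fun_pair. Qed.

Lemma ldp_pair :
  large_deviation_principle P (fun n w => col2 (Z1 n w) (Z2 n w)) v (rate_K theta rho).
Proof.
have -> : rate_K theta rho = fun x => (dual_qform a b c (x ord0 ord0) (x 1 ord0))%:E.
  by apply/funext => x; rewrite rate_KE.
have mU n U : open U -> measurable ((fun w => col2 (Z1 n w) (Z2 n w)) @^-1` U).
  move=> oU; have oV : open ((fun p : R * R => col2 p.1 p.2) @^-1` U).
    by apply: open_comp => // p _; exact: continuous_col2.
  have := mZ n measurableT (open_prod_measurable oV).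
  by rewrite setTI.
apply: (@ldp_of_bounds _ _ _ P v voo 'cV[R]_2 _
  (fun x => dual_qform a b c (x ord0 ord0) (x 1 ord0))) => //.
- apply: (@good_rate_continuous R 'cV[R]_2
    (fun x => dual_qform a b c (x ord0 ord0) (x 1 ord0))).
  + move=> x.
    have h1 : (y : 'cV[R]_2) ord0 ord0 @[y --> x] --> x ord0 ord0.
      exact: (@coord_continuous R _ _ ord0 ord0).
    have h2 : (y : 'cV[R]_2) 1 ord0 @[y --> x] --> x 1 ord0.
      exact: (@coord_continuous R _ _ 1 ord0).
    exact: (cvg_comp2 h1 h2 (@continuous_dual_qform R a b c (x ord0 ord0, x 1 ord0))).
  + by move=> x; exact: dual_qform_ge0.
  + move=> k.
    (* Compactness of the level sets is carried over from [R * R] by the continuous map [col2]. *)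
    have -> : [set x : 'cV[R]_2 | dual_qform a b c (x ord0 ord0) (x 1 ord0) <= k] =
        (fun p : R * R => col2 p.1 p.2) @` [set p | dual_qform a b c p.1 p.2 <= k].
      apply/seteqP; split => [x /= hx|_ /= [p hp <-]].
        by exists (x ord0 ord0, x 1 ord0) => //; exact: col2_eta.
      by rewrite /= !mxE.
    apply: continuous_compact; last exact: compact_dual_qform_le.
    by apply: continuous_subspaceT; exact: continuous_col2.
- move=> k L k0 Lk; apply: filterS (upper k0 Lk) => z /=.
  by rewrite /= !mxE.
move=> x U eta oU Ux eta0.
have /nbhs_ballP[e /= e0 eU] : nbhs x U by exact: open_nbhs_nbhs.
apply: filterS (lower (x ord0 ord0) (x 1 ord0) e0 eta0) => n hn.
apply: le_trans hn _; apply: le_measure; rewrite ?inE.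
- apply: measurableI; apply: measurable_lt_set => //; apply: measurableT_comp => //;
    exact: measurable_funB.
- exact: mU.
move=> w [/= w1 w2]; apply: eU; split => // i j.
rewrite -(col2_eta x) /ball/= !mxE distrC.
by case: i => -[|[|//]] hi.
Qed.

Let c2_gt0 : 0 < 2 * c.
Proof. exact: mulr_gt0. Qed.

Let proj_qform x1 x2 : x2 ^+ 2 / (2 * c) <= dual_qform a b c x1 x2.
Proof.
rewrite ler_pdivrMr // [X in _ <= X]mulrC.
exact: sqr2_le_dual_qform.
Qed.

(** The contraction to the second coordinate, done by hand on the same two planar bounds. *)
Lemma ldp_second :
  large_deviation_principle P Z2 v (rate_rho theta rho).
Proof.
have mU n U : open U -> measurable (Z2 n @^-1` U).
  by move=> oU; have := mZ2 n measurableT (open_measurable oU); rewrite setTI.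
have cI : continuous (fun x : R => x ^+ 2 / (2 * c)).
  by move=> x; apply: cvgM; [exact: cvgM|exact: cvg_cst].
apply: (@ldp_of_bounds _ _ _ P v voo R Z2 (fun x => x ^+ 2 / (2 * c))) => //.
- apply: (@good_rate_continuous R R (fun x => x ^+ 2 / (2 * c))) => //.
  + by move=> x; apply: divr_ge0; [exact: sqr_ge0|exact: ltW].
  + move=> k; pose r := Num.sqrt (k * (2 * c)).
    apply: (subclosed_compact _ (@segment_compact R (- r) r)).
      apply: (preimage_closed (f := fun x : R => x ^+ 2 / (2 * c)) (D := [set y | y <= k])).
        by move=> x _; exact: cI.
      exact: closed_le.
    move=> x /=; rewrite in_itv/= -ler_norml -sqrtr_sqr ler_pdivrMr//.
    exact: ler_wsqrtr.
- move=> k L k0 Lk; apply: filterS (upper k0 Lk) => z /=.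
  exact: le_lt_trans (proj_qform _ _).
move=> x U eta oU Ux eta0.
have /nbhs_ballP[e /= e0 eU] : nbhs x U by exact: open_nbhs_nbhs.
(* The point [(b * x / c, x)] minimises the dual form among those with second coordinate [x]. *)
have -> : x ^+ 2 / (2 * c) = dual_qform a b c (b * x / c) x.
  by rewrite /dual_qform; field; rewrite !lt0r_neq0.
apply: filterS (lower (b * x / c) x e0 eta0) => n hn.
apply: le_trans hn _; apply: le_measure; rewrite ?inE.
- apply: measurableI; apply: measurable_lt_set => //; apply: measurableT_comp => //;
    exact: measurable_funB.
- exact: mU.
by move=> w [/= w1 w2]; apply: eU; rewrite /ball/= distrC.
Qed.

End planar_ldp.

Lemma mean_le_exp_sqr {d : measure_display} {T : measurableType d} {R : realType}
    (P : probability T R) (Y : {RV P >-> R}) t :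
  ('E_P[fun w => expR (t * Y w ^+ 2)] < +oo)%E ->
  exists C, mean_le P (fun w => expR (t * Y w ^+ 2)) C.
Proof.
rewrite unlock => h; exists (fine (\int[P]_w (expR (t * Y w ^+ 2))%:E)%E); split.
- apply: measurableT_comp => //; apply: measurable_funM => //.
  exact: measurable_funX.
- by move=> w; exact: expR_ge0.
rewrite fineK// ge0_fin_numE//; apply: integral_ge0 => w _.
by rewrite lee_fin expR_ge0.
Qed.

(** * The planar bounds for the normalised estimators *)

Section moderate_deviations.
Context {d : measure_display} {T : measurableType d} {R : realType}.
Variables (P : probability T R) (b : nat -> R).
Hypothesis b_gt0 : forall n, (1 <= n)%N -> 0 < b n.
Hypothesis b_oo : b n @[n --> \oo] --> +oo.
Hypothesis b_small : b n / Num.sqrt n%:R @[n --> \oo] --> 0.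
Variables (theta rho sigma : R) (X eps V : nat -> {RV P >-> R}).
Hypothesis htheta : `|theta| < 1.
Hypothesis hrho : `|rho| < 1.
Hypothesis hne : theta <> - rho.
Hypothesis sigma0 : 0 < sigma.
Hypothesis hindep : mutually_independent P (fun n w => V n.+1 w).
Hypothesis hnormal : forall k (A : set R), measurable A ->
  distribution P (V k.+1) A = normal_prob 0 sigma A.
Hypothesis hX : forall n w, X n.+1 w = theta * X n w + eps n.+1 w.
Hypothesis heps : forall n w, eps n.+1 w = rho * eps n w + V n.+1 w.
Hypothesis X0_exp : exists s C, 0 < s /\ mean_le P (fun w => expR (s * X 0%N w ^+ 2)) C.
Hypothesis eps0_exp : exists s C, 0 < s /\ mean_le P (fun w => expR (s * eps 0%N w ^+ 2)) C.

Let Z1 n w := Num.sqrt n%:R / b n * (theta_hat X n w - theta_star theta rho).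
Let Z2 n w := Num.sqrt n%:R / b n * (rho_hat X n w - rho_star theta rho).
Let dq := dual_qform (sigma2_theta theta rho) (theta * rho * sigma2_theta theta rho)
  (sigma2_rho theta rho).

Let a0 := sigma2_theta_gt0 htheta hrho.
Let disc0 := Gamma_disc_gt0 htheta hrho hne.

Lemma measurable_scaled_theta_hat n : measurable_fun setT (Z1 n).
Proof.
by apply: measurable_funM => //; apply: measurable_funB => //; exact: measurable_theta_hat.
Qed.

Lemma measurable_scaled_rho_hat n : measurable_fun setT (Z2 n).
Proof.
by apply: measurable_funM => //; apply: measurable_funB => //; exact: measurable_rho_hat.
Qed.

Lemma superexp_estimators k L : 0 < k -> L < k ->
  superexp P (fun n => b n ^+ 2) L [set z | dq (Z1 z.1 z.2) (Z2 z.1 z.2) < k].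
Proof.
move=> k0 Lk; apply: (superexp_dual_qform_lt (speed_oo b_oo) a0 disc0
  (D := log_tilt b theta rho sigma V)) => //.
- by move=> l1 l2; apply: log_tilt_le.
- by move=> L' l1 l2; apply: log_tilt_cvg.
Qed.

(** Tilting by the slope [Gamma^-1 x] moves the centre to [x], at cost [qform (Gamma^-1 x)], which
    is the dual form at [x]. *)
Lemma estimators_lower_bound x1 x2 de eta : 0 < de -> 0 < eta ->
  \forall n \near \oo, ((expR (- (dq x1 x2 + eta) * b n ^+ 2))%:E <=
    P [set w | (`|Z1 n w - x1| < de)%R /\ (`|Z2 n w - x2| < de)%R])%E.
Proof.
move=> de0 eta0.
have := tilted_lower_bound (speed_oo b_oo) a0 disc0 measurable_scaled_theta_hat
  measurable_scaled_rho_hat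
  (log_tilt_le b_oo theta rho sigma0 hindep hnormal)
  (log_tilt_ge b_oo theta rho sigma0 hindep hnormal)
  (log_tilt_sqr b_oo b_small htheta hrho sigma0 hindep hnormal)
  (log_tilt_cvg b_gt0 b_oo b_small htheta hrho sigma0 hindep hnormal hX heps X0_exp eps0_exp)
  (dual1 (sigma2_theta theta rho) (theta * rho * sigma2_theta theta rho)
     (sigma2_rho theta rho) x1 x2)
  (dual2 (sigma2_theta theta rho) (theta * rho * sigma2_theta theta rho)
     (sigma2_rho theta rho) x1 x2) de0 eta0.
by rewrite dual_inv1// dual_inv2// -dual_qformE.
Qed.

End moderate_deviations.

Theorem theorem2p2 (R : realType) (d : measure_display) (T : measurableType d)
  (P : probability T R)
  (theta rho sigma : R) (b : nat -> R)
  (X eps V : nat -> {RV P >-> R})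
  (htheta : `|theta| < 1) (hrho : `|rho| < 1) (hsigma : 0 < sigma)
  (* the model *)
  (hX : forall n w, (1 <= n)%N -> X n w = theta * X n.-1 w + eps n w)
  (heps : forall n w, (1 <= n)%N -> eps n w = rho * eps n.-1 w + V n w)
  (hindep : mutually_independent P (fun n w => V n.+1 w))
  (hident : identically_distributed P (fun n w => V n.+1 w))
  (hV2 : (V 1%N : T -> R) \in Lfun P 2%:E)
  (hmean : ('E_P[V 1%N] = 0)%E)
  (hvar : ('V_P[V 1%N] = (sigma ^+ 2)%:E)%E)
  (hX0 : (X 0%N : T -> R) \in Lfun P 2%:E)
  (heps0 : (eps 0%N : T -> R) \in Lfun P 2%:E)
  (* the scale *)
  (hbpos : forall n, (1 <= n)%N -> 0 < b n)
  (hbincr : forall m n, (1 <= m)%N -> (m <= n)%N -> b m <= b n)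
  (hbinfty : b n @[n --> \oo] --> +oo)
  (hbsqrt : b n / Num.sqrt n%:R @[n --> \oo] --> 0)
  (* the assumptions of the theorem *)
  (hnormal : forall A : set R, measurable A ->
     distribution P (V 1%N) A = normal_prob 0 sigma A)
  (hexp : exists2 t : R, 0 < t &
     ('E_P[fun w => expR (t * eps 0%N w ^+ 2)] < +oo)%E /\
     ('E_P[fun w => expR (t * X 0%N w ^+ 2)] < +oo)%E)
  (hne : theta <> - rho) :
  large_deviation_principle P
    (fun n w => (Num.sqrt n%:R / b n) *:
       col2 (theta_hat X n w - theta_star theta rho)
            (rho_hat X n w - rho_star theta rho))
    (fun n => b n ^+ 2) (rate_K theta rho) /\
  large_deviation_principle P
    (fun n w => Num.sqrt n%:R / b n * (rho_hat X n w - rho_star theta rho))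
    (fun n => b n ^+ 2) (rate_rho theta rho).
Proof.
have hV k (A : set R) : measurable A -> distribution P (V k.+1) A = normal_prob 0 sigma A.
  by move=> mA; rewrite -hnormal// /distribution /pushforward (hident k 0%N A mA).
have hX' n w : X n.+1 w = theta * X n w + eps n.+1 w by exact: hX.
have heps' n w : eps n.+1 w = rho * eps n w + V n.+1 w by exact: heps.
have [t t0 [heps_exp hX_exp]] := hexp.
have X0_exp : exists s C, 0 < s /\ mean_le P (fun w => expR (s * X 0%N w ^+ 2)) C.
  by have [C hC] := mean_le_exp_sqr hX_exp; exists t, C.
have eps0_exp : exists s C, 0 < s /\ mean_le P (fun w => expR (s * eps 0%N w ^+ 2)) C.
  by have [C hC] := mean_le_exp_sqr heps_exp; exists t, C.
have a0 := sigma2_theta_gt0 htheta hrho.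
have disc0 := Gamma_disc_gt0 htheta hrho hne.
have voo := speed_oo hbinfty.
have mZ1 := measurable_scaled_theta_hat b theta rho X.
have mZ2 := measurable_scaled_rho_hat b theta rho X.
have upper := superexp_estimators hbpos hbinfty hbsqrt htheta hrho hne hsigma hindep hV hX'
  heps' X0_exp eps0_exp.
have lower := estimators_lower_bound hbpos hbinfty hbsqrt htheta hrho hne hsigma hindep hV
  hX' heps' X0_exp eps0_exp.
split; last exact: (ldp_second voo a0 disc0 mZ1 mZ2 upper lower).
under [X in large_deviation_principle _ X]eq_fun => n do under eq_fun do rewrite scale_col2.
exact: (ldp_pair voo a0 disc0 mZ1 mZ2 upper lower).
Qed.
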